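(* Let $T>0$, $u\in\mathbb R$, $|\rho|<1$ and $0<\lambda<\infty$. Let $X(t)=Z(t)+J(t)$, $t\in[0,T]$, where $Z$ and $J$ are independent, $Z$ is a centered stationary Gaussian process with $C^1$ paths and covariance function $\Gamma(\tau)=\mathbb E Z(0)Z(\tau)$ satisfying $\Gamma(0)=1/2$, and $J$ is a PAR($\rho,\lambda$) process. Then $$\mathbb E U^c_u=T\sqrt{\frac{-\Gamma''(0)}{2\pi}}\,\varphi(u),\qquad \mathbb E U^d_u=\lambda T\,P_\rho(u).$$
   Context: Poisson-auto-regressive process PAR($\rho,\lambda$): let $(\epsilon_n)_{n\ge0}$ be i.i.d. centered Gaussian random variables with variance $1/2$, and set $A_0=\epsilon_0$ and $A_n=\rho A_{n-1}+\sqrt{1-\rho^2}\,\epsilon_n$ for $n\ge1$. Let $\nu=(\nu_t)_{t\ge0}$ be a (simple, homogeneous) Poisson process with intensity $\lambda$, independent of $(\epsilon_n)$. Then $J(t)=A_{\nu_t}$. $\varphi$ is the standard Gaussian density. $P_\rho(u)=\mathbb P(V<u,\,W>u)$, where $(V,W)$ is a centered Gaussian vector with $\mathbb E V^2=\mathbb E W^2=1$ and $\mathbb E VW=(1+\rho)/2$. Note that $-\Gamma''(0)$ is the variance of $\dot Z(0)$. $U^c_u$ is the number of continuous up-crossings of level $u$ by $X$ on $[0,T]$, i.e. of points $s\in(0,T)$ at which $X$ is continuous with $X(s)=u$ and $\dot X(s)>0$. $U^d_u$ is the number of discontinuous up-crossings, i.e. of points $s$ with $X(s^-)<u<X(s)$.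 *)

(* Defs.v *)
From HB Require Import structures.
From mathcomp Require Import all_boot all_order all_algebra.
From mathcomp Require Import all_classical all_reals all_analysis
  measurable_realfun.

Set Implicit Arguments.
Unset Strict Implicit.
Unset Printing Implicit Defensive.

Import Order.TTheory GRing.Theory Num.Theory.
Import numFieldNormedType.Exports.

Local Open Scope classical_set_scope.
Local Open Scope ring_scope.

Definition mutually_independent (R : realType) (d d' : measure_display)
    (Omega : measurableType d) (P : probability Omega R)
    (U : measurableType d') (I : eqType) (X : I -> Omega -> U) : Prop :=
  forall (s : seq I) (B : I -> set U), uniq s ->
    (forall i, measurable (B i)) ->
    P (\bigcap_(i in [set` s]) (X i @^-1` B i)) =
    (\prod_(i <- s) P (X i @^-1` B i))%E.

Definition sigma_of (d d' : measure_display) (Omega : measurableType d)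
    (U : measurableType d') (I : Type) (D : set I) (X : I -> Omega -> U) :
    set (set Omega) :=
  <<s \bigcup_(i in D) preimage_set_system setT (X i) measurable >>.

Definition independent_systems (R : realType) (d : measure_display)
    (Omega : measurableType d) (P : probability Omega R)
    (F G : set (set Omega)) : Prop :=
  forall A B, F A -> G B -> P (A `&` B) = (P A * P B)%E.

Definition has_law (R : realType) (d : measure_display)
    (Omega : measurableType d) (P : probability Omega R)
    (X : Omega -> R) (mu : set R -> \bar R) : Prop :=
  forall B : set R, measurable B -> P (X @^-1` B) = mu B.

(* [normal_prob m 0] is the uniform law on [0, 1], not the Dirac mass at m,
   hence the separate case for degenerate Gaussian laws. *)
Definition gaussian_rv (R : realType) (d : measure_display)
    (Omega : measurableType d) (P : probability Omega R)
    (X : Omega -> R) : Prop :=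
  (exists m, has_law P X (\d_m)) \/
  (exists m s, 0 < s /\ has_law P X (normal_prob m s)).

Definition gaussian_process (R : realType) (d : measure_display)
    (Omega : measurableType d) (P : probability Omega R)
    (D : set R) (Z : R -> Omega -> R) : Prop :=
  forall (n : nat) (t a : 'I_n -> R), (forall i, D (t i)) ->
    gaussian_rv P (fun w => \sum_(i < n) a i * Z (t i) w).

Definition centered_process (R : realType) (d : measure_display)
    (Omega : measurableType d) (P : probability Omega R)
    (D : set R) (Z : R -> Omega -> R) : Prop :=
  forall t, D t -> ('E_P[Z t] = 0)%E.

(* Equality of the finite-dimensional laws is tested on measurable rectangles. *)
Definition stationary_process (R : realType) (d : measure_display)
    (Omega : measurableType d) (P : probability Omega R)
    (D : set R) (Z : R -> Omega -> R) : Prop :=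
  forall (n : nat) (t : 'I_n -> R) (h : R) (B : 'I_n -> set R),
    (forall i, D (t i)) -> (forall i, D (t i + h)) ->
    (forall i, measurable (B i)) ->
    P (\bigcap_i (Z (t i + h) @^-1` B i)) = P (\bigcap_i (Z (t i) @^-1` B i)).

(* Gamma is the covariance function of a centered stationary process on D.
   Taking s = 0 gives E[Z(0) Z(tau)] = Gamma(tau); letting both s and t vary
   makes Gamma two-sided (hence even) on D - D, so that Gamma''(0) only depends
   on Z even when D is an interval whose left end point is 0. *)
Definition covariance_function (R : realType) (d : measure_display)
    (Omega : measurableType d) (P : probability Omega R)
    (D : set R) (Z : R -> Omega -> R) (Gamma : R -> R) : Prop :=
  forall s t, D s -> D t -> ('E_P[Z s * Z t] = (Gamma (t - s)%R)%:E)%E.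

(* f is C^1 on [a, b]: the derivative g on ]a, b[ extends continuously to
   the end points. *)
Definition C1_on (R : realType) (a b : R) (f : R -> R) : Prop :=
  {within `[a, b], continuous f} /\
  exists g : R -> R, {within `[a, b], continuous g} /\
    forall t, a < t < b -> is_derive t 1 f (g t).

(* A simple counting path on [0, +oo[; for nat-valued paths, right-continuity
   is being eventually constant on the right. *)
Definition simple_counting_path (R : realType) (f : R -> nat) : Prop :=
  [/\ f 0 = 0%N,
      forall s t, 0 <= s -> s <= t -> (f s <= f t)%N,
      forall t, 0 <= t -> \forall s \near t^'+, f s = f t
    & forall t, 0 < t -> \forall s \near t^'-, (f t <= (f s).+1)%N].

(* The truncated subtraction is exact since the paths are nondecreasing. *)
Definition poisson_process (R : realType) (d : measure_display)
    (Omega : measurableType d) (P : probability Omega R)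
    (lambda : R) (nu : R -> {RV P >-> nat}) : Prop :=
  [/\ forall w, simple_counting_path (fun t => nu t w),
      forall t : nat -> R, 0 <= t 0%N ->
        (forall i j, (i <= j)%N -> t i <= t j) ->
        mutually_independent P (fun i w => nu (t i.+1) w - nu (t i) w)%N
    & forall (s t : R) (k : nat), 0 <= s -> s < t ->
        P [set w | (nu t w - nu s w)%N = k] =
        (poisson_pmf (lambda * (t - s)) k)%:E].

Fixpoint ar_chain (R : realType) (Omega : Type) (rho : R)
    (eps : nat -> Omega -> R) (n : nat) (w : Omega) : R :=
  match n with
  | 0%N => eps 0%N w
  | m.+1 => rho * ar_chain rho eps m w + Num.sqrt (1 - rho ^+ 2) * eps m.+1 w
  end.

Definition PAR_process (R : realType) (d : measure_display)
    (Omega : measurableType d) (P : probability Omega R)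
    (rho lambda : R) (J : R -> Omega -> R) : Prop :=
  exists (eps : nat -> {RV P >-> R}) (nu : R -> {RV P >-> nat}),
    [/\ mutually_independent P (fun n => eps n : Omega -> R) /\
        (forall n, has_law P (eps n) (normal_prob 0 (Num.sqrt (1 / 2)))),
        poisson_process lambda nu,
        independent_systems P
          (sigma_of setT (fun n => eps n : Omega -> R))
          (sigma_of [set t | 0 <= t] (fun t => nu t : Omega -> nat))
      & forall t w, 0 <= t -> J t w = ar_chain rho eps (nu t w) w].

Definition centered_gaussian_pair (R : realType) (d : measure_display)
    (Omega : measurableType d) (P : probability Omega R)
    (V W : Omega -> R) : Prop :=
  [/\ forall a b : R, gaussian_rv P (fun w => a * V w + b * W w),
      ('E_P[V] = 0)%E & ('E_P[W] = 0)%E].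

Definition continuous_upcrossings (R : realType) (T u : R) (f : R -> R) :
    set R :=
  [set s | [/\ 0 < s < T, {for s, continuous f}, f s = u,
               derivable f s 1 & 0 < derive1 f s]].

Definition discontinuous_upcrossings (R : realType) (T u : R) (f : R -> R) :
    set R :=
  [set s | 0 < s < T /\
           exists l : R, f x @[x --> s^'-] --> l /\ l < u < f s].

Definition nb_cont_up (R : realType) (T u : R) (f : R -> R) : \bar R :=
  counting (continuous_upcrossings T u f).

Definition nb_disc_up (R : realType) (T u : R) (f : R -> R) : \bar R :=
  counting (discontinuous_upcrossings T u f).

(* Main.v *)
Require Import Defs.
From HB Require Import structures.
From mathcomp Require Import all_boot all_order all_algebra.
From mathcomp Require Import all_classical all_reals all_analysis
  measurable_realfun.

From mathcomp Require Import ring lra.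

(* The interval [0, T] is cut into 2^n cells. In a cell [s, t] without jump of
   J, of length h, an up-crossing of u means Z(s) + J(s) < u <= Z(t) + J(s), up
   to an event which becomes negligible once Z(t) - Z(s) is asked to exceed a
   small multiple of h; since Z is independent of J and J(s) has the law of the
   Gaussian chain A, this has the probability of an up-crossing for a standard
   Gaussian pair of correlation r = 1/2 + Gamma(h). Writing such a pair as
   M - D, M + D with M, D independent and Var D = (1 - r)/2, that probability
   is equivalent to h sqrt(-Gamma''(0)) phi(u) / sqrt(2 pi), because
   2 (Gamma(0) - Gamma(h)) / h^2 tends to the variance of Z'(0). In a cell with
   a single jump, which has probability about lambda h, the values before and
   after the jump form a Gaussian pair distributed as (V, W). Summing over the
   cells, the number of cells detected converges pathwise to the number of
   up-crossings (both Z' and the jump times are controlled uniformly on [0, T]),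
   and is dominated by a variable which increases with n and has a bounded
   expectation, whence the convergence of the expectations. *)

Set Implicit Arguments.
Unset Strict Implicit.
Unset Printing Implicit Defensive.
Set SsrOldRewriteGoalsOrder.

Import Order.TTheory GRing.Theory Num.Theory.
Import numFieldNormedType.Exports.

Local Open Scope classical_set_scope.
Local Open Scope ring_scope.

(** * Gaussian integrals *)

(** Two obstacles shape the proof. First, a cell detected from its end values alone need not contain
    an up-crossing in the sense of the definitions: the derivative may vanish at the crossing, or a
    jump may straddle [u] at the end of the cell but not at the jump time. Hence a second parameter
    [m]: a mean slope of at least 1/(m+1) in the continuous case, a margin of 1/(m+1) on both sides
    of [u] in the discontinuous one. For fixed [m] a fine mesh makes every detection genuine, and
    what the margin loses tends to 0 with [m]. Second, Z is independent of the sigma-algebra of J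
    only, and J mixes noise and clock. Events are therefore moved to [Omega * Omega], with Z read on
    the first factor and J on the second; there they are split according to the value k of nu(s),
    and the independence of noise and clock is used on the second factor alone. Laws are compared
    through cosine and sine transforms, which can be computed for Z, for the chain and for (V, W),
    and which determine the probabilities of quadrants. The value of Gamma''(0) comes from a
    mean-square derivative of Z at T/2, extracted from the pathwise one. *)

Section normal_integrals.
Context {R : realType}.
Local Notation mu := (@lebesgue_measure R).
Local Open Scope ereal_scope.

Lemma integral_normal_prob (m s : R) (f : R -> \bar R) :
  (normal_prob m s).-integrable setT f ->
  \int[normal_prob m s]_x f x = \int[mu]_x (f x * (normal_pdf m s x)%:E).
Proof.
move=> intf; have mf := measurable_int _ intf.
rewrite -(Radon_Nikodym_change_of_variables (normal_prob_dominates m s))//=.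
apply: ae_eq_integral => //.
- apply: emeasurable_funM => //; apply: (measurable_int mu).
  by apply: Radon_Nikodym_integrable; exact: normal_prob_dominates.
- apply: emeasurable_funM => //=; apply/measurable_EFinP.
  exact: measurable_normal_pdf.
(* The Radon-Nikodym derivative and the density have the same integral over every measurable set,
   hence agree almost everywhere. *)
- apply: ae_eqe_mul2l => /=.
  rewrite Radon_NikodymE//=; first exact: normal_prob_dominates.
  move=> abmu; case: cid => /= h [h1 h2 h3].
  apply: integral_ae_eq => //=.
  + apply/measurable_EFinP; exact: measurable_normal_pdf.
  + by move=> E _ mE; rewrite -h3.
Qed.

Import HBNNSimple.

(** Simple functions are bounded, hence integrable for a probability, and the change of density
    holds for them; monotone convergence on both sides carries it to every nonnegative [f]. This
    form serves to prove integrability in the first place. *)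
Lemma ge0_integral_normal_prob (m s : R) (f : R -> \bar R) :
  measurable_fun setT f -> (forall x, 0 <= f x) ->
  \int[normal_prob m s]_x f x = \int[mu]_x (f x * (normal_pdf m s x)%:E).
Proof.
move=> mf f0.
have mpdf : measurable_fun setT (fun x => (normal_pdf m s x)%:E).
  by apply/measurable_EFinP; exact: measurable_normal_pdf.
pose g := nnsfun_approx measurableT mf.
have gf x : (g n x)%:E @[n --> \oo] --> f x by exact: cvg_nnsfun_approx.
have gnd x : {homo (fun n => (g n x)%:E) : a b / (a <= b)%N >-> a <= b}.
  by move=> a b ab; rewrite lee_fin; exact/lefP/nd_nnsfun_approx.
have step n : \int[normal_prob m s]_x (g n x)%:E =
              \int[mu]_x ((g n x)%:E * (normal_pdf m s x)%:E).
  apply: integral_normal_prob; apply: measurable_bounded_integrable => //.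
  - by rewrite -ge0_fin_numE// fin_num_measure.
  - exact: (@measurable_funPT _ _ _ _ (g n)).
  - exact: (simple_bounded (g n)).
transitivity (\int[normal_prob m s]_x limn (fun n => (g n x)%:E)).
  by apply: eq_integral => x _; apply/esym/cvg_lim.
rewrite monotone_convergence//; last 2 first.
- by move=> n; apply/measurable_EFinP; exact: (@measurable_funPT _ _ _ _ (g n)).
- by move=> n x _; rewrite lee_fin.
under eq_fun do rewrite step.
rewrite -monotone_convergence//; last 3 first.
- by move=> n; apply: emeasurable_funM => //; apply/measurable_EFinP; exact:
  (@measurable_funPT _ _ _ _ (g n)).
- by move=> n x _; rewrite -EFinM lee_fin mulr_ge0// normal_pdf_ge0.
- by move=> x _ a b ab; rewrite lee_wpmul2r ?lee_fin ?normal_pdf_ge0//; exact: gnd.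
apply: eq_integral => x _; apply/cvg_lim => //.
by apply: cvgeZr.
Qed.

Lemma ge0_integral_has_law d (T : measurableType d) (P : probability T R)
    (X : T -> R) (m : {measure set (measurableTypeR R) -> \bar R}) (f : R -> \bar R) :
  measurable_fun setT X -> has_law P X m ->
  measurable_fun setT f -> (forall x, 0 <= f x) ->
  \int[P]_w f (X w) = \int[m]_x f x.
Proof.
move=> mX lX mf f0.
pose X' : T -> measurableTypeR R := X.
have mX' : measurable_fun setT X' by [].
rewrite (_ : (fun w => f (X w)) = f \o X')//.
rewrite -(preimage_setT X') -(ge0_integral_pushforward mX')//.
apply: eq_measure_integral => //= A mA _.
by rewrite /pushforward -lX.
Qed.

Lemma normal_pdf_affine (m s x : R) : (0 < s)%R ->
  (normal_pdf m s x = normal_pdf 0 1 ((x - m) / s) * s^-1)%R.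
Proof.
move=> s0; rewrite !normal_pdfE ?gt_eqF// /normal_peak /normal_fun.
rewrite subr0 expr1n mul1r -mulrnAr sqrtrM ?sqr_ge0// sqrtr_sqr gtr0_norm//.
have -> : (- (x - m) ^+ 2 / (s ^+ 2 *+ 2) = - ((x - m) / s) ^+ 2 / 2)%R.
  by rewrite -mulr_natr exprMn exprVn invfM !mulNr mulrA.
by rewrite invfM; ring.
Qed.

Lemma ge0_integral_normal_affine (m s : R) (g : R -> R) : (0 < s)%R ->
  continuous g -> (forall x, 0 <= g x)%R ->
  \int[normal_prob m s]_x (g x)%:E =
  \int[normal_prob 0 1]_y (g (m + s * y)%R)%:E.
Proof.
move=> s0 cg g0.
have mg : measurable_fun setT g by exact: continuous_measurable_fun.
have caff : continuous (fun y : R => m + s * y)%R.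
  by move=> y; apply: cvgD; [exact: cvg_cst|apply: cvgM; [exact: cvg_cst|exact: cvg_id]].
have cgaff : continuous (fun y : R => g (m + s * y)%R).
  by move=> y; apply: continuous_comp; [exact: caff|exact: cg].
have mgaff : measurable_fun setT (fun y : R => g (m + s * y)%R).
  exact: continuous_measurable_fun.
have -> : \int[normal_prob m s]_x (g x)%:E =
    \int[mu]_x ((g x)%:E * (normal_pdf m s x)%:E).
  by apply: ge0_integral_normal_prob => [|x]; [exact/measurable_EFinP|rewrite lee_fin].
have -> : \int[normal_prob 0 1]_y (g (m + s * y)%R)%:E =
    \int[mu]_x ((g (m + s * x)%R)%:E * (normal_pdf 0 1 x)%:E).
  by apply: (ge0_integral_normal_prob 0 1 (f := fun y => (g (m + s * y)%R)%:E)) => [|x];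
    [exact/measurable_EFinP|rewrite lee_fin].
(* [F] inverts the affine map. The substitution is made in the integral over the standard variable,
   and its Jacobian 1/s is the factor between the two densities. *)
pose F (x : R) : R := ((x - m) / s)%R.
have dF (x : R) : is_derive x 1%R F s^-1%R.
  have -> : (s^-1 = s^-1 *: 1)%R by rewrite scaler1.
  rewrite /F (_ : (fun x => (x - m) / s)%R = (s^-1 \*: (id - cst m))%R).
    by apply: is_deriveZ; rewrite -[1%R in X in is_derive _ _ _ X]subr0; apply: is_deriveB.
  by apply/funext => z /=; rewrite mulrC.
have F'E : (F^`())%classic = cst (s^-1)%R.
  by apply/funext => x; rewrite derive1E; apply: derive_val.
rewrite -[RHS]/(\int[mu]_y ((g (m + s * y)%R * normal_pdf 0 1 y)%:E)).
rewrite [RHS](increasing_ge0_integration_by_substitutionT (F := F)); last 9 first.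
- by move=> x y xy; rewrite /F ltr_pM2r ?invr_gt0// ltrD2r.
- by rewrite F'E => ?; exact: cvg_cst.
- by rewrite F'E; exact: is_cvg_cst.
- by rewrite F'E; exact: is_cvg_cst.
- by move=> x; apply: ex_derive.
- by apply/gt0_cvgMlNy; [rewrite invr_gt0|exact: cvg_addrr_Ny].
- by apply/gt0_cvgMly; [rewrite invr_gt0|exact: cvg_addrr].
- by move=> y; apply: cvgM; [exact: cgaff|exact: continuous_normal_pdf].
- by move=> x; rewrite mulr_ge0// normal_pdf_ge0.
apply: eq_integral => x _.
rewrite /= F'E /= /F -EFinM; congr EFin.
rewrite fctE /= /cst normal_pdf_affine// [in RHS](mulrC s) divfK ?gt_eqF//.
by rewrite (addrC m) subrK mulrA.
Qed.

Lemma continuous_funepos_EFin (g : R -> R) : continuous g ->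
  continuous (fun x => Num.max (g x) 0)%R.
Proof.
by move=> cg x; apply: (@continuous_max _ _ g (cst 0%R)); [exact: cg|exact: cst_continuous].
Qed.

(** The positive and negative parts of [g] are continuous and nonnegative, so the affine
    substitution applies to each of them, whether or not [g] is integrable. *)
Lemma gaussian_integral d (T : measurableType d) (P : probability T R)
    (X : T -> R) (m s : R) (g : R -> R) :
  measurable_fun setT X -> (0 < s)%R -> has_law P X (normal_prob m s) ->
  continuous g ->
  \int[P]_w (g (X w))%:E = \int[normal_prob 0 1]_y (g (m + s * y)%R)%:E.
Proof.
move=> mX s0 lX cg.
have key (h : R -> R) : continuous h -> (forall x, 0 <= h x)%R ->
   \int[P]_w (h (X w))%:E = \int[normal_prob 0 1]_y (h (m + s * y)%R)%:E.
  move=> ch h0; rewrite -ge0_integral_normal_affine//.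
  rewrite -(@ge0_integral_has_law _ _ P X (normal_prob m s) (EFin \o h))//.
  by apply/measurable_EFinP; exact: continuous_measurable_fun.
rewrite integralE [RHS]integralE; congr (_ - _).
- transitivity (\int[P]_w (Num.max (g (X w)) 0%R)%:E).
    by apply: eq_integral => w _; rewrite funeposE EFin_max.
  rewrite (key (fun x => Num.max (g x) 0%R)).
  + by apply: eq_integral => w _; rewrite funeposE EFin_max.
  + exact: continuous_funepos_EFin.
  + by move=> x; rewrite le_max lexx orbT.
- transitivity (\int[P]_w (Num.max (- g (X w))%R 0%R)%:E).
    by apply: eq_integral => w _; rewrite funenegE EFin_max.
  rewrite (key (fun x => Num.max (- g x)%R 0%R)).
  + by apply: eq_integral => w _; rewrite funenegE EFin_max.
  + by apply: continuous_funepos_EFin => x; apply: cvgN; exact: cg.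
  + by move=> x; rewrite le_max lexx orbT.
Qed.
End normal_integrals.

(** * Moments and characteristic function of the standard normal law *)

Section normal_moments.
Context {R : realType}.
Local Notation mu := (@lebesgue_measure R).
Local Notation phi := (@normal_pdf R 0 1).
Local Notation N := (@normal_prob R 0 1).

(** The fundamental theorem of calculus on the growing intervals [I n] leaves boundary values of
    [F], which vanish in the limit; dominated convergence identifies the same limit with the full
    integral. *)
Lemma integral_derivative_eq0 (f F : R -> R) :
  continuous f -> mu.-integrable setT (EFin \o f) ->
  (forall x : R, is_derive x 1 F (f x)) ->
  F n%:R @[n --> \oo] --> (0 : R) -> F (- n%:R) @[n --> \oo] --> (0 : R) ->
  (\int[mu]_x (f x)%:E = 0)%E.
Proof.
move=> cf intf dF Fn0 FNn0.
pose I n : set R := `[- n.+1%:R, n.+1%:R]%classic.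
have FTC n : (\int[mu]_(x in I n) (f x)%:E = (F n.+1%:R - F (- n.+1%:R))%:E)%E.
  rewrite (continuous_FTC2 (F := F))//; first by rewrite gtrN.
  - exact: continuous_subspaceT.
  - have cF x : {for x, continuous F}.
      by apply: differentiable_continuous; apply/derivable1_diffP; exact: ex_derive.
    split.
    + by move=> x _; exact: ex_derive.
    + exact/cvg_at_right_filter/cF.
    + exact/cvg_at_left_filter/cF.
  - by move=> x _; rewrite derive1E; apply: derive_val.
have lim0 : (\int[mu]_(x in I n) (f x)%:E)%E @[n --> \oo] --> (0 : \bar R)%E.
  under eq_fun do rewrite FTC.
  apply: cvg_EFin; first exact: nearW.
  rewrite -[X in _ --> X](subr0 0); apply: cvgB.
    by rewrite (cvg_shiftS (fun n => F n%:R)).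
  by rewrite (cvg_shiftS (fun n => F (- n%:R))).
have limf : (\int[mu]_(x in I n) (f x)%:E)%E @[n --> \oo] --> (\int[mu]_x (f x)%:E)%E.
  under eq_fun do rewrite integral_mkcond.
  have mf : measurable_fun setT f by exact: continuous_measurable_fun.
  have [] // := @dominated_convergence _ _ _ mu setT measurableT
    (fun n => (EFin \o f) \_ (I n)) (EFin \o f) (fun x => `|f x|%:E).
  - move=> n; apply: (measurable_restrictT (EFin \o f) _).1; first exact: measurable_itv.
    by apply: (@measurable_funS _ _ _ _ setT) => //; exact: (measurable_int _ intf).
  - exact/measurable_EFinP.
  - apply: aeW => x _ /=.
    have [n0 xn0] : exists n0 : nat, `|x| <= n0%:R.
      by exists (Num.bound `|x|); apply/ltW/archi_boundP.
    apply: (@cvg_near_cst _ _ _ _ _).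
    exists n0 => // n /= n0n; rewrite patchE mem_set// /I /= in_itv/= -ler_norml.
    by rewrite (le_trans xn0)// ler_nat ltnW// ltnS.
  - exact: integrable_norm.
  - apply: aeW => x n _ /=; rewrite patchE; case: ifPn => _ //=.
    by rewrite normr0 lee_fin.
exact: (cvg_unique _ limf lim0).
Qed.

Lemma normal_pdf01E x : phi x = normal_peak 1 * expR (- x ^+ 2 / 2).
Proof. by rewrite normal_pdfE// /normal_fun subr0 expr1n. Qed.

Lemma is_derive_normal_pdf01 (x : R) : is_derive x 1 phi (- x * phi x).
Proof.
have -> : phi = normal_peak 1 \*: (fun x => expR (- x ^+ 2 / 2)).
  by apply/funext => y; rewrite normal_pdf01E.
apply: is_derive_eq.
by rewrite /GRing.scale /= /GRing.scale /= -exprVn; field.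
Qed.

Lemma integrable_normal_prob_pdf (f : R -> R) : measurable_fun setT f ->
  (N.-integrable setT (EFin \o f) <->
   mu.-integrable setT (fun x => (f x * phi x)%:E)).
Proof.
move=> mf.
have eqi : (\int[N]_x `|(f x)%:E| = \int[mu]_x `|(f x * phi x)%:E|)%E.
  rewrite ge0_integral_normal_prob//.
    by apply: eq_integral => x _; rewrite /= normrM EFinM (ger0_norm (normal_pdf_ge0 _ _ _)).
  by apply/measurable_EFinP; apply: measurableT_comp.
split => /integrableP[_ h]; apply/integrableP; split.
- by apply/measurable_EFinP; apply: measurable_funM => //; exact: measurable_normal_pdf.
- by rewrite -eqi.
- exact/measurable_EFinP.
- by rewrite eqi.
Qed.

Lemma integrable_normal_bounded (f : R -> R) (M : R) : measurable_fun setT f ->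
  (forall x, `|f x| <= M) -> N.-integrable setT (EFin \o f).
Proof.
move=> mf fM; apply: measurable_bounded_integrable => //.
  by rewrite -ge0_fin_numE// fin_num_measure.
exists M; split; first exact: num_real.
by move=> z /ltW Mx y _; apply: le_trans Mx.
Qed.

Lemma integrable_normal_sq : N.-integrable setT (fun x => (x ^+ 2)%:E).
Proof.
apply/(integrable_normal_prob_pdf (f := fun x => x ^+ 2)).
  exact: exprn_measurable.
(* x^2 exp(-x^2/2) is 4 exp(-x^2/4) times (x^2/4) exp(-x^2/4), and the last factor is at most 1.
   What remains is a multiple of the normal density of variance 2; [c] adjusts the peaks. *)
pose c : R := 4 * (normal_peak 1 / normal_peak (Num.sqrt 2)).
apply: (@le_integrable _ _ _ mu _ measurableT _ (fun x => (c * normal_pdf 0 (Num.sqrt 2) x)%:E)).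
- apply/measurable_EFinP; apply: measurable_funM; first exact: exprn_measurable.
  exact: measurable_normal_pdf.
- move=> x _ /=; rewrite lee_fin [leLHS]ger0_norm; last by rewrite mulr_ge0 ?sqr_ge0 ?normal_pdf_ge0.
  have c0 : 0 <= c by rewrite /c !mulr_ge0 ?invr_ge0 ?normal_peak_ge0.
  rewrite [leRHS]ger0_norm; last by rewrite mulr_ge0// normal_pdf_ge0.
  rewrite normal_pdf01E normal_pdfE ?gt_eqF// /normal_fun subr0 sqr_sqrtr//.
  have -> : expR (- x ^+ 2 / 2) = expR (- (x ^+ 2 / 4)) * expR (- (x ^+ 2 / 4)).
    by rewrite -expRD; congr expR; field.
  have -> : - x ^+ 2 / (2 *+ 2) = - (x ^+ 2 / 4) by field.
  have p2 : normal_peak (Num.sqrt 2) != 0 :> R.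
    by rewrite gt_eqF// normal_peak_gt0// gt_eqF.
  rewrite /c.
  have -> : 4 * (normal_peak 1 / normal_peak (Num.sqrt 2)) *
    (normal_peak (Num.sqrt 2) * expR (- (x ^+ 2 / 4))) =
     4 * normal_peak 1 * expR (- (x ^+ 2 / 4)) by field.
  have -> : x ^+ 2 * (normal_peak 1 * (expR (- (x ^+ 2 / 4)) * expR (- (x ^+ 2 / 4)))) =
     (x ^+ 2 / 4 * expR (- (x ^+ 2 / 4))) * (4 * normal_peak 1 * expR (- (x ^+ 2 / 4))) by field.
  rewrite ler_piMl// ?mulr_ge0 ?expR_ge0 ?normal_peak_ge0//.
  rewrite expRN ler_pdivrMr ?expR_gt0// mul1r.
  by rewrite (le_trans _ (expR_ge1Dx _))// lerDr.
- under eq_fun do rewrite EFinM.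
  apply: integrableZl => //; exact: integrable_normal_pdf.
Qed.

Lemma integrable_normal_id : N.-integrable setT (fun x => x%:E).
Proof.
apply: (@le_integrable _ _ _ N _ measurableT _ (fun x => (1 + x ^+ 2)%:E)).
- exact/measurable_EFinP.
- move=> x _ /=; rewrite lee_fin [leRHS]ger0_norm ?addr_ge0 ?sqr_ge0//.
  by rewrite -(real_normK (num_real x)); have := sqr_ge0 (`|x| - 1/2); nra.
- under eq_fun do rewrite EFinD.
  apply: integrableD => //; last exact: integrable_normal_sq.
  apply: (@integrable_normal_bounded (cst 1) 1) => // x.
  by rewrite normr1.
Qed.

(** From exp(x^2/2) >= 1 + x^2/2 and (1 + |x|)^2 <= 6 (1 + x^2/2). *)
Lemma normal_pdf01_tail (x : R) : (1 + `|x|) * phi x <= 6 * normal_peak 1 * (1 + `|x|)^-1.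
Proof.
have x1 : 0 < 1 + `|x| by rewrite ltr_wpDr.
rewrite ler_pdivlMr// normal_pdf01E mulNr expRN -(real_normK (num_real x)).
set E := expR _.
have E0 : 0 < E by exact: expR_gt0.
have hE : 1 + `|x| ^+ 2 / 2 <= E by exact: expR_ge1Dx.
have p0 := normal_peak_ge0 (1 : R).
have -> : (1 + `|x|) * (normal_peak 1 / E) * (1 + `|x|) =
    normal_peak 1 * (1 + `|x|) ^+ 2 / E by field; rewrite gt_eqF.
rewrite ler_pdivrMr// (mulrC 6) -mulrA ler_wpM2l//.
have := sqr_ge0 (`|x| - 1); nra.
Qed.

Lemma cvg0_normal_tail (F : R -> R) : (forall x, `|F x| <= (1 + `|x|) * phi x) ->
  F x @[x --> +oo] --> (0 : R).
Proof.
move=> hF; apply/cvgr0Pnorm_le => e e0; near=> x.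
rewrite (le_trans (hF _))// (le_trans (normal_pdf01_tail _))//.
have x0 : 0 <= x by near: x; exact: nbhs_pinfty_ge.
rewrite ler_pdivrMr ?ltr_wpDr// ger0_norm// mulrDr mulr1 -lerBlDl.
by rewrite -ler_pdivrMl.
Unshelve. all: by end_near. Qed.

(** Gaussian integration by parts in primitive form. The bound on [F] is chosen wide enough for the
    three kinds of primitives used below: [phi], [x * phi], and a bounded function times [phi]. *)
Lemma integral_normal_derivative (f F : R -> R) :
  continuous f -> N.-integrable setT (EFin \o f) ->
  (forall x : R, is_derive x 1 F (f x * phi x)) ->
  (forall x, `|F x| <= (1 + `|x|) * phi x) ->
  (\int[N]_x (f x)%:E = 0)%E.
Proof.
move=> cf intf dF hF.
have mf : measurable_fun setT f by exact: continuous_measurable_fun.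
rewrite integral_normal_prob//.
have h1 := cvg0_normal_tail hF.
have h2 : F (- x) @[x --> +oo] --> (0 : R).
  apply: (@cvg0_normal_tail (F \o -%R)) => x /=.
  by rewrite (le_trans (hF _))// normrN !normal_pdf01E sqrrN.
apply: (@integral_derivative_eq0 (fun x => f x * phi x) F) => //.
- by move=> x; apply: cvgM; [exact: cf|exact: continuous_normal_pdf].
- exact/integrable_normal_prob_pdf.
- by apply: (cvg_comp _ _ _ h1); exact: cvgr_idn.
- by apply: (cvg_comp _ (fun x => F (- x)) _ h2); exact: cvgr_idn.
Qed.

Lemma normal_mean : (\int[N]_x x%:E = 0)%E.
Proof.
apply: (@integral_normal_derivative id (fun x => - phi x)).
- by move=> x; exact: cvg_id.
- exact: integrable_normal_id.
- move=> x; apply: is_derive_eq; first by apply: is_deriveN; exact: is_derive_normal_pdf01.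
  by rewrite mulNr opprK.
- by move=> x; rewrite normrN ger0_norm ?normal_pdf_ge0// ler_peMl ?normal_pdf_ge0// lerDl.
Qed.

(** [- (x * phi x)] is a primitive of [(x ^+ 2 - 1) * phi x], whose integral is therefore 0. *)
Lemma normal_variance : (\int[N]_x (x ^+ 2)%:E = 1)%E.
Proof.
have : (\int[N]_x (x ^+ 2 - 1)%:E = 0)%E.
  apply: (@integral_normal_derivative (fun x => x ^+ 2 - 1) (fun x => - (x * phi x))).
  - by move=> x; apply: cvgB; [exact: exprn_continuous|exact: cvg_cst].
  - rewrite (_ : EFin \o _ = (fun x => (x ^+ 2)%:E - 1%:E)%E)//.
    apply: integrableB => //; first exact: integrable_normal_sq.
    by apply: (@integrable_normal_bounded (cst 1) 1) => // x; rewrite normr1.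
  - move=> x; have d := is_derive_normal_pdf01 x.
    apply: is_derive_eq.
    by rewrite -![_ *: _]/(_ * _) /=; ring.
  - move=> x; rewrite normrN normrM (ger0_norm (normal_pdf_ge0 _ _ _)).
    by rewrite ler_wpM2r ?normal_pdf_ge0// lerDr.
under eq_integral do rewrite EFinB.
rewrite integralB//; last 2 first.
- exact: integrable_normal_sq.
- by apply: (@integrable_normal_bounded (cst 1) 1) => // x; rewrite normr1.
rewrite integral_cst// [X in (1 * X)%E](@probability_setT _ _ _ N) mule1.
by move/(congr1 (fun z => z + 1)%E); rewrite subeK// add0e.
Qed.

(** This is the origin of the factor 1/sqrt(2 pi) in the continuous formula: only positive
    increments of Z cross upwards, and they enter through the mean of their positive part. *)
Lemma normal_positive_part : (\int[N]_x (Num.max x 0)%:E = (normal_peak 1)%:E)%E.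
Proof.
have mm : measurable_fun setT (fun x : R => Num.max x 0).
  by apply: measurable_maxr.
rewrite ge0_integral_normal_prob//; last 2 first.
- exact/measurable_EFinP.
- by move=> x; rewrite lee_fin le_max lexx orbT.
transitivity (\int[mu]_(x in `[0%R, +oo[) (x * phi x)%:E)%E.
  rewrite [RHS]integral_mkcond; apply: eq_integral => x _.
  rewrite patchE; case: ifPn.
    by rewrite inE/= in_itv/= andbT => x0; rewrite max_l.
  by rewrite notin_setE/= in_itv/= andbT => /negP; rewrite -ltNge => x0; rewrite max_r ?ltW// mul0e.
have h1 : - phi x @[x --> +oo] --> (0 : R).
  apply: cvg0_normal_tail => x.
  by rewrite normrN ger0_norm ?normal_pdf_ge0// ler_peMl ?normal_pdf_ge0// lerDl.
rewrite (@ge0_continuous_FTC2y _ (fun x => x * phi x) (fun x => - phi x) 0 0).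
- by rewrite normal_pdf01E expr0n/= oppr0 mul0r expR0 mulr1 opprK add0e.
- by move=> x x0; rewrite mulr_ge0 ?normal_pdf_ge0.
- by apply: continuous_subspaceT => x; apply: cvgM; [exact: cvg_id|exact: continuous_normal_pdf].
- exact: h1.
- by move=> x _; apply: ex_derive; apply: is_deriveN; exact: is_derive_normal_pdf01.
- by apply: cvg_at_right_filter; apply: cvgN; exact: continuous_normal_pdf.
- move=> x _; rewrite derive1E; have d := is_derive_normal_pdf01 x.
  by rewrite deriveN// derive_val mulNr opprK.
Qed.

(* As a function of a, the integral solves y' = - a y: differentiate under the
   integral sign, then integrate by parts. *)
Lemma normal_oscillation (h h' : R -> R) (a : R) :
  (forall x : R, is_derive x 1 h (h' x)) -> (forall x : R, is_derive x 1 h' (- h x)) ->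
  (forall x, `|h x| <= 1) -> (forall x, `|h' x| <= 1) ->
  \int[N]_x h (a * x) = h 0 * expR (- a ^+ 2 / 2).
Proof.
move=> dh dh' h1 h'1.
have ch : continuous h.
  by move=> x; apply: differentiable_continuous; apply/derivable1_diffP; exact: ex_derive.
have ch' : continuous h'.
  by move=> x; apply: differentiable_continuous; apply/derivable1_diffP; exact: ex_derive.
have cmul (b : R) : continuous (fun x : R => b * x).
  by move=> x; apply: cvgM; [exact: cvg_cst|exact: cvg_id].
have chm (b : R) : continuous (fun x : R => h (b * x)).
  by move=> x; apply: continuous_comp; [exact: cmul|exact: ch].
have ch'm (b : R) : continuous (fun x : R => h' (b * x)).
  by move=> x; apply: continuous_comp; [exact: cmul|exact: ch'].
have dmul (b x : R) : is_derive x 1 ( *%R b) b.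
  by have := is_deriveZ (f := id) b (is_derive_id x 1); rewrite /GRing.scale /= mulr1.
have dmul' (b x : R) : is_derive x 1 ( *%R^~ b) b.
  rewrite (_ : *%R^~ b = *%R b); first exact: dmul.
  by apply/funext => y; rewrite mulrC.
have ih (b : R) : N.-integrable setT (EFin \o (fun x : R => h (b * x))).
  by apply: (@integrable_normal_bounded _ 1) => //; exact: continuous_measurable_fun.
pose G (b : R) : R := \int[N]_x h (b * x).
have dhb (b y : R) : is_derive b 1 (fun c => h (c * y)) (y * h' (b * y)).
  by rewrite mulrC; apply: (@is_derive1_comp _ h ( *%R^~ y) b _ y); exact: dmul'.
have ixh' (b : R) : N.-integrable setT (EFin \o (fun x => x * h' (b * x))).
  apply: le_integrable integrable_normal_id => //.
    apply/measurable_EFinP; apply: measurable_funM => //.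
    exact: continuous_measurable_fun.
  by move=> x _ /=; rewrite lee_fin normrM ler_piMr.
have dG (b : R) : is_derive b 1 G (- b * G b).
  have Ib : `]b - 1, b + 1[%classic b by rewrite /= in_itv/= ltrBlDr ltrDl ltr01.
  have hder (x y : R) : derivable ((fun c z : R => h (c * z)) ^~ y) x 1.
    exact: (@ex_derive _ _ _ _ _ _ _ (dhb x y)).
  have p1 (x y : R) : partial1of2 (fun c z : R => h (c * z)) x y = y * h' (x * y).
    by rewrite partial1of2E; apply: (@derive_val _ _ _ _ _ _ _ (dhb x y)).
  have iabs : N.-integrable setT (EFin \o (fun x : R => `|x|)).
    exact: integrable_norm integrable_normal_id.
  have bnd (x y : R) : `]b - 1, b + 1[%classic x -> [set: R] y ->
      `|partial1of2 (fun c z : R => h (c * z)) x y| <= `|y|.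
    by move=> _ _; rewrite p1 normrM ler_piMr.
  have der := @derivable_under_integral _ _ _ N (fun c y => h (c * y)) setT measurableT
    b (b - 1) (b + 1) Ib (fun x _ => ih x) (fun x y _ _ => hder x y) (fun y => `|y|)
    (fun y => normr_ge0 y) iabs bnd.
  have derE := @differentiation_under_integral _ _ _ N (fun c y => h (c * y)) setT measurableT
    b (b - 1) (b + 1) Ib (fun x _ => ih x) (fun x y _ _ => hder x y) (fun y => `|y|)
    (fun y => normr_ge0 y) iabs bnd.
  apply: DeriveDef => //.
  rewrite -derive1E [LHS]derE.
  (* Since h'' = - h, the function [- (h' (b * x) * phi x)] is a primitive of this integrand times
     [phi x]. *)
  have key : (\int[N]_x ((b * h (b * x) + x * h' (b * x)))%:E = 0)%E.
    apply: (@integral_normal_derivative _ (fun x => - (h' (b * x) * phi x))).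
    - by move=> x; apply: cvgD; apply: cvgM; [exact: cvg_cst|exact: chm|exact: cvg_id|exact: ch'm].
    - rewrite (_ : EFin \o _ = (fun x => b%:E * (h (b * x))%:E + (x * h' (b * x))%:E)%E)//.
      apply: integrableD => //; last exact: ixh'.
      exact: (@integrableZl _ _ _ N _ measurableT b _ (ih b)).
    - move=> x; have d1 := is_derive_normal_pdf01 x.
      have d2 : is_derive x 1 (fun x : R => h' (b * x)) (b * - h (b * x)).
        by rewrite mulrC; apply: (@is_derive1_comp _ h' ( *%R b) x _ b).
      by apply: is_derive_eq; rewrite /GRing.scale /= /GRing.scale /=; ring.
    - move=> x; rewrite normrN normrM (ger0_norm (normal_pdf_ge0 _ _ _)).
      by rewrite ler_wpM2r ?normal_pdf_ge0// (le_trans (h'1 _))// lerDl.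
  under eq_Rintegral do rewrite p1.
  have : b * G b + \int[N]_y (y * h' (b * y)) = 0.
    rewrite -RintegralZl; [|exact: measurableT|exact: ih].
    rewrite -RintegralD; [|exact: measurableT| |exact: ixh']; last first.
      exact: (@integrableZl _ _ _ N _ measurableT b _ (ih b)).
    by rewrite /Rintegral key.
  by move=> /eqP; rewrite addrC addr_eq0 => /eqP ->; rewrite mulNr.
(* The integrating factor exp(b^2/2) turns G' = - b G into K' = 0. *)
pose K (b : R) : R := G b * expR (b ^+ 2 / 2).
have dK (b : R) : is_derive b 1 K 0.
  have dGb := dG b.
  have dE : is_derive b 1 (fun b => expR (b ^+ 2 / 2)) (b * expR (b ^+ 2 / 2)).
    rewrite mulrC; apply: (@is_derive1_comp _ expR (fun b => b ^+ 2 / 2) b _ b).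
    by apply: is_derive_eq; rewrite /GRing.scale /=; field.
  by apply: is_derive_eq; rewrite /GRing.scale /=; ring.
have := @is_derive_0_is_cst _ K a 0 dK.
rewrite /K expr0n/= mul0r expR0 mulr1.
have -> : G 0 = h 0.
  rewrite /G; under eq_Rintegral do rewrite mul0r.
  rewrite Rintegral_cst//= (_ : fine _ = 1) ?mulr1//.
  by rewrite (_ : N setT = 1%E)//; exact: probability_setT.
move=> <-; rewrite -/(G a) -mulrA -expRD mulNr addrN expR0 mulr1//.
Qed.

Lemma normal_cos (a : R) : \int[N]_x cos (a * x) = expR (- a ^+ 2 / 2).
Proof.
rewrite (normal_oscillation (h' := fun x => - sin x)) ?cos0 ?mul1r//.
- by move=> x; exact: cos_max.
- by move=> x; rewrite normrN; exact: sin_max.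
Qed.

Lemma normal_sin (a : R) : \int[N]_x sin (a * x) = 0.
Proof.
rewrite (normal_oscillation (h' := cos)) ?sin0 ?mul0r//.
- by move=> x; exact: sin_max.
- by move=> x; exact: cos_max.
Qed.

End normal_moments.

(** * Uniqueness from cosine and sine transforms *)

Section bounded_integrals.
Context {R : realType} d (T : measurableType d) (m : {measure set T -> \bar R}).

Lemma finite_integrable_bounded (f : T -> R) (M : R) : (m setT < +oo)%E ->
  measurable_fun setT f -> (forall x, `|f x| <= M) -> m.-integrable setT (EFin \o f).
Proof.
move=> mfin mf fM; apply: measurable_bounded_integrable => //.
exists M; split; first exact: num_real.
by move=> z /ltW Mx y _; apply: le_trans Mx.
Qed.

Lemma EFin_Rintegral (f : T -> R) : m.-integrable setT (EFin \o f) ->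
  ((\int[m]_x f x)%R%:E = \int[m]_x (f x)%:E)%E.
Proof. by move=> intf; rewrite /Rintegral fineK// integrable_fin_num. Qed.

Lemma dominated_cvg_Rintegral (f_ : nat -> T -> R) (f g : T -> R) :
  (forall n, measurable_fun setT (f_ n)) -> (forall x, f_ n x @[n --> \oo] --> f x) ->
  m.-integrable setT (EFin \o g) -> (forall n x, `|f_ n x| <= g x) ->
  \int[m]_x f_ n x @[n --> \oo] --> \int[m]_x f x.
Proof.
move=> mf_ f_f ig f_g.
have mf : measurable_fun setT f.
  by apply: (@measurable_fun_cvg _ _ _ _ f_) => // x _; exact: f_f.
have [] := @dominated_convergence _ _ _ m setT measurableT (fun n => EFin \o f_ n)
  (EFin \o f) (EFin \o g).
- by move=> n; exact/measurable_EFinP.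
- exact/measurable_EFinP.
- by apply: aeW => x _; apply: cvg_EFin; [exact: nearW|exact: f_f].
- exact: ig.
- by apply: aeW => x n _; rewrite lee_fin.
move=> intf _ cv; apply: fine_cvg; rewrite EFin_Rintegral//.
Qed.

End bounded_integrals.

Lemma integrable_bounded {R : realType} d (T : measurableType d) (P : probability T R)
    (f : T -> R) (M : R) : measurable_fun setT f ->
  (forall x, `|f x| <= M) -> P.-integrable setT (EFin \o f).
Proof.
by apply: finite_integrable_bounded; rewrite -ge0_fin_numE// fin_num_measure.
Qed.

Lemma product_probability_finite {R : realType} d (T : measurableType d) (P : probability T R)
    d' (T' : measurableType d') (P' : probability T' R) : ((P \x P')%E setT < +oo)%E.
Proof.
rewrite -setXTT product_measure1E// -ge0_fin_numE ?mule_ge0//.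
by apply: fin_numM; apply: fin_num_measure.
Qed.

Section Rintegral_Fubini.
Context {R : realType} d (T : measurableType d) (P : probability T R)
  d' (T' : measurableType d') (P' : probability T' R).

Lemma bounded_Fubini (f : T * T' -> R) (M : R) : measurable_fun setT f ->
  (forall x, `|f x| <= M) ->
  \int[P]_x \int[P']_y f (x, y) = \int[P']_y \int[P]_x f (x, y).
Proof.
move=> mf fM.
have intf : (P \x P')%E.-integrable setT (EFin \o f).
  by apply: finite_integrable_bounded fM => //; exact: product_probability_finite.
have := @Fubini _ _ _ _ _ P P' (EFin \o f) intf => /(congr1 fine).
have -> : (\int[P]_x \int[P']_y (EFin \o f) (x, y) =
          \int[P]_x (\int[P']_y f (x, y))%:E)%E.
  apply: eq_integral => x _; rewrite EFin_Rintegral//.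
  apply: (@integrable_bounded _ _ _ _ _ M) => //.
  by apply: measurableT_comp => //; exact: measurable_pair1.
have -> // : (\int[P']_y \int[P]_x (EFin \o f) (x, y) =
          \int[P']_y (\int[P]_x f (x, y))%:E)%E.
apply: eq_integral => x _; rewrite EFin_Rintegral//.
apply: (@integrable_bounded _ _ _ _ _ M) => //.
by apply: measurableT_comp => //; exact: measurable_pair2.
Qed.

End Rintegral_Fubini.

Lemma measurable_cosr (R : realType) : measurable_fun setT (@cos R).
Proof. by apply: continuous_measurable_fun; exact: continuous_cos. Qed.

Lemma measurable_sinr (R : realType) : measurable_fun setT (@sin R).
Proof. by apply: continuous_measurable_fun; exact: continuous_sin. Qed.

(** * Smoothing of half-line indicators by narrow Gaussian kernels *)

Section smoothing.
Context {R : realType}.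
Local Notation mu := (@lebesgue_measure R).
Local Notation N := (@normal_prob R 0 1).

(** The Gaussian shape is its own Fourier transform: the kernel is an average of cosines. This
    explicit identity does the work of an inversion formula. *)
Lemma normal_pdf_cos (x s p : R) : 0 < s ->
  normal_pdf x s p = normal_peak s * \int[N]_a cos ((x - p) / s * a).
Proof.
move=> s0; rewrite normal_cos normal_pdfE ?gt_eqF// /normal_fun; congr (_ * expR _).
by rewrite exprMn exprVn -(sqrrN (x - p)) opprB -mulr_natr invfM !mulNr mulrA.
Qed.

Lemma measurable_normal_pdf2 (s : R) : 0 < s ->
  measurable_fun setT (fun z : R * R => normal_pdf z.1 s z.2).
Proof.
move=> s0; rewrite (_ : (fun z : R * R => _) =
  (fun z => normal_pdf 0 s (z.2 - z.1))).
  apply: measurableT_comp; first exact: measurable_normal_pdf.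
  by apply: measurable_funB; [exact: measurable_snd|exact: measurable_fst].
by apply/funext => z; rewrite !normal_pdfE ?gt_eqF// /normal_fun subr0.
Qed.

Lemma measurable_far (x e : R) : measurable [set p : R | e <= `|p - x|].
Proof.
rewrite -[X in measurable X]setTI.
have : measurable_fun setT (fun p : R => `|p - x|).
  by apply: measurableT_comp => //; exact: measurable_funB.
by move=> /(_ measurableT `[e, +oo[%classic (measurable_itv _)); rewrite preimage_itvcy.
Qed.

(** Chebyshev: the indicator is dominated by ((p - x)/e)^2, whose integral is (s/e)^2. *)
Lemma normal_prob_tail (x s e : R) : 0 < s -> 0 < e ->
  (normal_prob x s [set p : R | e <= `|p - x|]%R <= ((s / e) ^+ 2)%:E)%E.
Proof.
move=> s0 e0.
have mA := @measurable_far x e.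
rewrite -[X in (normal_prob x s X <= _)%E]setIT -integral_indic//.
have -> : ((s / e) ^+ 2)%:E = (\int[normal_prob x s]_p (((p - x) / e) ^+ 2)%:E)%E.
  rewrite (@ge0_integral_normal_affine _ x s (fun p => ((p - x) / e) ^+ 2))//; last first.
  - by move=> y; rewrite sqr_ge0.
  - move=> y; apply: (@continuous_comp _ _ _ (fun y => (y - x) / e) (fun y => y ^+ 2)).
      by apply: cvgM; [apply: cvgB; [exact: cvg_id|exact: cvg_cst]|exact: cvg_cst].
    exact: exprn_continuous.
  transitivity (\int[N]_y (((s / e) ^+ 2)%:E * (y ^+ 2)%:E))%E.
    rewrite ge0_integralZl ?lee_fin ?sqr_ge0//.
    - by rewrite normal_variance mule1.
    - by apply/measurable_EFinP; exact: exprn_measurable.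
    - by move=> y _; rewrite lee_fin sqr_ge0.
  apply: eq_integral => y _; rewrite -EFinM; congr EFin; field.
  by rewrite gt_eqF.
apply: ge0_le_integral => //.
- by apply/measurable_EFinP; exact: measurable_indic.
- apply/measurable_EFinP; apply: (measurableT_comp (f := fun y : R => y ^+ 2)).
    exact: exprn_measurable.
  by apply: measurable_funM => //; exact: measurable_funB.
- move=> p _; rewrite lee_fin indicE; case: (boolP (p \in _)) => [|_]; last by rewrite sqr_ge0.
  rewrite inE/= => ep; rewrite -(real_normK (num_real _)) normrM normfV (gtr0_norm e0).
  by rewrite exprn_ege1// ler_pdivlMr// mul1r.
Qed.

(** The standard deviation 1/(n+1)^2 is small compared with the shift 1/(n+1) of the threshold, so
    the kernel centered at x ends up entirely on one side. The shift also gives the limit 0 at x =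
    u, and the convergence holds at every point. *)
Lemma cvg_normal_halfline (u x : R) :
  fine (normal_prob x (n.+1%:R^-1 ^+ 2) `]-oo, u - n.+1%:R^-1[) @[n --> \oo] --> (\1_`]-oo, u[ x : R).
Proof.
pose s (n : nat) : R := n.+1%:R^-1 ^+ 2.
pose v (n : nat) : R := u - n.+1%:R^-1.
have s0 n : 0 < s n by rewrite exprn_gt0// invr_gt0.
have e0 n : 0 < n.+1%:R^-1 :> R by rewrite invr_gt0.
have sE n : s n / n.+1%:R^-1 = n.+1%:R^-1 by rewrite /s expr2 mulfK// gt_eqF.
have tail n : fine (normal_prob x (s n) [set p : R | n.+1%:R^-1 <= `|p - x|]) <= n.+1%:R^-1 ^+ 2.
  rewrite -lee_fin fineK; last by rewrite fin_num_measure//; exact: measurable_far.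
  by rewrite -[in leRHS]sE; exact: normal_prob_tail.
have lim0 : n.+1%:R^-1 ^+ 2 @[n --> \oo] --> (0 : R).
  rewrite -[X in _ --> X](mulr0 0); under eq_fun do rewrite expr2.
  by apply: cvgM; exact: cvg_harmonic.
have lim1 : 1 - n.+1%:R^-1 ^+ 2 @[n --> \oo] --> (1 : R).
  by rewrite -[X in _ --> X](subr0 1); apply: cvgB => //; exact: cvg_cst.
rewrite indicE; case: (boolP (x \in _)) => [|]; rewrite ?inE ?notin_setE /= in_itv/=.
- move=> xu; have ux0 : 0 < (u - x) / 2 by rewrite divr_gt0// subr_gt0.
  apply: (@squeeze_cvgr _ _ _ _ (fun n => 1 - n.+1%:R^-1 ^+ 2) (cst 1) _ _ _ lim1 (cvg_cst _));
    near=> n.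
  have hn : n.+1%:R^-1 < (u - x) / 2.
    by near: n; exact: (near_infty_natSinv_lt (PosNum ux0)).
  apply/andP; split; last first.
    by rewrite -lee_fin fineK ?fin_num_measure// probability_le1.
  rewrite lerBlDr -lerBlDl (le_trans _ (tail n))//.
  rewrite -lee_fin EFinB !fineK ?fin_num_measure//; last exact: measurable_far.
  rewrite -[X in (X <= _)%E](@probability_setC _ _ _ (normal_prob x (s n)))//.
  apply: le_measure; rewrite ?inE//; [exact: measurableC|exact: measurable_far|].
  move=> p /=; rewrite in_itv/= /v => /negP; rewrite -leNgt => pv.
  have en := e0 n; have key (e q : R) : 0 < e -> e < (u - x) / 2 -> u - e <= q -> e <= `|q - x|.
    by move=> ? ? uq; rewrite ger0_norm; lra.
  exact: key.
- move=> /negP; rewrite -leNgt => ux.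
  apply: (@squeeze_cvgr _ _ _ _ (cst 0) (fun n => n.+1%:R^-1 ^+ 2) _ _ _ (cvg_cst _) lim0);
    apply: nearW => n.
  rewrite fine_ge0//= (le_trans _ (tail n))// fine_le ?fin_num_measure//.
    exact: measurable_far.
  apply: le_measure; rewrite ?inE//; first exact: measurable_far.
  move=> p /=; rewrite in_itv/= /v => pv.
  have en := e0 n; have key (e q : R) : 0 < e -> q < u - e -> e <= `|q - x|.
    by move=> ? uq; rewrite ler0_norm; lra.
  exact: key.
Unshelve. all: by end_near. Qed.

Context d (T : measurableType d) (P : probability T R).
Variables (X w : T -> R).
Hypotheses (mX : measurable_fun setT X) (mw : measurable_fun setT w).
Hypothesis w1 : forall t, `|w t| <= 1.

Let msc (f : R -> R) (a : R) : continuous f -> measurable_fun setT (fun t => f (a * X t)).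
Proof.
move=> cf; apply: (measurableT_comp (f := f)); first exact: continuous_measurable_fun.
by apply: measurable_funM.
Qed.

(** Real and imaginary parts of the characteristic function of the signed law of [X] weighted by
    [w]. In the applications the weight is a function of a second variable, which reduces uniqueness
    in dimension two to dimension one. *)
Definition cos_weight (a : R) := \int[P]_t (w t * cos (a * X t)).
Definition sin_weight (a : R) := \int[P]_t (w t * sin (a * X t)).

Let iwc a : P.-integrable setT (EFin \o (fun t => w t * cos (a * X t))).
Proof.
apply: (@integrable_bounded _ _ _ _ _ 1).
  by apply: measurable_funM => //; apply: msc; exact: continuous_cos.
by move=> t; rewrite normrM mulr_ile1// cos_max.
Qed.

Let iws a : P.-integrable setT (EFin \o (fun t => w t * sin (a * X t))).
Proof.
apply: (@integrable_bounded _ _ _ _ _ 1).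
  by apply: measurable_funM => //; apply: msc; exact: continuous_sin.
by move=> t; rewrite normrM mulr_ile1// sin_max.
Qed.

(** The kernel is replaced by its average of cosines, the integrals are exchanged, and the addition
    formula separates [X t] from [p]. The right-hand side depends on [X] and [w] through the two
    transforms only. *)
Lemma smoothed_density (s p : R) : 0 < s ->
  \int[P]_t (w t * normal_pdf (X t) s p) =
  normal_peak s * \int[N]_a (cos (p / s * a) * cos_weight (a / s) +
                             sin (p / s * a) * sin_weight (a / s)).
Proof.
move=> s0.
pose f (z : T * R) := w z.1 * cos ((X z.1 - p) / s * z.2).
have mf : measurable_fun setT f.
  apply: measurable_funM; first by apply: measurableT_comp => //; exact: measurable_fst.
  apply: (measurableT_comp (@measurable_cosr R)).
  apply: measurable_funM; last exact: measurable_snd.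
  apply: measurable_funM => //; apply: measurable_funB => //.
  by apply: measurableT_comp => //; exact: measurable_fst.
have f1 z : `|f z| <= 1 by rewrite normrM mulr_ile1// cos_max.
have := bounded_Fubini P N mf f1.
have -> : \int[P]_x \int[N]_y f (x, y) =
    \int[P]_x (w x * \int[N]_a cos ((X x - p) / s * a)).
  apply: eq_Rintegral => t _; rewrite -RintegralZl//.
  apply: (@integrable_bounded _ _ _ _ _ 1).
    apply: (measurableT_comp (@measurable_cosr R)).
    exact: measurable_funM.
  by move=> a; exact: cos_max.
have -> : \int[N]_y \int[P]_x f (x, y) =
    \int[N]_a (cos (p / s * a) * cos_weight (a / s) + sin (p / s * a) * sin_weight (a / s)).
  apply: eq_Rintegral => a _; rewrite /cos_weight /sin_weight.
  rewrite -RintegralZl// -RintegralZl// -RintegralD//.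
  - apply: eq_Rintegral => t _; rewrite /f /=.
    rewrite (_ : (X t - p) / s * a = a / s * X t + - (p / s * a)); last first.
      by field; rewrite gt_eqF.
    by rewrite cosD cosN sinN; ring.
  - exact: (@integrableZl _ _ _ P _ measurableT _ _ (iwc _)).
  - exact: (@integrableZl _ _ _ P _ measurableT _ _ (iws _)).
move=> <-; rewrite -RintegralZl//.
  by apply: eq_Rintegral => t _; rewrite normal_pdf_cos//; ring.
apply: (@integrable_bounded _ _ _ _ _ 1).
  apply: measurable_funM => //.
  rewrite (_ : (fun x => _) = (fun t => normal_pdf 0 s (p - X t) / normal_peak s)).
    apply: measurable_funM => //; apply: measurableT_comp; first exact: measurable_normal_pdf.
    exact: measurable_funB.
  apply/funext => t; rewrite normal_cos normal_pdfE ?gt_eqF// /normal_fun subr0.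
  rewrite [RHS]mulrC mulKf ?gt_eqF ?normal_peak_gt0 ?gt_eqF//; congr expR.
  by field; rewrite gt_eqF.
move=> t; rewrite normrM mulr_ile1// normal_cos ger0_norm ?expR_ge0//.
by rewrite -[leRHS]expR0 ler_expR mulNr oppr_le0 divr_ge0 ?sqr_ge0.
Qed.

(** Fubini between [P] and Lebesgue measure; integrability on the product holds because every kernel
    has mass 1 and the weight is bounded by 1. *)
Lemma smoothed_halfline (s v : R) : 0 < s ->
  \int[P]_t (w t * fine (normal_prob (X t) s `]-oo, v[)) =
  \int[mu]_(p in `]-oo, v[) \int[P]_t (w t * normal_pdf (X t) s p).
Proof.
move=> s0.
pose f (z : T * R) := w z.1 * (normal_pdf (X z.1) s z.2 * \1_`]-oo, v[ z.2).
have mpdf : measurable_fun setT (fun z : T * R => normal_pdf (X z.1) s z.2).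
  rewrite (_ : (fun z : T * R => _) = (fun z => normal_pdf z.1 s z.2) \o (fun z => (X z.1, z.2)));
    last by [].
  apply: measurableT_comp; first exact: measurable_normal_pdf2.
  apply: measurable_fun_pair; last exact: measurable_snd.
  by apply: measurableT_comp => //; exact: measurable_fst.
have mf : measurable_fun setT f.
  apply: measurable_funM; first by apply: measurableT_comp => //; exact: measurable_fst.
  by apply: measurable_funM => //; apply: measurableT_comp;
    [exact: measurable_indic|exact: measurable_snd].
have intf : (P \x mu)%E.-integrable setT (EFin \o f).
  apply/integrable12ltyP; first exact/measurable_EFinP.
  apply: (@le_lt_trans _ _ (\int[P]_x 1)%E); last first.
    by rewrite integral_cst// mul1e -ge0_fin_numE// fin_num_measure.
  apply: ge0_le_integral => //.
  - by move=> t _; exact: integral_ge0.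
  - have mabs : measurable_fun setT (fun z => `|(f z)%:E|%E).
      by apply/measurable_EFinP; apply: measurableT_comp.
    exact: (@measurable_fun_fubini_tonelli_F _ _ _ _ _ mu _ mabs (fun z => abse_ge0 _)).
  - move=> t _; rewrite -(@integral_normal_pdf R (X t) s).
    apply: ge0_le_integral => //.
    + apply/measurable_EFinP; apply: measurableT_comp => //.
      exact: measurable_fun_pair2.
    + by apply/measurable_EFinP; exact: measurable_normal_pdf.
    + move=> p _ /=; rewrite lee_fin normrM (le_trans (ler_piMl _ _))//.
      rewrite normrM (ger0_norm (normal_pdf_ge0 _ _ _)) ler_piMr ?normal_pdf_ge0//.
      by rewrite indicE; case: (_ \in _); rewrite ?normr1 ?normr0.
have := @Fubini _ _ _ _ _ P mu (EFin \o f) intf => /(congr1 fine).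
have -> : (\int[P]_x \int[mu]_y (EFin \o f) (x, y) =
          \int[P]_x (w x * fine (normal_prob (X x) s `]-oo, v[))%:E)%E.
  apply: eq_integral => x _.
  rewrite EFinM fineK ?fin_num_measure//.
  have -> : normal_prob (X x) s `]-oo, v[ =
      (\int[mu]_y (normal_pdf (X x) s y * \1_`]-oo, v[ y)%:E)%E.
    rewrite /normal_prob integral_mkcond; apply: eq_integral => y _.
    by rewrite patchE indicE; case: (_ \in _); rewrite ?mulr1 ?mulr0.
  rewrite -integralZl//.
  apply: le_integrable (integrable_normal_pdf (X x) s) => //.
    apply/measurable_EFinP; apply: measurable_funM; last exact: measurable_indic.
    exact: measurable_normal_pdf.
  move=> p _ /=; rewrite lee_fin normrM ler_piMr//.
  by rewrite indicE; case: (_ \in _); rewrite ?normr1 ?normr0.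
have -> : (\int[mu]_y \int[P]_x (EFin \o f) (x, y) =
          \int[mu]_(p in `]-oo, v[) (\int[P]_t (w t * normal_pdf (X t) s p))%:E)%E.
  rewrite [RHS]integral_mkcond; apply: eq_integral => p _.
  rewrite patchE /f /= indicE; case: ifPn => _; last first.
    by under eq_integral do rewrite !mulr0; rewrite integral0.
  under eq_integral do rewrite mulr1.
  rewrite EFin_Rintegral//; apply: (@integrable_bounded _ _ _ _ _ (normal_peak s)).
    by apply: measurable_funM => //; exact: (measurable_fun_pair1 p mpdf).
  move=> t; rewrite normrM (le_trans (ler_piMl _ _))// ger0_norm ?normal_pdf_ge0//.
  by apply: normal_pdf_ub; rewrite gt_eqF.
by [].
Qed.

Lemma measurable_normal_halfline (s v : R) : 0 < s ->
  measurable_fun setT (fun t => fine (normal_prob (X t) s `]-oo, v[)).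
Proof.
move=> s0; apply/measurable_EFinP.
pose f (z : T * R) := (normal_pdf (X z.1) s z.2 * \1_`]-oo, v[ z.2)%:E.
have mf : measurable_fun setT f.
  apply/measurable_EFinP; apply: measurable_funM.
    rewrite (_ : (fun z : T * R => _) = (fun z => normal_pdf z.1 s z.2) \o (fun z => (X z.1,
      z.2))); last by [].
    apply: measurableT_comp; first exact: measurable_normal_pdf2.
    apply: measurable_fun_pair; last exact: measurable_snd.
    by apply: measurableT_comp => //; exact: measurable_fst.
  by apply: measurableT_comp; [exact: measurable_indic|exact: measurable_snd].
have f0 z : (0 <= f z)%E.
  by rewrite lee_fin mulr_ge0 ?normal_pdf_ge0// indicE.
have := @measurable_fun_fubini_tonelli_F _ _ _ _ _ mu f mf f0.
apply: eq_measurable_fun => t _.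
rewrite /= fineK ?fin_num_measure// /normal_prob [RHS]integral_mkcond.
apply: eq_integral => y _.
by rewrite patchE /f /= indicE; case: (_ \in _); rewrite ?mulr1 ?mulr0.
Qed.

Lemma cvg_smoothed_halfline (u : R) :
  let s (n : nat) : R := n.+1%:R^-1 ^+ 2 in
  let v (n : nat) : R := u - n.+1%:R^-1 in
  \int[P]_t (w t * fine (normal_prob (X t) (s n) `]-oo, v n[)) @[n --> \oo] -->
  \int[P]_t (w t * \1_`]-oo, u[ (X t)).
Proof.
move=> s v.
have s0 n : 0 < s n by rewrite exprn_gt0// invr_gt0.
have e0 n : 0 < n.+1%:R^-1 :> R by rewrite invr_gt0.
have sE n : s n / n.+1%:R^-1 = n.+1%:R^-1 by rewrite /s expr2 mulfK// gt_eqF.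
apply: (@dominated_cvg_Rintegral _ _ _ _ _ _ (cst 1)).
- by move=> n; apply: measurable_funM => //; exact: measurable_normal_halfline.
- by move=> t; apply: cvgM; [exact: cvg_cst|exact: cvg_normal_halfline].
- by apply: (@integrable_bounded _ _ _ _ _ 1) => // t; rewrite normr1.
- move=> n t; rewrite normrM mulr_ile1// ger0_norm ?fine_ge0//.
  by rewrite -lee_fin fineK ?fin_num_measure// probability_le1.
Qed.

End smoothing.

Section uniqueness.
Context {R : realType} d1 (T1 : measurableType d1) (P1 : probability T1 R)
  d2 (T2 : measurableType d2) (P2 : probability T2 R).

(* Smoothing the law of X weighted by w with a small Gaussian gives a density
   which is a Gaussian mixture of cos_weight and sin_weight. *)
Lemma weighted_trig_unique (X1 w1 : T1 -> R) (X2 w2 : T2 -> R) :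
  measurable_fun setT X1 -> measurable_fun setT w1 -> (forall t, `|w1 t| <= 1) ->
  measurable_fun setT X2 -> measurable_fun setT w2 -> (forall t, `|w2 t| <= 1) ->
  (forall a, cos_weight P1 X1 w1 a = cos_weight P2 X2 w2 a) ->
  (forall a, sin_weight P1 X1 w1 a = sin_weight P2 X2 w2 a) ->
  forall u, \int[P1]_t (w1 t * \1_`]-oo, u[ (X1 t)) =
            \int[P2]_t (w2 t * \1_`]-oo, u[ (X2 t)).
Proof.
move=> mX1 mw1 bw1 mX2 mw2 bw2 eqc eqs u.
have c1 := @cvg_smoothed_halfline _ _ _ P1 X1 w1 mX1 mw1 bw1 u.
have c2 := @cvg_smoothed_halfline _ _ _ P2 X2 w2 mX2 mw2 bw2 u.
apply: (@cvg_unique _ (@Rhausdorff R) _ _ _ _ c1); apply: cvg_trans c2; apply: near_eq_cvg;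
  apply: nearW => n.
have s0 : 0 < n.+1%:R^-1 ^+ 2 :> R by rewrite exprn_gt0// invr_gt0.
rewrite !smoothed_halfline//; apply: eq_Rintegral => p _.
rewrite !smoothed_density//; congr (_ * _); apply: eq_Rintegral => a _.
by rewrite eqc eqs.
Qed.

End uniqueness.

Section trigonometric_weights.
Context {R : realType} d (T : measurableType d) (P : probability T R).
Variables (X Y : T -> R).
Hypotheses (mX : measurable_fun setT X) (mY : measurable_fun setT Y).

Let mlin (a b : R) : measurable_fun setT (fun t => a * X t + b * Y t).
Proof. by apply: measurable_funD; apply: measurable_funM. Qed.

Lemma integrable_cos_comp (f : T -> R) : measurable_fun setT f ->
  P.-integrable setT (EFin \o (fun t => cos (f t))).
Proof.
move=> mf; apply: (@integrable_bounded _ _ _ _ _ 1).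
  by apply: (measurableT_comp (@measurable_cosr R)).
by move=> t; exact: cos_max.
Qed.

Lemma integrable_sin_comp (f : T -> R) : measurable_fun setT f ->
  P.-integrable setT (EFin \o (fun t => sin (f t))).
Proof.
move=> mf; apply: (@integrable_bounded _ _ _ _ _ 1).
  by apply: (measurableT_comp (@measurable_sinr R)).
by move=> t; exact: sin_max.
Qed.

Let half (f g : T -> R) (c : R) : P.-integrable setT (EFin \o f) ->
  P.-integrable setT (EFin \o g) ->
  \int[P]_t (2^-1 * f t + c * g t) = 2^-1 * \int[P]_t f t + c * \int[P]_t g t.
Proof.
move=> intf intg; rewrite RintegralD//.
- by rewrite !RintegralZl.
- exact: (@integrableZl _ _ _ P _ measurableT _ _ intf).
- exact: (@integrableZl _ _ _ P _ measurableT _ _ intg).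
Qed.

Let C a b := \int[P]_t cos (a * X t + b * Y t).
Let S a b := \int[P]_t sin (a * X t + b * Y t).

(** Product-to-sum formulas, here and in the next three lemmas: trigonometric weights in [Y] are
    expressed by the joint transforms at (a, b) and (a, -b). *)
Lemma cos_weight_cos a b :
  cos_weight P X (fun t => cos (b * Y t)) a = 2^-1 * C a b + 2^-1 * C a (- b).
Proof.
rewrite -half; [|exact: integrable_cos_comp..].
by apply: eq_Rintegral => t _; rewrite (mulNr b) !cosD cosN sinN; field.
Qed.

Lemma sin_weight_cos a b :
  sin_weight P X (fun t => cos (b * Y t)) a = 2^-1 * S a b + 2^-1 * S a (- b).
Proof.
rewrite -half; [|exact: integrable_sin_comp..].
by apply: eq_Rintegral => t _; rewrite (mulNr b) !sinD cosN sinN; field.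
Qed.

Lemma cos_weight_sin a b :
  cos_weight P X (fun t => sin (b * Y t)) a = 2^-1 * S a b + - 2^-1 * S a (- b).
Proof.
rewrite -half; [|exact: integrable_sin_comp..].
by apply: eq_Rintegral => t _; rewrite (mulNr b) !sinD cosN sinN; field.
Qed.

Lemma sin_weight_sin a b :
  sin_weight P X (fun t => sin (b * Y t)) a = 2^-1 * C a (- b) + - 2^-1 * C a b.
Proof.
rewrite -half; [|exact: integrable_cos_comp..].
by apply: eq_Rintegral => t _; rewrite (mulNr b) !cosD cosN sinN; field.
Qed.

End trigonometric_weights.

Section bivariate_uniqueness.
Context {R : realType} d1 (T1 : measurableType d1) (P1 : probability T1 R)
  d2 (T2 : measurableType d2) (P2 : probability T2 R).

Let measurable_indic_lt d (T : measurableType d) (X : T -> R) u :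
  measurable_fun setT X -> measurable_fun setT (fun t => \1_`]-oo, u[ (X t) : R).
Proof.
move=> mX; apply: (@measurableT_comp _ _ _ _ _ _ (\1_`]-oo, u[ : R -> R)) => //.
Qed.

Let indic_le1 (u x : R) : `|\1_`]-oo, u[ x : R| <= 1.
Proof. by rewrite indicE; case: (_ \in _); rewrite ?normr1 ?normr0. Qed.

Let quadrantE d (T : measurableType d) (P : probability T R) (X Y : T -> R) u v :
  measurable_fun setT X -> measurable_fun setT Y ->
  P [set t | X t < u /\ Y t < v] =
  (\int[P]_t (\1_`]-oo, u[ (X t) * \1_`]-oo, v[ (Y t)))%:E.
Proof.
move=> mX mY; rewrite EFin_Rintegral; last first.
  apply: (@integrable_bounded _ _ _ _ _ 1).
    by apply: measurable_funM; exact: measurable_indic_lt.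
  by move=> t; rewrite normrM mulr_ile1// indic_le1.
have mS : measurable [set t | X t < u /\ Y t < v].
  rewrite (_ : [set t | _] = X @^-1` `]-oo, u[ `&` Y @^-1` `]-oo, v[); last first.
    by apply/seteqP; split => t /=; rewrite !in_itv.
  by apply: measurableI; [rewrite -[X in measurable X]setTI; exact: mX|
    rewrite -[X in measurable X]setTI; exact: mY].
rewrite -[X in P X]setIT -integral_indic//; apply: eq_integral => t _; congr EFin.
rewrite !indicE -natrM mulnb; congr (nat_of_bool _)%:R.
by apply/idP/andP => [|[]]; rewrite !inE/= !in_itv/=.
Qed.

(** One-dimensional uniqueness is used twice. With weights cos(bY) and sin(bY) it yields the
    half-line indicator of [X]; this indicator then serves as the weight, and the equalities just
    obtained say that the transforms in [Y] agree. *)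
Lemma trig_unique2 (X1 Y1 : T1 -> R) (X2 Y2 : T2 -> R) :
  measurable_fun setT X1 -> measurable_fun setT Y1 ->
  measurable_fun setT X2 -> measurable_fun setT Y2 ->
  (forall a b, \int[P1]_t cos (a * X1 t + b * Y1 t) = \int[P2]_t cos (a * X2 t + b * Y2 t)) ->
  (forall a b, \int[P1]_t sin (a * X1 t + b * Y1 t) = \int[P2]_t sin (a * X2 t + b * Y2 t)) ->
  forall u v, P1 [set t | X1 t < u /\ Y1 t < v] = P2 [set t | X2 t < u /\ Y2 t < v].
Proof.
move=> mX1 mY1 mX2 mY2 eqc eqs u v.
have mcos d (T : measurableType d) (Y : T -> R) b : measurable_fun setT Y ->
    measurable_fun setT (fun t => cos (b * Y t)).
  by move=> mY; apply: (measurableT_comp (@measurable_cosr R)); exact: measurable_funM.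
have msin d (T : measurableType d) (Y : T -> R) b : measurable_fun setT Y ->
    measurable_fun setT (fun t => sin (b * Y t)).
  by move=> mY; apply: (measurableT_comp (@measurable_sinr R)); exact: measurable_funM.
have stepc b : \int[P1]_t (cos (b * Y1 t) * \1_`]-oo, u[ (X1 t)) =
               \int[P2]_t (cos (b * Y2 t) * \1_`]-oo, u[ (X2 t)).
  apply: weighted_trig_unique => //; try exact: mcos; try by move=> t; exact: cos_max.
  - by move=> a; rewrite !cos_weight_cos// !eqc.
  - by move=> a; rewrite !sin_weight_cos// !eqs.
have steps b : \int[P1]_t (sin (b * Y1 t) * \1_`]-oo, u[ (X1 t)) =
               \int[P2]_t (sin (b * Y2 t) * \1_`]-oo, u[ (X2 t)).
  apply: weighted_trig_unique => //; try exact: msin; try by move=> t; exact: sin_max.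
  - by move=> a; rewrite !cos_weight_sin// !eqs.
  - by move=> a; rewrite !sin_weight_sin// !eqc.
rewrite !quadrantE//; congr EFin.
apply: weighted_trig_unique => //; try exact: measurable_indic_lt; try by move=> t; exact: indic_le1.
- move=> b; rewrite /cos_weight.
  under eq_Rintegral do rewrite mulrC.
  by under [RHS]eq_Rintegral do rewrite mulrC.
- move=> b; rewrite /sin_weight.
  under eq_Rintegral do rewrite mulrC.
  by under [RHS]eq_Rintegral do rewrite mulrC.
Qed.

End bivariate_uniqueness.

(** * Gaussian pairs *)

Section measurable_comparison.
Context {R : realType} d (T : measurableType d).

Lemma measurable_set_ltr (f g : T -> R) : measurable_fun setT f -> measurable_fun setT g ->
  measurable [set t | f t < g t].
Proof.
move=> mf mg; have mb := measurable_fun_ltr mf mg.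
rewrite (_ : [set t | _] = setT `&` (fun t => f t < g t) @^-1` [set true]); first exact: mb.
by rewrite setTI; apply/seteqP; split => t.
Qed.

Lemma measurable_set_ler (f g : T -> R) : measurable_fun setT f -> measurable_fun setT g ->
  measurable [set t | f t <= g t].
Proof.
move=> mf mg; have mb := measurable_fun_ler mf mg.
rewrite (_ : [set t | _] = setT `&` (fun t => f t <= g t) @^-1` [set true]); first exact: mb.
by rewrite setTI; apply/seteqP; split => t.
Qed.

End measurable_comparison.

Section product_probability.
Context {R : realType} d1 (T1 : measurableType d1) (P1 : probability T1 R)
  d2 (T2 : measurableType d2) (P2 : probability T2 R).

(** A name of its own for the product measure, so that the probability structure declared below can
    be attached to it. *)
Definition product_prob : set (T1 * T2) -> \bar R := (P1 \x P2)%E.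

HB.instance Definition _ := Measure.on product_prob.

Let product_prob_setT : product_prob setT = 1%E.
Proof.
rewrite /product_prob -setXTT product_measure1E//.
transitivity (1 * 1 : \bar R)%E; last by rewrite mule1.
by congr (_ * _)%E; exact: probability_setT.
Qed.

HB.instance Definition _ :=
  @Measure_isProbability.Build _ _ R product_prob product_prob_setT.

Lemma Rintegral_product_prob (f : T1 * T2 -> R) (M : R) : measurable_fun setT f ->
  (forall x, `|f x| <= M) ->
  \int[product_prob]_z f z = \int[P1]_x \int[P2]_y f (x, y).
Proof.
move=> mf fM.
have intf : (P1 \x P2)%E.-integrable setT (EFin \o f).
  by apply: finite_integrable_bounded fM => //; exact: product_probability_finite.
rewrite /Rintegral -(integral12_prod_meas1 intf); congr fine.
apply: eq_integral => x _; rewrite EFin_Rintegral//.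
apply: (@integrable_bounded _ _ _ _ _ M) => //.
exact: measurable_fun_pair2.
Qed.

Section trig.
Variables (f : T1 -> R) (g : T2 -> R).
Hypotheses (mf : measurable_fun setT f) (mg : measurable_fun setT g).

Let mfg : measurable_fun setT (fun z : T1 * T2 => f z.1 + g z.2).
Proof.
by apply: measurable_funD; [exact: (measurableT_comp mf measurable_fst)|
  exact: (measurableT_comp mg measurable_snd)].
Qed.

Lemma product_cos :
  \int[product_prob]_z cos (f z.1 + g z.2) =
  \int[P1]_x cos (f x) * \int[P2]_y cos (g y) - \int[P1]_x sin (f x) * \int[P2]_y sin (g y).
Proof.
rewrite (@Rintegral_product_prob _ 1); last 2 first.
- exact: (measurableT_comp (@measurable_cosr R) mfg).
- by move=> z; exact: cos_max.
transitivity (\int[P1]_x (\int[P2]_y cos (g y) * cos (f x) - \int[P2]_y sin (g y) * sin (f x))).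
  apply: eq_Rintegral => x _ /=.
  rewrite mulrC (mulrC (\int[P2]_y sin _)) -!RintegralZl//;
    [|exact: integrable_sin_comp|exact: integrable_cos_comp].
  rewrite -RintegralB//.
  - by apply: eq_Rintegral => y _; rewrite cosD.
  - exact: (@integrableZl _ _ _ P2 _ measurableT _ _ (integrable_cos_comp _ mg)).
  - exact: (@integrableZl _ _ _ P2 _ measurableT _ _ (integrable_sin_comp _ mg)).
rewrite RintegralB//.
- rewrite !RintegralZl//; [|exact: integrable_sin_comp|exact: integrable_cos_comp].
  by congr (_ - _); rewrite mulrC.
- exact: (@integrableZl _ _ _ P1 _ measurableT _ _ (integrable_cos_comp _ mf)).
- exact: (@integrableZl _ _ _ P1 _ measurableT _ _ (integrable_sin_comp _ mf)).
Qed.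

Lemma product_sin :
  \int[product_prob]_z sin (f z.1 + g z.2) =
  \int[P1]_x sin (f x) * \int[P2]_y cos (g y) + \int[P1]_x cos (f x) * \int[P2]_y sin (g y).
Proof.
rewrite (@Rintegral_product_prob _ 1); last 2 first.
- exact: (measurableT_comp (@measurable_sinr R) mfg).
- by move=> z; exact: sin_max.
transitivity (\int[P1]_x (\int[P2]_y cos (g y) * sin (f x) + \int[P2]_y sin (g y) * cos (f x))).
  apply: eq_Rintegral => x _ /=.
  rewrite mulrC (mulrC (\int[P2]_y sin _)) -!RintegralZl//;
    [|exact: integrable_sin_comp|exact: integrable_cos_comp].
  rewrite -RintegralD//.
  - by apply: eq_Rintegral => y _; rewrite sinD.
  - exact: (@integrableZl _ _ _ P2 _ measurableT _ _ (integrable_cos_comp _ mg)).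
  - exact: (@integrableZl _ _ _ P2 _ measurableT _ _ (integrable_sin_comp _ mg)).
rewrite RintegralD//.
- rewrite !RintegralZl//; [|exact: integrable_cos_comp|exact: integrable_sin_comp].
  by congr (_ + _); rewrite mulrC.
- exact: (@integrableZl _ _ _ P1 _ measurableT _ _ (integrable_sin_comp _ mf)).
- exact: (@integrableZl _ _ _ P1 _ measurableT _ _ (integrable_cos_comp _ mf)).
Qed.
End trig.

End product_probability.

(** * Characteristic functions of Gaussian variables and pairs *)

Section gaussian_trigonometric.
Context {R : realType} d (T : measurableType d) (P : probability T R).
Local Notation N := (@normal_prob R 0 1).

Lemma has_law_dirac_ae (X : T -> R) (m : R) : measurable_fun setT X ->
  has_law P X (\d_m) -> {ae P, forall t, X t = m}.
Proof.
move=> mX lX; exists (~` (X @^-1` [set m])); split.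
- by apply: measurableC; rewrite -[X in measurable X]setTI; exact: mX.
- rewrite probability_setC; last by rewrite -[X in measurable X]setTI; exact: mX.
  by rewrite lX// diracE mem_set// subee.
- by move=> t /= /[swap] h; apply; exact: h.
Qed.

(** The parameters of the law are identified from the first two moments: m = 0, then v = 0 for a
    Dirac mass and v = s^2 for a normal law. The degenerate case agrees with the same formula. *)
Lemma gaussian_rv_trig (X : T -> R) (v : R) : measurable_fun setT X ->
  gaussian_rv P X -> ('E_P[X] = 0)%E -> ('E_P[X ^+ 2] = v%:E)%E ->
  0 <= v /\ \int[P]_t cos (X t) = expR (- v / 2) /\ \int[P]_t sin (X t) = 0.
Proof.
move=> mX gX EX EX2.
have v0 : 0 <= v.
  by rewrite -lee_fin -EX2 unlock integral_ge0// => t _; rewrite lee_fin sqr_ge0.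
split => //; case: gX => [[m lX]|[m [s [s0 lX]]]].
- have ae := has_law_dirac_ae mX lX.
  have aeE (h : R -> R) : measurable_fun setT h -> (\int[P]_t (h (X t))%:E = (h m)%:E)%E.
    move=> mh; transitivity (\int[P]_t (cst (h m)%:E) t)%E.
      apply: ae_eq_integral => //.
      - by apply/measurable_EFinP; exact: measurableT_comp.
      - by apply: filterS ae => t -> _.
    by rewrite integral_cst// [X in (_ * X)%E](_ : _ = 1%E) ?mule1//; exact: probability_setT.
  have m0 : m = 0 by move: EX; rewrite unlock (aeE id)// => -[].
  have <- : 0 = v.
    move: EX2; rewrite unlock (aeE (fun x => x ^+ 2)); last exact: exprn_measurable.
    by rewrite m0 expr0n => -[].
  rewrite /Rintegral (aeE cos (@measurable_cosr R)) (aeE sin (@measurable_sinr R)) /= m0.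
  by rewrite cos0 sin0 oppr0 mul0r expR0.
- have gi (h : R -> R) : continuous h ->
      (\int[P]_t (h (X t))%:E = \int[N]_y (h (m + s * y))%:E)%E.
    by move=> ch; exact: gaussian_integral.
  have isy : N.-integrable setT (fun y : R => (s * y)%:E).
    exact: (@integrableZl _ _ _ N _ measurableT s _ integrable_normal_id).
  have icst (c : R) : N.-integrable setT (fun y : R => c%:E).
    by apply: (@integrable_normal_bounded _ (cst c) `|c|).
  have Ncst (c : R) : (\int[N]_y c%:E = c%:E)%E.
    by rewrite integral_cst// [X in (_ * X)%E](_ : _ = 1%E) ?mule1//; exact: probability_setT.
  have Nsy : (\int[N]_y (s * y)%:E = 0)%E.
    under eq_integral do rewrite EFinM.
    by rewrite integralZl//; [rewrite normal_mean mule0|exact: integrable_normal_id].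
  have m0 : m = 0.
    move: EX; rewrite unlock (gi id); last by move=> x; exact: cvg_id.
    under eq_integral do rewrite EFinD.
    by rewrite integralD// Ncst Nsy adde0 => -[].
  move: gi; rewrite m0 => gi.
  have vE : v = s ^+ 2.
    move: EX2; rewrite unlock (gi (fun x => x ^+ 2)); last exact: exprn_continuous.
    under eq_integral do rewrite add0r exprMn EFinM.
    rewrite integralZl//; last exact: integrable_normal_sq.
    by rewrite normal_variance mule1 => -[].
  rewrite /Rintegral (gi cos (@continuous_cos R)) (gi sin (@continuous_sin R)) vE.
  under eq_integral do rewrite add0r.
  under [in X in _ /\ X]eq_integral do rewrite add0r.
  by split; [exact: normal_cos|exact: normal_sin].
Qed.

(** Characteristic function of a centered Gaussian pair with variances [p], [q] and covariance [c].
    This is the common form in which all pairs are compared: it determines the probabilities below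
    and is additive over independent pairs. *)
Definition bivariate_trig (X Y : T -> R) (p c q : R) : Prop :=
  [/\ measurable_fun setT X, measurable_fun setT Y,
      forall a b, \int[P]_t cos (a * X t + b * Y t) =
        expR (- (a ^+ 2 * p + 2 * a * b * c + b ^+ 2 * q) / 2)
    & forall a b, \int[P]_t sin (a * X t + b * Y t) = 0].

Lemma integrable_of_sq (X : T -> R) (p : R) : measurable_fun setT X ->
  ('E_P[X ^+ 2] = p%:E)%E -> P.-integrable setT (fun t => (X t ^+ 2)%:E).
Proof.
move=> mX EX2; apply/integrableP; split.
  by apply/measurable_EFinP; exact: measurable_funX.
under eq_integral do rewrite abse_EFin ger0_norm ?sqr_ge0//.
by move: EX2; rewrite unlock => ->; rewrite ltry.
Qed.

Lemma integrable_of_sq1 (X : T -> R) : measurable_fun setT X ->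
  P.-integrable setT (fun t => (X t ^+ 2)%:E) -> P.-integrable setT (EFin \o X).
Proof.
move=> mX iX; apply: (@le_integrable _ _ _ P _ measurableT _ (fun t => (1 + X t ^+ 2)%:E)).
- exact/measurable_EFinP.
- move=> x _ /=; rewrite lee_fin [leRHS]ger0_norm ?addr_ge0 ?sqr_ge0//.
  by rewrite -(real_normK (num_real (X x))); have := sqr_ge0 (`|X x| - 1/2); nra.
- under eq_fun do rewrite EFinD.
  apply: integrableD => //.
  by apply: (@integrable_bounded _ _ _ P (cst 1) 1) => // x; rewrite normr1.
Qed.

Lemma integrable_product (X Y : T -> R) : measurable_fun setT X -> measurable_fun setT Y ->
  P.-integrable setT (fun t => (X t ^+ 2)%:E) -> P.-integrable setT (fun t => (Y t ^+ 2)%:E) ->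
  P.-integrable setT (fun t => (X t * Y t)%:E).
Proof.
move=> mX mY iX iY.
apply: (@le_integrable _ _ _ P _ measurableT _ (fun t => (X t ^+ 2 + Y t ^+ 2)%:E)).
- by apply/measurable_EFinP; exact: measurable_funM.
- move=> x _ /=; rewrite lee_fin [leRHS]ger0_norm ?addr_ge0 ?sqr_ge0//.
  rewrite ler_norml; have := sqr_ge0 (X x - Y x); have := sqr_ge0 (X x + Y x).
  by have := sqr_ge0 (X x); have := sqr_ge0 (Y x); move=> *; apply/andP; split; nra.
- by under eq_fun do rewrite EFinD; exact: integrableD.
Qed.

Lemma gaussian_pair_trig (X Y : T -> R) (p c q : R) :
  measurable_fun setT X -> measurable_fun setT Y ->
  (forall a b, gaussian_rv P (fun t => a * X t + b * Y t)) ->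
  ('E_P[X] = 0)%E -> ('E_P[Y] = 0)%E ->
  ('E_P[X ^+ 2] = p%:E)%E -> ('E_P[Y ^+ 2] = q%:E)%E -> ('E_P[X * Y] = c%:E)%E ->
  bivariate_trig X Y p c q.
Proof.
move=> mX mY gXY EX EY EX2 EY2 EXY.
have iX2 := integrable_of_sq mX EX2; have iY2 := integrable_of_sq mY EY2.
have iX := integrable_of_sq1 mX iX2; have iY := integrable_of_sq1 mY iY2.
have iXY := integrable_product mX mY iX2 iY2.
have mlin a b : measurable_fun setT (fun t => a * X t + b * Y t).
  by apply: measurable_funD; exact: measurable_funM.
have lin0 a b : ('E_P[(fun t => a * X t + b * Y t)%R] = 0)%E.
  rewrite unlock; under eq_integral do rewrite EFinD.
  rewrite integralD//; [|exact: (@integrableZl _ _ _ P _ measurableT _ _ iX)|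
                         exact: (@integrableZl _ _ _ P _ measurableT _ _ iY)].
  under eq_integral do rewrite EFinM.
  rewrite integralZl//; under [X in (_ + X)%E]eq_integral do rewrite EFinM.
  rewrite integralZl//; move: EX EY; rewrite unlock => -> ->.
  by rewrite !mule0 adde0.
have sq a b : ('E_P[(fun t => a * X t + b * Y t)%R ^+ 2] =
    (a ^+ 2 * p + 2 * a * b * c + b ^+ 2 * q)%:E)%E.
  rewrite unlock.
  transitivity (\int[P]_t ((a ^+ 2)%:E * (X t ^+ 2)%:E + ((2 * a * b)%:E * (X t * Y t)%:E +
     (b ^+ 2)%:E * (Y t ^+ 2)%:E)))%E.
    by apply: eq_integral => t _; rewrite -!EFinM -!EFinD; congr EFin; rewrite !fctE /=; ring.
  have i1 := @integrableZl _ _ _ P _ measurableT (a ^+ 2) _ iX2.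
  have i2 := @integrableZl _ _ _ P _ measurableT (2 * a * b) _ iXY.
  have i3 := @integrableZl _ _ _ P _ measurableT (b ^+ 2) _ iY2.
  rewrite integralD//; last exact: integrableD.
  rewrite integralD// !integralZl//; move: EX2 EY2 EXY; rewrite unlock => -> -> ->.
  by rewrite -!EFinM -!EFinD addrA.
split => // a b.
- by have [_ []] := gaussian_rv_trig (mlin a b) (gXY a b) (lin0 a b) (sq a b).
- by have [_ []] := gaussian_rv_trig (mlin a b) (gXY a b) (lin0 a b) (sq a b).
Qed.

End gaussian_trigonometric.

Section bivariate_events.
Context {R : realType} d1 (T1 : measurableType d1) (P1 : probability T1 R)
  d2 (T2 : measurableType d2) (P2 : probability T2 R).
Variables (X1 Y1 : T1 -> R) (X2 Y2 : T2 -> R) (p c q : R).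
Hypotheses (h1 : bivariate_trig P1 X1 Y1 p c q) (h2 : bivariate_trig P2 X2 Y2 p c q).

Lemma bivariate_gap_unique u v :
  P1 [set t | X1 t < u /\ v < Y1 t] = P2 [set t | X2 t < u /\ v < Y2 t].
Proof.
have [mX1 mY1 c1 s1] := h1; have [mX2 mY2 c2 s2] := h2.
have := @trig_unique2 _ _ _ P1 _ _ P2 X1 (\- Y1) X2 (\- Y2) mX1
  (measurable_funN mY1) mX2 (measurable_funN mY2) _ _ u (- v).
rewrite (_ : [set t | X1 t < u /\ (\- Y1) t < - v] = [set t | X1 t < u /\ v < Y1 t]); last first.
  by apply/seteqP; split => t /=; rewrite ltrN2.
rewrite (_ : [set t | X2 t < u /\ (\- Y2) t < - v] = [set t | X2 t < u /\ v < Y2 t]); last first.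
  by apply/seteqP; split => t /=; rewrite ltrN2.
apply=> a b.
- under eq_Rintegral do rewrite /= mulrN -mulNr.
  by under [RHS]eq_Rintegral do rewrite /= mulrN -mulNr; rewrite c1 c2.
- under eq_Rintegral do rewrite /= mulrN -mulNr.
  by under [RHS]eq_Rintegral do rewrite /= mulrN -mulNr; rewrite s1 s2.
Qed.

(** The event mixes a strict and a weak inequality. It is the difference of {X < u} and the quadrant
    {X < u, Y < u}, both of which are determined. *)
Lemma bivariate_crossing_unique u :
  P1 [set t | X1 t < u /\ u <= Y1 t] = P2 [set t | X2 t < u /\ u <= Y2 t].
Proof.
have [mX1 mY1 c1 s1] := h1; have [mX2 mY2 c2 s2] := h2.
have eqcos a b : \int[P1]_t cos (a * X1 t + b * Y1 t) = \int[P2]_t cos (a * X2 t + b * Y2 t).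
  by rewrite c1 c2.
have eqsin a b : \int[P1]_t sin (a * X1 t + b * Y1 t) = \int[P2]_t sin (a * X2 t + b * Y2 t).
  by rewrite s1 s2.
have q1 := trig_unique2 mX1 mY1 mX2 mY2 eqcos eqsin u u.
have q2 : P1 [set t | X1 t < u] = P2 [set t | X2 t < u].
  (* The marginal law: with 0 as second variable and 1 as its threshold, the second condition always
     holds. *)
  have := @trig_unique2 _ _ _ P1 _ _ P2 X1 (cst 0) X2 (cst 0) mX1
    (measurable_cst _) mX2 (measurable_cst _) _ _ u 1.
  rewrite (_ : [set t | X1 t < u /\ _] = [set t | X1 t < u]); last first.
    by apply/seteqP; split => t /= => [[]//|]; rewrite ltr01.
  rewrite (_ : [set t | X2 t < u /\ _] = [set t | X2 t < u]); last first.
    by apply/seteqP; split => t /= => [[]//|]; rewrite ltr01.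
  apply=> a b.
  - have := eqcos a 0; under eq_Rintegral do rewrite mul0r.
    under [RHS]eq_Rintegral do rewrite mul0r.
    by under [in X in _ -> X]eq_Rintegral do rewrite mulr0; under [in X in _ ->
      _ = X]eq_Rintegral do rewrite mulr0.
  - have := eqsin a 0; under eq_Rintegral do rewrite mul0r.
    under [RHS]eq_Rintegral do rewrite mul0r.
    by under [in X in _ -> X]eq_Rintegral do rewrite mulr0; under [in X in _ ->
      _ = X]eq_Rintegral do rewrite mulr0.
have diff d (T : measurableType d) (P : probability T R) (X Y : T -> R) :
    measurable_fun setT X -> measurable_fun setT Y ->
    (P [set t | (X t < u /\ u <= Y t)%R] =
     P [set t | (X t < u)%R] - P [set t | (X t < u /\ Y t < u)%R])%E.
  move=> mX mY.
  have m1 : measurable [set t | X t < u] by exact: measurable_set_ltr.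
  have m2 : measurable [set t | Y t < u] by exact: measurable_set_ltr.
  rewrite (_ : [set t | X t < u /\ u <= Y t] = [set t | X t < u] `\` [set t | Y t < u]); last first.
    apply/seteqP; split => t /= [xu]; first by rewrite leNgt => /negP.
    by move/negP; rewrite -leNgt.
  by rewrite measureD// -?ge0_fin_numE ?fin_num_measure.
by rewrite !diff// q1 q2.
Qed.

End bivariate_events.

(** * Crossing probability of a Gaussian pair *)

Section crossing_model.
Context {R : realType}.
Local Notation mu := (@lebesgue_measure R).
Local Notation N := (@normal_prob R 0 1).
Local Notation phi := (@normal_pdf R 0 1).
Local Notation peak := (@normal_peak R 1).

Lemma normal_pdf01_deriv_le (x : R) : `|x| * phi x <= peak.
Proof.
rewrite normal_pdf01E mulNr expRN mulrCA ler_piMr ?normal_peak_ge0//.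
rewrite ler_pdivrMr ?expR_gt0// mul1r (le_trans _ (expR_ge1Dx _))//.
rewrite -(real_normK (num_real x)); have := sqr_ge0 (`|x| - 1); nra.
Qed.

Lemma normal_pdf01_lipschitz (x y : R) : `|phi x - phi y| <= peak * `|x - y|.
Proof.
wlog xy : x y / y < x.
  move=> H; have [xy|yx|->] := ltgtP x y; last by rewrite !subrr normr0 mulr0.
  - by rewrite distrC (distrC x) H.
  - exact: H.
have [|c _ ->] := @MVT _ phi (fun x => - x * phi x) y x xy (fun z _ => is_derive_normal_pdf01 z).
  by apply: continuous_subspaceT; exact: continuous_normal_pdf.
rewrite normrM ler_wpM2r// mulNr normrN normrM (ger0_norm (normal_pdf_ge0 _ _ _)).
exact: normal_pdf01_deriv_le.
Qed.

(** The density varies by at most [peak * e] from its value at the midpoint, over an interval of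
    length 2e. *)
Lemma normal_prob_itv_approx (c e : R) : 0 <= e ->
  `|fine (N `[c - e, c + e[) - 2 * e * phi c| <= 2 * peak * e ^+ 2.
Proof.
move=> e0.
have muI : mu `[c - e, c + e[ = (2 * e)%:E.
  rewrite lebesgue_measure_itv/= lte_fin; case: ifPn => [_|].
    by rewrite -EFinB; congr EFin; lra.
  by rewrite -leNgt => h; congr EFin; lra.
have near_c t : t \in `[c - e, c + e[%classic -> `|phi t - phi c| <= peak * e.
  rewrite inE/= in_itv/= => /andP[t1 t2]; rewrite (le_trans (normal_pdf01_lipschitz _ _))//.
  by rewrite ler_wpM2l ?normal_peak_ge0// ler_norml; lra.
have iphi : mu.-integrable `[c - e, c + e[ (fun t => (phi t)%:E).
  by apply: (integrableS measurableT) => //; exact: integrable_normal_pdf.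
have icst (k : R) : mu.-integrable `[c - e, c + e[ (EFin \o cst k).
  apply: measurable_bounded_integrable => //; last exact: bounded_cst.
  by rewrite [X in (X < _)%E]muI ltry.
have -> : fine (N `[c - e, c + e[) = \int[mu]_(t in `[c - e, c + e[) phi t by [].
have cstE (k : R) : \int[mu]_(t in `[c - e, c + e[) (cst k t) = k * (2 * e).
  by rewrite Rintegral_cst//; congr (_ * _); exact: (congr1 fine muI).
rewrite ler_distl; apply/andP; split.
- rewrite [leLHS](_ : _ = \int[mu]_(t in `[c - e, c + e[) (cst (phi c - peak * e) t)); last first.
    by rewrite cstE; ring.
  apply: le_Rintegral => // t tI /=.
  by have := near_c t (mem_set tI); rewrite ler_distl; lra.
- rewrite [leRHS](_ : _ = \int[mu]_(t in `[c - e, c + e[) (cst (phi c + peak * e) t)); last first.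
    by rewrite cstE; ring.
  apply: le_Rintegral => // t tI /=.
  by have := near_c t (mem_set tI); rewrite ler_distl; lra.
Qed.

Local Notation RR := (measurableTypeR R * measurableTypeR R)%type.
Local Notation model := (product_prob N N).

Lemma model_trig (a b : R) :
  bivariate_trig model (fun z : RR => a * z.2 - b * z.1) (fun z : RR => a * z.2 + b * z.1)
    (a ^+ 2 + b ^+ 2) (a ^+ 2 - b ^+ 2) (a ^+ 2 + b ^+ 2).
Proof.
have m1 (k : R) : measurable_fun setT (fun z : RR => k * z.1).
  by apply: measurable_funM => //; exact: measurable_fst.
have m2 (k : R) : measurable_fun setT (fun z : RR => k * z.2).
  by apply: measurable_funM => //; exact: measurable_snd.
have mk (k : R) : measurable_fun setT (fun x : measurableTypeR R => k * x) by exact: measurable_funM.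
have reorg (c e : R) (z : RR) : c * (a * z.2 - b * z.1) + e * (a * z.2 + b * z.1) =
    ((e - c) * b) * z.1 + ((c + e) * a) * z.2 by ring.
split.
- exact: measurable_funB.
- exact: measurable_funD.
- move=> c e; under eq_Rintegral do rewrite reorg.
  by rewrite (product_cos N N (mk _) (mk _)) !normal_cos !normal_sin mulr0 subr0 -expRD;
    congr expR; field.
- move=> c e; under eq_Rintegral do rewrite reorg.
  by rewrite (product_sin N N (mk _) (mk _)) !normal_sin mul0r mulr0 addr0.
Qed.

(** Given z.1 = y, the event confines z.2 to the interval of center u/a and half-length (b/a) y,
    empty for y <= 0. Its mass is 2 (b/a) y^+ phi(u/a) up to 2 peak (b/a)^2 y^2; integrating in y,
    the mean of y^+ is [peak] and that of y^2 is 1. *)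
Lemma model_crossing (u a b : R) : 0 < a -> 0 <= b ->
  `|fine (model [set z : RR | (a * z.2 - b * z.1 < u)%R /\ (u <= a * z.2 + b * z.1)%R]) -
    2 * (b / a) * phi (u / a) * peak| <= 2 * peak * (b / a) ^+ 2.
Proof.
move=> a0 b0.
set A := [set z : RR | _].
have mA : measurable A.
  rewrite (_ : A = [set z : RR | a * z.2 - b * z.1 < u] `&` [set z : RR | u <= a * z.2 + b * z.1]);
    last by [].
  have [m1 m2 _ _] := model_trig a b.
  by apply: measurableI; [exact: measurable_set_ltr|exact: measurable_set_ler].
pose g (y : R) : R := fine (N `[u / a - b / a * y, u / a + b / a * y[).
have sec y : N (xsection A y) = (g y)%:E.
  rewrite /g fineK ?fin_num_measure//; congr (N _).
  have e1 : u / a - b / a * y = (u - b * y) / a by field; rewrite gt_eqF.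
  have e2 : u / a + b / a * y = (u + b * y) / a by field; rewrite gt_eqF.
  apply/seteqP; split => x; rewrite xsectionP /A /= in_itv/= e1 e2 ler_pdivrMr// ltr_pdivlMr//.
    by rewrite (mulrC x) => -[h1 h2]; apply/andP; split; [rewrite lerBlDr|rewrite -ltrBlDr].
  by rewrite (mulrC x) => /andP[h1 h2]; split; [rewrite ltrBlDr|rewrite -lerBlDr].
have modelE : model A = (\int[N]_y (g y)%:E)%E.
  by rewrite /product_prob /product_measure1; apply: eq_integral => y _ /=; exact: sec.
have mg : measurable_fun setT g.
  apply/measurable_EFinP; rewrite (_ : EFin \o g = (N \o xsection A)%E).
    exact: measurable_fun_xsection.
  by apply/funext => y /=; rewrite sec.
have g01 y : 0 <= g y <= 1.
  by rewrite fine_ge0//= -lee_fin fineK ?fin_num_measure// probability_le1.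
have ig : N.-integrable setT (EFin \o g).
  apply: (@integrable_normal_bounded _ _ 1) => // y.
  by have /andP[g0 g1] := g01 y; rewrite ger0_norm.
have bnd y : `|g y - 2 * (b / a) * phi (u / a) * Num.max y 0| <= 2 * peak * (b / a) ^+ 2 * y ^+ 2.
  have ba0 : 0 <= b / a by rewrite divr_ge0// ltW.
  have [y0|y0] := leP 0 y.
    have := @normal_prob_itv_approx (u / a) (b / a * y) (mulr_ge0 ba0 y0).
    rewrite (_ : 2 * (b / a * y) * phi (u / a) = 2 * (b / a) * phi (u / a) * y); last by ring.
    by rewrite -(mulrA (2 * peak)) -exprMn.
  rewrite mulr0 subr0 /g set_itv_ge ?measure0 ?normr0.
    by rewrite mulr_ge0 ?sqr_ge0// mulr_ge0 ?sqr_ge0// mulr_ge0// normal_peak_ge0.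
  rewrite -leNgt bnd_simp; have : b / a * y <= 0 by rewrite mulr_ge0_le0// ltW.
  by lra.
have mmax : measurable_fun setT (fun x : R => Num.max x 0) by exact: measurable_maxr.
have imax : N.-integrable setT (fun x => (Num.max x 0)%:E).
  apply: le_integrable (integrable_normal_id (R := R)) => //; first exact/measurable_EFinP.
  move=> y _ /=; rewrite lee_fin; have [y0|y0] := leP 0 y.
    by [].
  by rewrite normr0.
have maxE : \int[N]_y Num.max y 0 = peak.
  by rewrite /Rintegral normal_positive_part.
have sqE : \int[N]_y (y ^+ 2) = 1 by rewrite /Rintegral normal_variance.
rewrite modelE -/(Rintegral _ _ _) -[X in _ * X]maxE.
have ikmax := @integrableZl _ _ _ N _ measurableT (2 * (b / a) * phi (u / a)) _ imax.
have iB : N.-integrable setT (EFin \o (fun y => g y - 2 * (b / a) * phi (u / a) * Num.max y 0)).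
  exact: (integrableB measurableT ig ikmax).
rewrite -RintegralZl// -RintegralB//.
apply: (le_trans (le_normr_Rintegral measurableT iB)).
have isq := @integrableZl _ _ _ N _ measurableT (2 * peak * (b / a) ^+ 2) _ (integrable_normal_sq
  (R := R)).
have rhsE : \int[N]_y (2 * peak * (b / a) ^+ 2 * y ^+ 2) = 2 * peak * (b / a) ^+ 2.
  by rewrite RintegralZl ?sqE ?mulr1//; exact: integrable_normal_sq.
rewrite -[leRHS]rhsE.
apply: le_Rintegral => //.
exact: integrable_norm.
Qed.

(** The two coefficients solve a^2 + b^2 = 1 and a^2 - b^2 = r: unit variances and correlation
    [r]. *)
Definition crossing_prob (u r : R) : R :=
  fine (model [set z : RR |
    (Num.sqrt ((1 + r) / 2) * z.2 - Num.sqrt ((1 - r) / 2) * z.1 < u)%R /\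
    (u <= Num.sqrt ((1 + r) / 2) * z.2 + Num.sqrt ((1 - r) / 2) * z.1)%R]).

Lemma crossing_probE d (T : measurableType d) (P : probability T R) (X Y : T -> R) (u r : R) :
  -1 <= r <= 1 -> bivariate_trig P X Y 1 r 1 ->
  P [set t | (X t < u)%R /\ (u <= Y t)%R] = (crossing_prob u r)%:E.
Proof.
move=> /andP[r1 r2] h.
have := model_trig (Num.sqrt ((1 + r) / 2)) (Num.sqrt ((1 - r) / 2)).
rewrite !sqr_sqrtr ?divr_ge0 ?subr_ge0//; last by rewrite -lerBlDl sub0r.
rewrite (_ : (1 + r) / 2 + (1 - r) / 2 = 1); last by field.
rewrite (_ : (1 + r) / 2 - (1 - r) / 2 = r); last by field.
move=> h'; rewrite (bivariate_crossing_unique h h' u) /crossing_prob fineK//.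
by rewrite fin_num_measure//; have [m1 m2 _ _] := h'; apply: measurableI;
  [exact: measurable_set_ltr|exact: measurable_set_ler].
Qed.

(** With K = 2 (1 - r)/h^2 one has 2b = h sqrt(K) and a^2 = 1 - b^2, so b tends to 0 and a to 1.
    Divided by h, the main term of [model_crossing] converges, while its error becomes peak (b/a)
    sqrt(K)/a, which vanishes with b. *)
Lemma cvg_crossing_prob (u s2 : R) (h r : nat -> R) :
  (forall n, 0 < h n) -> h n @[n --> \oo] --> (0 : R) -> (forall n, r n <= 1) ->
  2 * (1 - r n) / h n ^+ 2 @[n --> \oo] --> s2 ->
  crossing_prob u (r n) / h n @[n --> \oo] --> Num.sqrt s2 * phi u * peak.
Proof.
move=> h0 hlim r1 Klim.
pose K n := 2 * (1 - r n) / h n ^+ 2.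
have K0 n : 0 <= K n by rewrite /K divr_ge0 ?sqr_ge0// mulr_ge0// subr_ge0.
pose b n := Num.sqrt ((1 - r n) / 2).
pose a n := Num.sqrt ((1 + r n) / 2).
have bE n : 2 * b n = h n * Num.sqrt (K n).
  have e : (1 - r n) / 2 = K n * (h n / 2) ^+ 2 by rewrite /K; field; rewrite gt_eqF.
  by rewrite /b e sqrtrM// sqrtr_sqr ger0_norm ?divr_ge0// ?ltW//; field.
have cvg_sqrt (f : nat -> R) (l : R) : f n @[n --> \oo] --> l ->
    Num.sqrt (f n) @[n --> \oo] --> Num.sqrt l.
  by move=> fl; exact: (continuous_cvg _ (@sqrt_continuous R l) fl).
have sKlim : Num.sqrt (K n) @[n --> \oo] --> Num.sqrt s2 by exact: cvg_sqrt.
have blim : b n @[n --> \oo] --> (0 : R).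
  rewrite (_ : b = (fun n => h n * Num.sqrt (K n) * 2^-1)); last first.
    by apply/funext => n; rewrite -bE; field.
  rewrite [X in _ --> X](_ : 0 = 0 * Num.sqrt s2 * 2^-1); last by rewrite !mul0r.
  by apply: cvgM; [exact: cvgM|exact: cvg_cst].
have rlim : (1 + r n) / 2 @[n --> \oo] --> (1 : R).
  rewrite (_ : (fun n => _) = (fun n => 1 - b n * b n)); last first.
    by apply/funext => n; rewrite -expr2 sqr_sqrtr ?divr_ge0 ?subr_ge0//; field.
  rewrite [X in _ --> X](_ : 1 = 1 - 0 * 0); last by rewrite mulr0 subr0.
  by apply: cvgB; [exact: cvg_cst|exact: cvgM].
have alim : a n @[n --> \oo] --> (1 : R).
  by rewrite -[X in _ --> X]sqrtr1; exact: cvg_sqrt.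
have aVlim : (a n)^-1 @[n --> \oo] --> (1 : R).
  by rewrite -[X in _ --> X]invr1; apply: cvgV => //; rewrite oner_eq0.
have a0 : \forall n \near \oo, 0 < a n.
  by apply: (cvgr_gt (1 : R)) alim _ ltr01.
have philim : phi (u / a n) @[n --> \oo] --> phi u.
  have ualim : u / a n @[n --> \oo] --> u.
    by rewrite -[X in _ --> X]mulr1; apply: cvgM => //; exact: cvg_cst.
  by apply: (continuous_cvg _ (@continuous_normal_pdf _ 0 1 _ u) ualim); rewrite oner_eq0.
have mainlim : Num.sqrt (K n) * (a n)^-1 * phi (u / a n) * peak @[n --> \oo] -->
    Num.sqrt s2 * phi u * peak.
  rewrite [X in _ --> X](_ : _ = Num.sqrt s2 * 1 * phi u * peak); last by rewrite mulr1.
  by apply: cvgM; [apply: cvgM; [exact: cvgM|]|exact: cvg_cst].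
have errlim : peak * (b n * (a n)^-1) * (Num.sqrt (K n) * (a n)^-1) @[n --> \oo] --> (0 : R).
  rewrite [X in _ --> X](_ : 0 = peak * (0 * 1) * (Num.sqrt s2 * 1)); last first.
    by rewrite mul0r mulr0 mul0r.
  apply: cvgM; last exact: cvgM.
  by apply: cvgM; [exact: cvg_cst|exact: cvgM].
have difflim : crossing_prob u (r n) / h n -
   Num.sqrt (K n) * (a n)^-1 * phi (u / a n) * peak @[n --> \oo] --> (0 : R).
  apply: norm_cvg0; apply: (@squeeze_cvgr _ _ _ _ (cst 0) _ _ _ _ _ errlim); last exact: cvg_cst.
  near=> n; have an0 : 0 < a n by near: n.
  rewrite normr_ge0/=.
  have -> : crossing_prob u (r n) / h n - Num.sqrt (K n) * (a n)^-1 * phi (u / a n) * peak =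
      (crossing_prob u (r n) - 2 * (b n / a n) * phi (u / a n) * peak) / h n.
    have -> : 2 * (b n / a n) = (h n * Num.sqrt (K n)) / a n by rewrite -bE; ring.
    by field; rewrite !gt_eqF.
  rewrite normrM (@gtr0_norm _ (h n)^-1) ?invr_gt0// ler_pdivrMr//.
  apply: le_trans (model_crossing u an0 (sqrtr_ge0 _)) _.
  rewrite le_eqVlt; apply/orP; left; apply/eqP.
  have -> : 2 * peak * (b n / a n) ^+ 2 = peak * (b n / a n) * ((2 * b n) / a n) by ring.
  by rewrite bE; ring.
rewrite (_ : (fun n => _) = (fun n => (crossing_prob u (r n) / h n -
   Num.sqrt (K n) * (a n)^-1 * phi (u / a n) * peak) +
   Num.sqrt (K n) * (a n)^-1 * phi (u / a n) * peak)); last first.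
  by apply/funext => n; rewrite subrK.
by rewrite -[X in _ --> X]add0r; exact: cvgD.
Unshelve. all: by end_near. Qed.

End crossing_model.

(** * The covariance function at the origin *)

Section square_integrable.
Context {R : realType} d (T : measurableType d) (P : probability T R).

Definition sq_integrable (f : T -> R) : Prop :=
  measurable_fun setT f /\ P.-integrable setT (fun t => (f t ^+ 2)%:E).

Definition inner (f g : T -> R) : R := \int[P]_t (f t * g t).

Lemma sq_integrable_inner (f g : T -> R) : sq_integrable f -> sq_integrable g ->
  P.-integrable setT (EFin \o (fun t => f t * g t)).
Proof. by move=> [mf i_f] [mg ig]; exact: integrable_product. Qed.

Lemma sq_integrableZ (c : R) (f : T -> R) : sq_integrable f ->
  sq_integrable (fun t => c * f t).
Proof.
move=> [mf i_f]; split; first exact: measurable_funM.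
rewrite (_ : (fun t => _) = (fun t => (c ^+ 2)%:E * (f t ^+ 2)%:E)%E); last first.
  by apply/funext => t; rewrite exprMn EFinM.
exact: (@integrableZl _ _ _ P _ measurableT _ _ i_f).
Qed.

Lemma sq_integrableD (f g : T -> R) : sq_integrable f -> sq_integrable g ->
  sq_integrable (fun t => f t + g t).
Proof.
move=> sf sg; have ifg := sq_integrable_inner sf sg.
move: sf sg => [mf i_f] [mg ig]; split; first exact: measurable_funD.
rewrite (_ : (fun t => _) = (fun t => (f t ^+ 2)%:E + (2%:E * (f t * g t)%:E + (g t ^+ 2)%:E))%E);
  last first.
  by apply/funext => t; rewrite -EFinM -!EFinD; congr EFin; ring.
apply: integrableD => //; apply: integrableD => //.
exact: (@integrableZl _ _ _ P _ measurableT _ _ ifg).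
Qed.

Lemma innerC (f g : T -> R) : inner f g = inner g f.
Proof. by apply: eq_Rintegral => t _; rewrite mulrC. Qed.

Lemma inner_lin (a b : R) (f g h : T -> R) :
  sq_integrable f -> sq_integrable g -> sq_integrable h ->
  inner (fun t => a * f t + b * g t) h = a * inner f h + b * inner g h.
Proof.
move=> sf sg sh; have i1 := sq_integrable_inner sf sh; have i2 := sq_integrable_inner sg sh.
rewrite /inner -!RintegralZl// -RintegralD//.
- by apply: eq_Rintegral => t _; ring.
- exact: (@integrableZl _ _ _ P _ measurableT _ _ i1).
- exact: (@integrableZl _ _ _ P _ measurableT _ _ i2).
Qed.

Lemma inner_ge0 (f : T -> R) : 0 <= inner f f.
Proof. by apply: Rintegral_ge0 => t _; rewrite -expr2 sqr_ge0. Qed.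

Lemma inner_sub (f g : T -> R) : sq_integrable f -> sq_integrable g ->
  inner (fun t => f t - g t) (fun t => f t - g t) = inner f f - 2 * inner f g + inner g g.
Proof.
move=> sf sg; rewrite (_ : (fun t => _) = (fun t => 1 * f t + (-1) * g t)); last first.
  by apply/funext => t; ring.
have sd : sq_integrable (fun t => 1 * f t + (-1) * g t) by apply: sq_integrableD; exact: sq_integrableZ.
rewrite (inner_lin _ _ sf sg sd) (innerC f) (innerC g) (inner_lin _ _ sf sg sf)
  (inner_lin _ _ sf sg sg).
by rewrite (innerC g f); ring.
Qed.

Lemma inner_cauchy_schwarz (f g : T -> R) : sq_integrable f -> sq_integrable g ->
  inner f g ^+ 2 <= inner f f * inner g g.
Proof.
move=> sf sg.
have quad (x : R) : 0 <= inner f f - 2 * x * inner f g + x ^+ 2 * inner g g.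
  have sxg := sq_integrableZ (- x) sg; have sd := sq_integrableD sf sxg.
  have := inner_ge0 (fun t => 1 * f t + (- x) * g t).
  have sd' : sq_integrable (fun t => 1 * f t + (- x) * g t).
    by apply: sq_integrableD => //; exact: sq_integrableZ.
  rewrite inner_lin// innerC inner_lin// [X in _ + _ * X]innerC inner_lin// (innerC g f).
  by congr (0 <= _); ring.
have C0 := inner_ge0 g.
have [C1|C1] := eqVneq (inner g g) 0.
  have [->|B1] := eqVneq (inner f g) 0; first by rewrite expr0n/= C1 mulr0.
  (* When <g, g> = 0 the quadratic is affine in x; this x gives it the value -1. *)
  have := quad ((inner f f + 1) / (2 * inner f g)).
  rewrite C1 mulr0 addr0 (_ : 2 * _ * _ = inner f f + 1); last by field.
  by rewrite opprD addrA subrr sub0r oppr_ge0 lt_geF.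
have Cp : 0 < inner g g by rewrite lt_def C1.
have := quad (inner f g / inner g g).
rewrite (_ : _ - _ + _ = inner f f - inner f g ^+ 2 / inner g g); last by field.
by rewrite subr_ge0 ler_pdivrMr.
Qed.

Lemma inner_diff_le (f g h : T -> R) (e : R) : sq_integrable f -> sq_integrable g ->
  sq_integrable h -> 0 <= e ->
  inner (fun t => g t - h t) (fun t => g t - h t) <= e ^+ 2 ->
  `|inner f g - inner f h| <= Num.sqrt (inner f f) * e.
Proof.
move=> sf sg sh e0 he.
have sgh : sq_integrable (fun t => g t - h t).
  rewrite (_ : (fun t => _) = (fun t => g t + (-1) * h t)); last by apply/funext => t; rewrite mulN1r.
  by apply: sq_integrableD => //; exact: sq_integrableZ.
have -> : inner f g - inner f h = inner f (fun t => g t - h t).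
  rewrite [RHS]innerC (_ : (fun t => _) = (fun t => 1 * g t + (-1) * h t)); last first.
    by apply/funext => t; rewrite mul1r mulN1r.
  by rewrite inner_lin// mul1r mulN1r ![inner _ f]innerC.
rewrite -ler_sqr ?nnegrE ?mulr_ge0 ?sqrtr_ge0// real_normK ?num_real// exprMn sqr_sqrtr ?inner_ge0//.
by apply: le_trans (inner_cauchy_schwarz sf sgh) _; rewrite ler_wpM2l ?inner_ge0.
Qed.

End square_integrable.

Lemma fatou_bound {R : realType} d (T : measurableType d) (m : {measure set T -> \bar R})
    (f_ : nat -> T -> \bar R) (f : T -> \bar R) (M : \bar R) :
  (forall n, measurable_fun setT (f_ n)) -> (forall n x, 0 <= f_ n x)%E ->
  (forall x, f_ n x @[n --> \oo] --> f x) -> (forall n, \int[m]_x f_ n x <= M)%E ->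
  (\int[m]_x f x <= M)%E.
Proof.
move=> mf f0 ff fM.
have -> : (\int[m]_x f x = \int[m]_x limn_einf (f_ ^~ x))%E.
  apply: eq_integral => x _; rewrite is_cvg_limn_einfE; last by apply/cvg_ex; exists (f x).
  by apply/esym/cvg_lim => //; exact: ff.
apply: (le_trans (@fatou _ _ _ m setT measurableT f_ mf (fun n x _ => f0 n x))).
rewrite limn_einf_lim; apply: lime_le; first exact: is_cvg_einfs.
by apply: nearW => n; apply: le_trans (fM n); apply: ereal_inf_lbound; exists n => /=.
Qed.

Section covariance.
Context {R : realType} d (Omega : measurableType d) (P : probability Omega R).
Variables (T : R) (Z : R -> {RV P >-> R}) (Gamma : R -> R).
Hypotheses (T_gt0 : 0 < T)
  (Z_gaussian : gaussian_process P `[0, T] Z)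
  (Z_centered : centered_process P `[0, T] Z)
  (Z_C1 : forall w, C1_on 0 T (fun t => Z t w))
  (Z_cov : covariance_function P `[0, T] Z Gamma).

Local Notation D := [set` `[0, T]].

Lemma process_sq_integrable t : D t -> sq_integrable P (Z t).
Proof.
move=> Dt; split; first exact: measurable_funPT.
apply: (@integrable_of_sq _ _ _ _ _ (Gamma (t - t))); first exact: measurable_funPT.
by rewrite -(Z_cov Dt Dt).
Qed.

Lemma process_inner s t : D s -> D t -> inner P (Z s) (Z t) = Gamma (t - s).
Proof. by move=> Ds Dt; have := Z_cov Ds Dt; rewrite unlock /inner /Rintegral => ->. Qed.

Lemma covariance_even t : `|t| <= T -> Gamma (- t) = Gamma t.
Proof.
have pos s : 0 <= s <= T -> Gamma (- s) = Gamma s.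
  move=> s0; have D0 : D 0 by rewrite /= in_itv/= lexx ltW.
  have Ds : D s by rewrite /= in_itv/=.
  have := process_inner Ds D0; rewrite innerC process_inner// subr0 sub0r.
  by move=> ->.
rewrite ler_norml => /andP[t1 t2]; have [t0|t0] := leP 0 t; first by rewrite pos ?t0.
by rewrite -[in RHS](opprK t) [RHS]pos ?opprK//; apply/andP; split; lra.
Qed.

Lemma gaussian_process3 t0 t1 t2 a0 a1 a2 : D t0 -> D t1 -> D t2 ->
  gaussian_rv P (fun w => a0 * Z t0 w + a1 * Z t1 w + a2 * Z t2 w).
Proof.
move=> D0 D1 D2.
pose ts (i : 'I_3) := nth 0 [:: t0; t1; t2] i.
pose a_ (i : 'I_3) := nth 0 [:: a0; a1; a2] i.
have Dts i : D (ts i) by case: i => -[|[|[|]]].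
have := @Z_gaussian 3 ts a_ Dts.
rewrite (_ : (fun w => _) = (fun w => a0 * Z t0 w + a1 * Z t1 w + a2 * Z t2 w))//.
by apply/funext => w; rewrite !big_ord_recl big_ord0 addr0 addrA.
Qed.

Lemma process_mean t : D t -> \int[P]_w Z t w = 0.
Proof. by move=> Dt; have := Z_centered Dt; rewrite unlock /Rintegral => ->. Qed.

Lemma process_integrable t : D t -> P.-integrable setT (EFin \o Z t).
Proof.
move=> Dt; have [mz iz] := process_sq_integrable Dt; exact: integrable_of_sq1.
Qed.

(** Three times are what a difference of two difference quotients at a common point involves. *)
Lemma process_combination_cos t0 t1 t2 a0 a1 a2 : D t0 -> D t1 -> D t2 ->
  let X := fun w => a0 * Z t0 w + a1 * Z t1 w + a2 * Z t2 w in
  sq_integrable P X /\ \int[P]_w cos (X w) = expR (- inner P X X / 2).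
Proof.
move=> D0 D1 D2 X.
have s0 := sq_integrableZ a0 (process_sq_integrable D0).
have s1 := sq_integrableZ a1 (process_sq_integrable D1).
have s2 := sq_integrableZ a2 (process_sq_integrable D2).
have sX : sq_integrable P X by apply: sq_integrableD => //; exact: sq_integrableD.
split => //; have [mX iX] := sX.
have i0 := @integrableZl _ _ _ P _ measurableT a0 _ (process_integrable D0).
have i1 := @integrableZl _ _ _ P _ measurableT a1 _ (process_integrable D1).
have i2 := @integrableZl _ _ _ P _ measurableT a2 _ (process_integrable D2).
have EX : ('E_P[X] = 0)%E.
  rewrite unlock -EFin_Rintegral; last by apply: integrable_of_sq1.
  congr EFin; rewrite /X RintegralD//; last exact: (integrableD measurableT i0 i1).
  rewrite RintegralD// !RintegralZl//; [|exact: process_integrable..].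
  by rewrite !process_mean// !mulr0 !addr0.
have EX2 : ('E_P[X ^+ 2] = (inner P X X)%:E)%E.
  rewrite unlock /inner EFin_Rintegral; last exact: sq_integrable_inner.
  by apply: eq_integral => w _; rewrite fctE.
have [_ [-> _]] := gaussian_rv_trig mX (gaussian_process3 _ _ _ D0 D1 D2) EX EX2.
by [].
Qed.

Lemma process_derivable t w : 0 < t < T -> derivable (fun s => Z s w) t 1.
Proof.
by have [_ [g [_ dg]]] := Z_C1 w => /dg h; exact: ex_derive.
Qed.

(** An interior base point: increments of either sign, up to T/2, remain in the time interval, as
    the two-sided second derivative at 0 requires. *)
Let t := T / 2.
Let t0T : 0 < t < T.
Proof. by rewrite /t divr_gt0//= ltr_pdivrMr// ltr_pMr// ltr1n. Qed.
Let Dt (h : R) : `|h| < t -> D (t + h).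
Proof. by rewrite ltr_norml /= in_itv/= => /andP[h1 h2]; rewrite /t in h1 h2 *; apply/andP; split;
  lra. Qed.
Let Dt0 : D t. Proof. by rewrite -[t]addr0; apply: Dt; rewrite normr0; case/andP: t0T. Qed.

Let q (h : R) (w : Omega) : R := h^-1 * (Z (t + h) w - Z t w).
Let Y (w : Omega) : R := 'D_1 (fun s => Z s w) t.

Let q_cvg w : q h w @[h --> 0^'] --> Y w.
Proof.
have /(_ w) dZ := fun w => @process_derivable t w t0T.
rewrite (_ : q ^~ w = (fun h => h^-1 *: (((fun s => Z s w) \o shift t) (h *: 1) - Z t w))) //.
by apply/funext => h; rewrite /q /= /GRing.scale /= mulr1 (addrC t).
Qed.

Let q_cvg_seq (h : nat -> R) w : h n @[n --> \oo] --> (0 : R) -> (forall n, h n != 0) ->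
  q (h n) w @[n --> \oo] --> Y w.
Proof.
move=> h0 hn; have /cvgr_dnbhsP := @q_cvg w.
by apply.
Qed.

Let q_sq (h : R) : `|h| < t -> sq_integrable P (q h).
Proof.
move=> ht; apply: sq_integrableZ.
rewrite (_ : (fun w => _) = (fun w => Z (t + h) w + (-1) * Z t w)); last by apply/funext => w;
  rewrite mulN1r.
by apply: sq_integrableD; [|apply: sq_integrableZ]; apply: process_sq_integrable => //; exact: Dt.
Qed.

(* A difference of two quotients is a centered Gaussian variable X with
   E cos X = exp(- E X^2 / 2); when it tends to 0 pointwise, so does E X^2. *)
Let q_cauchy (e : R) : 0 < e -> exists2 r : R, 0 < r <= t & forall h k : R, 0 < `|h| < r ->
  0 < `|k| < r ->
  inner P (fun w => q h w - q k w) (fun w => q h w - q k w) <= e.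
Proof.
move=> e0; apply: contrapT => /forall2NP H.
have t0 : 0 < t by case/andP: t0T.
have /choice[hk Hhk] : forall n, exists hk : R * R, [/\ 0 < `|hk.1| < t * n.+1%:R^-1,
   0 < `|hk.2| < t * n.+1%:R^-1 &
   e < inner P (fun w => q hk.1 w - q hk.2 w) (fun w => q hk.1 w - q hk.2 w)].
  move=> n; have [|] := H (t * n.+1%:R^-1).
    case; apply/andP; split; first by rewrite mulr_gt0// invr_gt0.
    by rewrite ler_piMr ?(ltW t0)// invf_le1// ler1n.
  move=> /existsNP[h /existsNP[k /not_implyP[h1 /not_implyP[k1 /negP]]]].
  by rewrite -ltNge => h2; exists (h, k).
have tn0 : t * n.+1%:R^-1 @[n --> \oo] --> (0 : R).
  by rewrite -[X in _ --> X](mulr0 t); apply: cvgMr; exact: cvg_harmonic.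
have to0 (f : nat -> R) : (forall n, 0 < `|f n| < t * n.+1%:R^-1) -> f n @[n --> \oo] -->
  (0 : R) /\ forall n, f n != 0.
  move=> Hf; split; last by move=> n; case/andP: (Hf n); rewrite normr_gt0.
  apply/cvgr0Pnorm_lt => r r0.
  move/cvgr0Pnorm_lt : tn0 => /(_ _ r0); apply: filterS => n; apply: le_lt_trans.
  by case/andP: (Hf n) => _ /ltW/le_trans; apply; rewrite ler_norm.
have [h0 hn] := to0 (fun n => (hk n).1) (fun n => let: And3 a _ _ := Hhk n in a).
have [k0 kn] := to0 (fun n => (hk n).2) (fun n => let: And3 _ a _ := Hhk n in a).
have le_t n : t * n.+1%:R^-1 <= t.
  by rewrite ler_piMr ?(ltW t0)// invf_le1// ler1n.
have ht n : `|(hk n).1| < t by have [/andP[_ a] _ _] := Hhk n; exact: lt_le_trans a (le_t n).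
have kt n : `|(hk n).2| < t by have [_ /andP[_ a] _] := Hhk n; exact: lt_le_trans a (le_t n).
pose X n (w : Omega) := q (hk n).1 w - q (hk n).2 w.
have XE n : X n = (fun w => (hk n).1^-1 * Z (t + (hk n).1) w + (- (hk n).2^-1) * Z (t + (hk n).2) w
    + ((hk n).2^-1 - (hk n).1^-1) * Z t w).
  by apply/funext => w; rewrite /X /q; ring.
have cosX n : sq_integrable P (X n) /\ \int[P]_w cos (X n w) = expR (- inner P (X n) (X n) / 2).
  by rewrite !XE; apply: process_combination_cos => //; exact: Dt.
have X0 w : X n w @[n --> \oo] --> (0 : R).
  rewrite -[X in _ --> X](subrr (Y w)); apply: cvgB; exact: q_cvg_seq.
have c1 : \int[P]_w cos (X n w) @[n --> \oo] --> \int[P]_w (cos 0 : R).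
  apply: (@dominated_cvg_Rintegral _ _ _ P _ _ (cst 1)).
  - by move=> n; apply: measurableT_comp; [exact: measurable_cosr|have [[]] := cosX n].
  - by move=> w; apply: (@continuous_cvg _ _ _ _ _ _ cos); [exact: continuous_cos|exact: X0].
  - by apply: finite_measure_integrable_cst.
  - by move=> n w; rewrite cos_max.
rewrite Rintegral_cst// in c1; rewrite cos0 mul1r in c1.
have P1 : fine (P setT) = 1 by rewrite (_ : P setT = 1%E)//; exact: probability_setT.
rewrite P1 in c1.
have c2 : 1 <= expR (- e / 2).
  have l1 := cvg_lim (@Rhausdorff R) c1.
  have : limn (fun n => \int[P]_w cos (X n w)) <= expR (- e / 2).
    apply: limr_le; first by apply/cvg_ex; exists 1.
    apply: nearW => n; have [_ ->] := cosX n; rewrite ler_expR ler_pM2r ?invr_gt0// lerN2.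
    by have [_ _ /ltW] := Hhk n.
  by rewrite l1.
have := expR_lt1 (- e / 2); rewrite ltNge c2 => /esym/negbT.
by rewrite -leNgt; lra.
Qed.

(** Fatou along k -> 0 in the Cauchy estimate replaces [q k] by its pointwise limit [Y]. The same
    bound shows that [Y] is square integrable, as a sum of [q h] and the remainder. *)
Let Y_strong (e : R) : 0 < e -> exists2 r : R, 0 < r <= t & forall h : R, 0 < `|h| < r ->
  [/\ sq_integrable P Y & inner P (fun w => q h w - Y w) (fun w => q h w - Y w) <= e].
Proof.
move=> e0; have [r /andP[r0 rt] Hr] := q_cauchy e0; exists r; first by rewrite r0.
move=> h /andP[h0 hr].
pose k (n : nat) : R := r / 2 * n.+1%:R^-1.
have k0 n : 0 < k n by rewrite /k !mulr_gt0// invr_gt0.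
have kr n : k n < r.
  have : k n <= r / 2 by rewrite ler_piMr ?divr_ge0 ?(ltW r0)// invf_le1// ler1n.
  move=> /le_lt_trans; apply; lra.
have kt n : `|k n| < t by rewrite gtr0_norm//; exact: lt_le_trans (kr n) rt.
have kc : k n @[n --> \oo] --> (0 : R).
  by rewrite -[X in _ --> X](mulr0 (r / 2)); apply: cvgMr; exact: cvg_harmonic.
have kY w : q (k n) w @[n --> \oo] --> Y w by apply: q_cvg_seq => // n; rewrite gt_eqF.
have mY : measurable_fun setT Y.
  apply: (@measurable_fun_cvg _ _ _ _ (fun n => q (k n))) => // n.
  by have [] := q_sq (kt n).
have mq n : measurable_fun setT (q (k n)) by have [] := q_sq (kt n).
have sh : sq_integrable P (q h) by apply: q_sq; exact: lt_le_trans rt.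
have [mh ih] := sh.
have bnd : (\int[P]_w ((q h w - Y w) ^+ 2)%:E <= e%:E)%E.
  apply: (@fatou_bound _ _ _ P (fun n w => ((q h w - q (k n) w) ^+ 2)%:E)) => //.
  - by move=> n; apply/measurable_EFinP; apply: measurable_funX; exact: measurable_funB.
  - by move=> n w; rewrite lee_fin sqr_ge0.
  - move=> w; apply: cvg_EFin; first exact: nearW.
    have c : q h w - q (k n) w @[n --> \oo] --> q h w - Y w by apply: cvgB; [exact: cvg_cst|exact: kY].
    by rewrite expr2; under eq_fun => n do rewrite /= expr2; exact: (cvgM c c).
  - move=> n; have := Hr h (k n); rewrite h0 hr gtr0_norm ?k0 ?kr// => /(_ isT isT).
    rewrite -lee_fin /inner EFin_Rintegral.
      by under eq_integral do rewrite -expr2.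
    have sd : sq_integrable P (fun w => q h w + (-1) * q (k n) w).
      by apply: sq_integrableD => //; apply: sq_integrableZ; exact: q_sq.
    rewrite (_ : (fun w => q h w + _) = (fun w => q h w - q (k n) w)) in sd; last first.
      by apply/funext => w; rewrite mulN1r.
    exact: sq_integrable_inner.
have sd : sq_integrable P (fun w => q h w - Y w).
  split; first exact: measurable_funB.
  apply/integrableP; split.
    by apply/measurable_EFinP; apply: measurable_funX; exact: measurable_funB.
  under eq_integral do rewrite gee0_abs ?lee_fin ?sqr_ge0//.
  by apply: le_lt_trans bnd _; exact: ltry.
split.
  rewrite (_ : Y = (fun w => q h w + (-1) * (q h w - Y w))).
    by apply: sq_integrableD => //; exact: sq_integrableZ.
  by apply/funext => w; ring.
rewrite -lee_fin /inner EFin_Rintegral; last exact: sq_integrable_inner.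
by under eq_integral do rewrite -expr2.
Qed.

Let t_gt0 : 0 < t. Proof. by case/andP: t0T. Qed.

Let Y_sq : sq_integrable P Y.
Proof.
have [r /andP[r0 rt] H] := Y_strong (@ltr01 R).
by have [] := H (r / 2); rewrite // gtr0_norm ?divr_gt0//=; lra.
Qed.

Let q_weak f : sq_integrable P f -> inner P f (q h) @[h --> 0^'] --> inner P f Y.
Proof.
move=> sf; apply/cvgrPdist_le => e e0.
have s0 : 0 <= Num.sqrt (inner P f f) by exact: sqrtr_ge0.
have d0 : 0 < e / (Num.sqrt (inner P f f) + 1) by rewrite divr_gt0// ltr_wpDl.
have [r /andP[rp rt] H] := Y_strong (exprn_gt0 2 d0).
near=> h.
have h0 : 0 < `|h| by rewrite normr_gt0; near: h; exact: nbhs_dnbhs_neq.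
have hr : `|h| < r by near: h; apply: dnbhs0_lt.
have [_ Hh] := H h (introT andP (conj h0 hr)).
rewrite distrC; apply: (le_trans (inner_diff_le sf (q_sq (lt_le_trans hr rt)) Y_sq (ltW d0) Hh)).
by rewrite mulrA ler_pdivrMr ?ltr_wpDl// mulrC ler_pM2l// lerDl.
Unshelve. all: by end_near. Qed.

(** Write <.,.> for [inner]. A difference quotient of Gamma at tau is <Z(t - tau), q h>, so
    Gamma'(tau) = <Z(t - tau), Y>; a difference quotient of Gamma' at 0 is - <q(-h), Y>, so
    Gamma''(0) = - <Y, Y>. Finally 2 (Gamma(0) - Gamma(h))/h^2 is <q h, q h>. *)
Lemma covariance_second_derivative : 0 <= - derive1n 2 Gamma 0 /\
  (2 * (Gamma 0 - Gamma h) / h ^+ 2) @[h --> 0^'] --> - derive1n 2 Gamma 0.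
Proof.
have D1 tau : `|tau| < t -> derive1 Gamma tau = inner P (Z (t - tau)) Y.
  move=> ht; have Dtau : D (t - tau) by apply: Dt; rewrite normrN.
  rewrite derive1E; apply: cvg_lim => //.
  have := q_weak (process_sq_integrable Dtau); apply: cvg_trans; apply: near_eq_cvg.
  near=> h.
  have hr : `|h| < t by near: h; exact: dnbhs0_lt.
  rewrite /= /GRing.scale /= mulr1.
  rewrite (_ : q h = (fun w => h^-1 * Z (t + h) w + (- h^-1) * Z t w)); last first.
    by apply/funext => w; rewrite /q; ring.
  have Dh := Dt hr.
  rewrite innerC (inner_lin _ _ (process_sq_integrable Dh) (process_sq_integrable Dt0)
    (process_sq_integrable Dtau)).
  rewrite (process_inner Dh Dtau) (process_inner Dt0 Dtau).
  have even x : `|x| < T -> Gamma (- x) = Gamma x by move=> /ltW; exact: covariance_even.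
  rewrite (_ : t - tau - (t + h) = - (h + tau)); last by ring.
  rewrite (_ : t - tau - t = - tau); last by ring.
  rewrite !even; first by rewrite mulrBr mulNr.
    by apply: lt_trans ht _; case/andP: t0T.
  by apply: le_lt_trans (ler_normD _ _) _; move: hr ht; rewrite /t; lra.
have D2 : derive1n 2 Gamma 0 = - inner P Y Y.
  rewrite [LHS]derive1E; apply: cvg_lim => //.
  have := q_weak Y_sq => /cvgN c1.
  have c2 : (- inner P Y (q (- h))) @[h --> 0^'] --> - inner P Y Y.
    apply: (cvg_comp -%R _ _ c1) => A /= [e e0 H]; exists e => // h /= he hn.
    by apply: H => /=; rewrite ?oppr_eq0//; move: he; rewrite !sub0r !normrN.
  move: c2; apply: cvg_trans; apply: near_eq_cvg.
  near=> h.
  have hr : `|h| < t by near: h; exact: dnbhs0_lt.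
  rewrite /= /GRing.scale /= mulr1 addr0 !D1 ?normr0// subr0.
  rewrite (_ : q (- h) = (fun w => (- h^-1) * Z (t - h) w + h^-1 * Z t w)); last first.
    by apply/funext => w; rewrite /q invrN; ring.
  have Dh : D (t - h) by apply: Dt; rewrite normrN.
  have [? _] := Y_sq.
  rewrite innerC (inner_lin _ _ (process_sq_integrable Dh) (process_sq_integrable Dt0) Y_sq).
  by ring.
rewrite D2 opprK; split; first exact: inner_ge0.
(* From <q, q> = <q - Y, q - Y> + 2 <q, Y> - <Y, Y>, by strong and weak convergence. *)
have qq : inner P (q h) (q h) @[h --> 0^'] --> inner P Y Y.
  pose dd h := inner P (fun w => q h w - Y w) (fun w => q h w - Y w).
  have dd0 : dd h @[h --> 0^'] --> (0 : R).
    apply/cvgrPdist_le => e /Y_strong[r /andP[r0 rt] H]; near=> h.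
    have h0 : 0 < `|h| by rewrite normr_gt0; near: h; exact: nbhs_dnbhs_neq.
    have hr : `|h| < r by near: h; exact: dnbhs0_lt.
    rewrite sub0r normrN ger0_norm ?inner_ge0//.
    by have [] := H h (introT andP (conj h0 hr)).
  have c := cvgD dd0 (cvgB (cvgD (q_weak Y_sq) (q_weak Y_sq)) (cvg_cst (inner P Y Y))).
  rewrite add0r addrK in c; apply: cvg_trans (c _ _ _ _); apply: near_eq_cvg.
  near=> h.
  have hr : `|h| < t by near: h; exact: dnbhs0_lt.
  have sq := q_sq hr.
  have ddE : dd h = inner P (q h) (q h) - 2 * inner P (q h) Y + inner P Y Y by exact: inner_sub.
  by rewrite !fctE ddE (innerC _ Y (q h)); ring.
move: qq; apply: cvg_trans; apply: near_eq_cvg.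
near=> h.
have h0 : h != 0 by near: h; exact: nbhs_dnbhs_neq.
have hr : `|h| < t by near: h; exact: dnbhs0_lt.
have E : q h = (fun w => h^-1 * Z (t + h) w + (- h^-1) * Z t w).
  by apply/funext => w; rewrite /q; ring.
have sq := q_sq hr.
have Dh := Dt hr; have sh := process_sq_integrable Dh; have s0 := process_sq_integrable Dt0.
rewrite {1}E (inner_lin _ _ sh s0 sq) (innerC P _ (q h)) (innerC P (Z t) (q h)) E.
rewrite !(inner_lin _ _ sh s0) // (process_inner Dh Dh) (process_inner Dh Dt0)
  (process_inner Dt0 Dh) (process_inner Dt0 Dt0).
rewrite !subrr (_ : t - (t + h) = - h); last by ring.
rewrite (_ : t + h - t = h); last by ring.
rewrite covariance_even.
  by field.
by rewrite (le_trans (ltW hr))// /t ler_pdivrMr// ler_peMr ?ler1n// ltW.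
Unshelve. all: by end_near. Qed.

End covariance.

(** * Independence and the auto-regressive chain *)

Section joint_law.
Context {R : realType} d d1 d2 (T : measurableType d) (T1 : measurableType d1)
  (T2 : measurableType d2) (P : probability T R) (X : T -> T1) (Y : T -> T2).
Hypotheses (mX : measurable_fun setT X) (mY : measurable_fun setT Y)
  (indep : forall A B, measurable A -> measurable B ->
    P (X @^-1` A `&` Y @^-1` B) = (P (X @^-1` A) * P (Y @^-1` B))%E).

Let XY (w : T) := (X w, Y w).
Let XxY (p : T * T) := (X p.1, Y p.2).
Let mXY : measurable_fun setT XY. Proof. exact: measurable_fun_pair. Qed.
Let mXxY : measurable_fun setT XxY.
Proof.
apply: measurable_fun_pair.
  exact: (measurableT_comp mX measurable_fst).
exact: (measurableT_comp mY measurable_snd).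
Qed.

(** Two probabilities that agree on the rectangles, which are stable under intersection, agree
    everywhere. The independent copy lives on a second sample point of the same space. *)
Lemma joint_law (S : set (T1 * T2)) : measurable S ->
  P [set w | S (X w, Y w)] = product_prob P P [set p | S (X p.1, Y p.2)].
Proof.
move=> mS.
pose C : set (set (T1 * T2)) := [set A `*` B | A in measurable & B in measurable].
have CI : setI_closed C.
  move=> /= _ _ [A1 mA1 [B1 mB1 <-]] [A2 mA2 [B2 mB2 <-]].
  rewrite -setXI; exists (A1 `&` A2); first exact: measurableI.
  by exists (B1 `&` B2) => //; exact: measurableI.
apply: (measure_unique C (fun=> setT) _ _ _ _ (pushforward P XY) (pushforward
  (product_prob P P) XxY)) => //.
- by rewrite measurable_prod_measurableType.
- by move=> _; exists setT => //; exists setT => //; rewrite setXTT.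
- by rewrite bigcup_const//; exists 0%N.
- move=> _ [A mA [B mB <-]]; rewrite /pushforward /product_prob.
  rewrite -[RHS]/((P \x P)%E ((X @^-1` A) `*` (Y @^-1` B))).
  rewrite product_measure1E; last 2 first.
  - by rewrite -[S in measurable S]setTI; exact: mX.
  - by rewrite -[S in measurable S]setTI; exact: mY.
  exact: indep.
- by move=> _; apply: le_lt_trans (@probability_le1 _ _ _ P setT measurableT) _; rewrite ltry.
Qed.

Lemma joint_law_Rintegral (f : T1 * T2 -> R) (M : R) : measurable_fun setT f ->
  (forall z, `|f z| <= M) ->
  \int[P]_w f (X w, Y w) = \int[product_prob P P]_p f (X p.1, Y p.2).
Proof.
move=> mf fM; rewrite /Rintegral; congr fine.
have mEf : measurable_fun setT (EFin \o f) by exact/measurable_EFinP.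
have if1 : P.-integrable setT ((EFin \o f) \o XY).
  apply: (@integrable_bounded _ _ _ _ _ M); first exact: measurableT_comp mf mXY.
  by move=> x; exact: fM.
have if2 : (product_prob P P).-integrable setT ((EFin \o f) \o XxY).
  apply: (@integrable_bounded _ _ _ _ _ M); first exact: measurableT_comp mf mXxY.
  by move=> x; exact: fM.
have <- := @integral_pushforward _ _ _ _ R XY mXY P setT _ mEf if1 measurableT.
have <- := @integral_pushforward _ _ _ _ R XxY mXxY (product_prob P P) setT _ mEf if2 measurableT.
by apply: eq_measure_integral => A mA _; exact: joint_law.
Qed.

End joint_law.

Section decoupling.
Context {R : realType} d (T : measurableType d) (P : probability T R).

Lemma measurable_fun_sub (G : set (set T)) d' (U : measurableType d')
    (f : T -> U) : G `<=` measurable ->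
  measurable_fun (setT : set (g_sigma_algebraType G)) f -> measurable_fun setT f.
Proof.
move=> Gm mf _ B mB; rewrite setTI.
have : <<s G >> (f @^-1` B) by have := mf measurableT B mB; rewrite setTI.
by apply: smallest_sub => //; exact: sigma_algebra_measurable.
Qed.

(** [joint_law] for the identity maps into the two generated sigma-algebras. An event written on the
    diagonal may be evaluated with independent sample points as soon as it is measurable for the
    product of these sigma-algebras. *)
Lemma decoupling (G1 G2 : set (set T))
    (S : set (g_sigma_algebraType G1 * g_sigma_algebraType G2)) :
  G1 `<=` measurable -> G2 `<=` measurable ->
  independent_systems P <<s G1 >> <<s G2 >> -> measurable S ->
  P [set w | S (w, w)] = product_prob P P S.
Proof.
move=> G1m G2m ind mS.
have m1 : measurable_fun setT (fun w : T => w : g_sigma_algebraType G1).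
  exact: (measurable_fun_sub G1m (@measurable_id _ _ _)).
have m2 : measurable_fun setT (fun w : T => w : g_sigma_algebraType G2).
  exact: (measurable_fun_sub G2m (@measurable_id _ _ _)).
rewrite (joint_law m1 m2) //.
Qed.

Lemma measurable_sigma_of d' (U : measurableType d') (I : Type) (D : set I)
    (X : I -> T -> U) (i : I) : D i ->
  measurable_fun (setT : set (g_sigma_algebraType
    (\bigcup_(i in D) preimage_set_system setT (X i) measurable))) (X i).
Proof.
move=> Di _ B mB; rewrite setTI; apply: sub_sigma_algebra; exists i => //.
by exists B => //; rewrite setTI.
Qed.

End decoupling.

Lemma joint_law_cos {R : realType} d (T : measurableType d) (P : probability T R) (X Y : T -> R) :
  measurable_fun setT X -> measurable_fun setT Y ->
  (forall A B, measurable A -> measurable B ->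
    P (X @^-1` A `&` Y @^-1` B) = (P (X @^-1` A) * P (Y @^-1` B))%E) ->
  \int[P]_w cos (X w + Y w) =
    \int[P]_w cos (X w) * \int[P]_w cos (Y w) - \int[P]_w sin (X w) * \int[P]_w sin (Y w) /\
  \int[P]_w sin (X w + Y w) =
    \int[P]_w sin (X w) * \int[P]_w cos (Y w) + \int[P]_w cos (X w) * \int[P]_w sin (Y w).
Proof.
move=> mX mY ind.
have ms : measurable_fun setT (fun z : R * R => z.1 + z.2).
  by apply: measurable_funD; [exact: measurable_fst|exact: measurable_snd].
rewrite -(product_cos P P mX mY) -(product_sin P P mX mY); split.
- apply: (joint_law_Rintegral mX mY ind (f := fun z => cos (z.1 + z.2)) (M := 1)).
    exact: measurableT_comp (@measurable_cosr R) ms.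
  by move=> z; exact: cos_max.
- apply: (joint_law_Rintegral mX mY ind (f := fun z => sin (z.1 + z.2)) (M := 1)).
    exact: measurableT_comp (@measurable_sinr R) ms.
  by move=> z; exact: sin_max.
Qed.

Lemma measurable_ar_chain {R : realType} d (T : measurableType d) (eps : nat -> T -> R) rho k :
  (forall i, (i <= k)%N -> measurable_fun setT (eps i)) ->
  measurable_fun setT (ar_chain rho eps k).
Proof.
elim: k => [|k IH] meps; first exact: meps.
apply: measurable_funD; apply: measurable_funM => //; last exact: meps.
by apply: IH => i ik; apply: meps; exact: leqW.
Qed.

(** * Stationarity of the auto-regressive chain *)

Section chain.
Context {R : realType} d (Omega : measurableType d) (P : probability Omega R).
Variables (eps : nat -> {RV P >-> R}) (rho : R).
Hypotheses (eps_indep : mutually_independent P (fun n => eps n : Omega -> R))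
  (eps_law : forall n, has_law P (eps n) (normal_prob 0 (Num.sqrt (1 / 2))))
  (rho_lt1 : `|rho| < 1).

(** Cylinders over the first n innovations: a family stable under intersection, of which
    [mutually_independent] speaks directly. *)
Let past n : set (set Omega) :=
  [set S | exists2 B : nat -> set R, (forall i, measurable (B i)) &
     S = \bigcap_(i in [set` iota 0 n]) (eps i @^-1` B i)].

Let past_measurable n : past n `<=` measurable.
Proof.
move=> _ [B mB ->]; apply: bigcap_measurableType => i _.
by rewrite -[X in measurable X]setTI; exact: measurable_funPT.
Qed.

(** As functions of A, both sides are finite measures; they agree on cylinders, hence on the
    sigma-algebra these generate. *)
Let past_indep n (A : set Omega) (B : set R) : <<s past n >> A -> measurable B ->
  P (A `&` eps n @^-1` B) = (P A * P (eps n @^-1` B))%E.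
Proof.
move=> sA mB.
have mE : measurable (eps n @^-1` B) by rewrite -[X in measurable X]setTI; exact: measurable_funPT.
pose c : {nonneg R} := NngNum (fine_ge0 (measure_ge0 P (eps n @^-1` B))).
have cE : (c%:num)%:E = P (eps n @^-1` B) by rewrite /= fineK// fin_num_measure.
have -> : (P A * P (eps n @^-1` B))%E = mscale c P A by rewrite /mscale cE muleC.
rewrite -[LHS]/(mrestr P mE A).
apply: (@g_sigma_algebra_measure_unique _ _ _ (past n) (@past_measurable n) (fun=> setT) _ _
  (mrestr P mE) (mscale c P)) => //.
- by move=> _; exists (fun=> setT) => //; rewrite bigcapT.
- by rewrite bigcup_const//; exists 0%N.
- move=> _ _ [B1 mB1 ->] [B2 mB2 ->]; exists (fun i => B1 i `&` B2 i); first by move=> i;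
  exact: measurableI.
  by rewrite -bigcapI; apply: eq_bigcapr => i _; rewrite preimage_setI.
- move=> _ [B1 mB1 ->]; rewrite -[RHS]/((c%:num)%:E * P (\bigcap_(i in [set` iota 0 n])
  (eps i @^-1` B1 i)))%E cE muleC /mrestr.
  (* The condition on [eps n] is appended to the cylinder as coordinate n, and mutual independence
     is read for n + 1 and for n coordinates. *)
  pose B2 i := if i == n then B else B1 i.
  have mB2 i : measurable (B2 i) by rewrite /B2; case: ifP.
  have := @eps_indep (rcons (iota 0 n) n) B2 _ mB2.
  have := @eps_indep (iota 0 n) B1 (iota_uniq 0 n) mB1.
  rewrite rcons_uniq mem_iota ltnn andbF iota_uniq => E1 /(_ isT).
  have E0 : \big[*%E/1%E]_(i <- iota 0 n) P (eps i @^-1` B2 i) = \big[*%E/1%E]_(i <- iota 0 n) P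
    (eps i @^-1` B1 i).
    by rewrite !big_seq; apply: eq_bigr => i; rewrite mem_iota /B2 => /andP[_]; case: eqP => // ->;
      rewrite add0n ltnn.
  have B2n : B2 n = B by rewrite /B2 eqxx.
  rewrite big_rcons E0 B2n E1 => <-; congr (P _); apply/seteqP; split=> w.
    case=> H1 H2 i /=; rewrite mem_rcons inE /B2 => /orP[/eqP->|]; first by rewrite eqxx.
    by move=> ii; case: eqP => [->//|_]; exact: H1.
  move=> H; split; last by have := H n; rewrite /= /B2 eqxx mem_rcons inE eqxx; apply.
  move=> i /= ii; have := H i; rewrite /= mem_rcons inE ii orbT /B2 => /(_ isT).
  by case: eqP => // E; move: ii; rewrite E mem_iota ltnn andbF.
- by move=> _; apply: (@le_lt_trans _ _ 1%E); [apply: (@probability_le1 _ _ _ P);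
  exact: measurableI|rewrite ltry].
Qed.

Let eps_past i n : (i < n)%N -> measurable_fun (setT : set (g_sigma_algebraType (past n))) (eps i).
Proof.
move=> lin _ B mB; rewrite setTI; apply: sub_sigma_algebra.
exists (fun j => if j == i then B else setT); first by move=> j; case: ifP.
apply/seteqP; split=> w.
  by move=> Hw j _ /=; case: eqP => // ->.
by move=> /(_ i) /=; rewrite mem_iota leq0n add0n lin eqxx; exact.
Qed.

Let eps_trig n b : \int[P]_w cos (b * eps n w) = expR (- b ^+ 2 / 4) /\
  \int[P]_w sin (b * eps n w) = 0.
Proof.
pose s : R := Num.sqrt (1 / 2).
have s2 : s ^+ 2 = 1 / 2 by rewrite sqr_sqrtr// divr_ge0.
have s0 : 0 < s by rewrite sqrtr_gt0 divr_gt0.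
have me : measurable_fun setT (eps n) by exact: measurable_funPT.
rewrite -[X in _ = X /\ _](_ : expR (- (b * s) ^+ 2 / 2) = _); last by rewrite exprMn s2;
  congr expR; field.
rewrite -(normal_cos (b * s)) -[X in _ /\ _ = X](normal_sin (b * s)); split.
- have cg : continuous (fun x : R => cos (b * x)).
    by move=> x; apply: continuous_comp; [exact: mulrl_continuous|exact: continuous_cos].
  rewrite /Rintegral (gaussian_integral me s0 (eps_law n) cg); congr fine.
  by apply: eq_integral => y _; rewrite add0r mulrA.
- have cg : continuous (fun x : R => sin (b * x)).
    by move=> x; apply: continuous_comp; [exact: mulrl_continuous|exact: continuous_sin].
  rewrite /Rintegral (gaussian_integral me s0 (eps_law n) cg); congr fine.
  by apply: eq_integral => y _; rewrite add0r mulrA.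
Qed.

Local Notation A := (ar_chain rho (fun n => eps n : Omega -> R)).

Let chain_eps_trig k a b (ca : R) : \int[P]_w cos (a * A k w) = ca -> \int[P]_w sin (a * A k w) = 0 ->
  \int[P]_w cos (a * A k w + b * eps k.+1 w) = ca * expR (- b ^+ 2 / 4) /\
  \int[P]_w sin (a * A k w + b * eps k.+1 w) = 0.
Proof.
move=> c1 s1; have [c2 s2] := eps_trig k.+1 b.
have mA : measurable_fun (setT : set (g_sigma_algebraType (past k.+1))) (fun w => a * A k w).
  apply: measurable_funM => //; apply: measurable_ar_chain => i ik; exact: eps_past.
have me : measurable_fun setT (fun w => b * eps k.+1 w).
  by apply: measurable_funM => //; exact: measurable_funPT.
have mA' := measurable_fun_sub (@past_measurable k.+1) mA.
have [|] := joint_law_cos (P := P) mA' me.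
  move=> S1 S2 mS1 mS2.
  have [T2 mT2 ->] : exists2 T2, measurable T2 & (fun w => b * eps k.+1 w) @^-1` S2 = eps k.+1 @^-1` T2.
    exists ((fun x => b * x) @^-1` S2) => //; rewrite -[X in measurable X]setTI.
    by apply: measurable_funM.
  apply: past_indep => //.
  by have := mA measurableT S1 mS1; rewrite setTI.
by rewrite c1 s1 c2 s2 => -> ->; split; ring.
Qed.

Let rho2 : 0 <= 1 - rho ^+ 2.
Proof. by move: rho_lt1; rewrite ltr_norml => /andP[? ?]; nra. Qed.

Let sqr_s : Num.sqrt (1 - rho ^+ 2) ^+ 2 = 1 - rho ^+ 2.
Proof. exact: sqr_sqrtr. Qed.

(** The recursion preserves the variance: rho^2/2 + (1 - rho^2)/2 = 1/2. The law does not depend on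
    k, which is what removes the random index nu(s) later. *)
Lemma ar_chain_trig k a : \int[P]_w cos (a * A k w) = expR (- a ^+ 2 / 4) /\
  \int[P]_w sin (a * A k w) = 0.
Proof.
elim: k a => [|k IH] a; first exact: eps_trig.
have [c1 s1] := IH (a * rho); have [] := chain_eps_trig (a * Num.sqrt (1 - rho ^+ 2)) c1 s1.
rewrite -expRD (_ : _ / 4 + _ = - a ^+ 2 / 4); last by rewrite !exprMn sqr_s; field.
rewrite (_ : (fun w => cos _) = (fun w => cos (a * A k.+1 w))); last by apply/funext => w /=;
  congr cos; ring.
by rewrite (_ : (fun w => sin _) = (fun w => sin (a * A k.+1 w))); last by apply/funext => w /=;
  congr sin; ring.
Qed.

(** a A_k + b A_(k+1) is (a + b rho) A_k plus b sqrt(1 - rho^2) times an innovation independent of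
    A_k. *)
Lemma ar_chain_pair_trig k : bivariate_trig P (A k) (A k.+1) (1 / 2) (rho / 2) (1 / 2).
Proof.
have mA j : measurable_fun setT (A j) by apply: measurable_ar_chain => i _; exact: measurable_funPT.
suff H a b : \int[P]_w cos (a * A k w + b * A k.+1 w) =
    expR (- (a ^+ 2 * (1 / 2) + 2 * a * b * (rho / 2) + b ^+ 2 * (1 / 2)) / 2) /\
    \int[P]_w sin (a * A k w + b * A k.+1 w) = 0.
  by split => // a b; have [] := H a b.
have [c1 s1] := ar_chain_trig k (a + b * rho).
have [] := chain_eps_trig (b * Num.sqrt (1 - rho ^+ 2)) c1 s1.
rewrite -expRD.
rewrite (_ : _ / 4 + _ = - (a ^+ 2 * (1 / 2) + 2 * a * b * (rho / 2) + b ^+ 2 * (1 / 2)) / 2);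
  last first.
  by rewrite !exprMn sqr_s; field.
rewrite (_ : (fun w => cos _) = (fun w => cos (a * A k w + b * A k.+1 w)));
  last by apply/funext => w /=; congr cos; ring.
by rewrite (_ : (fun w => sin _) = (fun w => sin (a * A k w + b * A k.+1 w)));
  last by apply/funext => w /=; congr sin; ring.
Qed.

End chain.

(** * Probabilities of one-cell events *)

Section product_mixture.
Context {R : realType} d (T : measurableType d) (P : probability T R).
Variables (G2 G3 : set (set T)).
Hypotheses (G2m : G2 `<=` measurable) (G3m : G3 `<=` measurable)
  (ind : independent_systems P <<s G2 >> <<s G3 >>).

Local Notation Q := (product_prob P P).

Lemma measurable_sub_set (G : set (set T)) : G `<=` measurable -> <<s G >> `<=` measurable.
Proof. by move=> Gm; apply: smallest_sub => //; exact: sigma_algebra_measurable. Qed.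

Lemma measurable_sub_prod (S : set (T * g_sigma_algebraType G2)) : measurable S ->
  measurable (S : set (T * T)).
Proof.
move=> mS.
have m2 : measurable_fun setT (fun w : T => w : g_sigma_algebraType G2).
  exact: (measurable_fun_sub G2m (@measurable_id _ _ _)).
have mp : measurable_fun setT (fun z : T * T => (z.1, z.2) : T * g_sigma_algebraType G2).
  apply: measurable_fun_pair; first exact: measurable_fst.
  exact: measurableT_comp m2 measurable_snd.
have := mp measurableT S mS; rewrite setTI.
by rewrite (_ : _ @^-1` S = S)//; apply/seteqP; split => -[].
Qed.

(** For each first coordinate, the section of [S] belongs to the sigma-algebra of [G2] and is thus
    independent of [G]; the factor [P G] then leaves the outer integral. *)
Lemma product_restrict (S : set (T * g_sigma_algebraType G2)) (G : set T) :
  measurable S -> <<s G3 >> G -> Q (S `&` (setT `*` G)) = (P G * Q S)%E.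
Proof.
move=> mS sG; have mS' := measurable_sub_prod mS; have mG := measurable_sub_set G3m sG.
rewrite /product_prob /product_measure1 /= muleC -ge0_integralZr//; last first.
  exact: (measurable_fun_xsection P mS').
apply: eq_integral => w _ /=.
rewrite -(ind _ sG); last by have := measurable_xsection w mS.
by congr (P _); apply/seteqP; split => v; rewrite /xsection /= !inE => -[] // ? [].
Qed.

Lemma product_partition (F : set (T * T)) (N : T -> nat) (H : set T) : measurable F ->
  measurable H -> (forall k, measurable (N @^-1` [set k])) ->
  Q (F `&` (setT `*` H)) = (\sum_(k <oo) Q (F `&` (setT `*` (N @^-1` [set k] `&` H))))%E.
Proof.
move=> mF mH mN.
rewrite -(measure_semi_bigcup Q).
- congr (Q _); apply/seteqP; split => [[v w] [Fvw [_ Hw]]|[v w] [k _ [Fvw [_ [_ Hw]]]]] //.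
  by exists (N w).
- by move=> k; apply: measurableI => //; apply: measurableX => //; exact: measurableI.
- move=> i j _ _ [[v w] [] [_ [_ [/= <- _]]] [_ [_ [<- _]]]]; by [].
- apply: bigcup_measurable => k _; apply: measurableI => //; apply: measurableX => //;
  exact: measurableI.
Qed.

Variables (N : T -> nat) (H : set T) (F : set (T * T))
  (S : nat -> set (T * g_sigma_algebraType G2)) (c : R).
Hypotheses (mF : measurable F) (mN : forall k, <<s G3 >> (N @^-1` [set k]))
  (mH : <<s G3 >> H) (mS : forall k, measurable (S k)) (c0 : 0 <= c)
  (FS : forall k v w, N w = k -> H w -> F (v, w) <-> S k (v, w)).

Let mNH k : <<s G3 >> (N @^-1` [set k] `&` H).
Proof. exact: (@measurableI _ (g_sigma_algebraType G3) _ _ (mN k) mH). Qed.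

Let series_H : (\sum_(k <oo) P (N @^-1` [set k] `&` H) = P H)%E.
Proof.
rewrite -(measure_semi_bigcup P).
- congr (P _); apply/seteqP; split => [w [k _ []]|w Hw] //.
  by exists (N w).
- by move=> k; exact: measurable_sub_set (mNH k).
- by move=> i j _ _ [w [] [/= <- _] [<- _]].
- by apply: bigcup_measurable => k _; exact: measurable_sub_set (mNH k).
Qed.

Let cell k : Q (F `&` (setT `*` (N @^-1` [set k] `&` H))) = (P (N @^-1` [set k] `&` H) * Q (S k))%E.
Proof.
rewrite -(product_restrict (mS k) (mNH k)); congr (product_prob P P _).
apply/seteqP; split => -[v w] [Fvw [_ [Nw Hw]]]; split => //.
- exact/(FS v Nw Hw).
- exact/(FS v Nw Hw).
Qed.

(** On {N = k} within [H], [F] may be replaced by [S k], which is independent of the index. As Q(S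
    k) does not depend on k, the sum over k only rebuilds P(H). *)
Lemma mixture_eq : (forall k, Q (S k) = c%:E) -> Q (F `&` (setT `*` H)) = (P H * c%:E)%E.
Proof.
move=> Sc; rewrite (@product_partition _ N) => //; last 2 first.
- exact: measurable_sub_set mH.
- by move=> k; exact: measurable_sub_set (mN k).
rewrite -series_H muleC -nneseriesZl//; apply: eq_eseriesr => k _.
by rewrite cell Sc muleC.
Qed.

Lemma mixture_le : (forall k, Q (S k) <= c%:E)%E -> (Q (F `&` (setT `*` H)) <= P H * c%:E)%E.
Proof.
move=> Sc; rewrite (@product_partition _ N) => //; last 2 first.
- exact: measurable_sub_set mH.
- by move=> k; exact: measurable_sub_set (mN k).
rewrite -series_H muleC -nneseriesZl//; apply: lee_nneseries => // k _.
by rewrite cell muleC lee_wpmul2r.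
Qed.

End product_mixture.

Lemma measurable_nat_rel d (T : measurableType d) (M N : T -> nat) (r : nat -> nat -> Prop) :
  measurable_fun setT M -> measurable_fun setT N -> measurable [set w | r (M w) (N w)].
Proof.
move=> mM mN.
rewrite (_ : [set w | _] = \bigcup_k (M @^-1` [set k] `&` N @^-1` [set j | r k j])); last first.
  by apply/seteqP; split => [w /= rw|w [k _ [/= <- //]]]; exists (M w).
apply: bigcup_measurable => k _; apply: measurableI; rewrite -[X in measurable X]setTI.
- exact: mM.
- exact: mN.
Qed.

Lemma sigma_of_generators_measurable d (T : measurableType d) d' (U : measurableType d')
    (I : Type) (D : set I) (X : I -> T -> U) : (forall i, D i -> measurable_fun setT (X i)) ->
  \bigcup_(i in D) preimage_set_system setT (X i) measurable `<=` measurable.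
Proof. by move=> mX _ [i Di [B mB <-]]; exact: mX. Qed.

Section sum_events.
Context {R : realType} d (T : measurableType d) (a b : R) (X1 X2 Y1 Y2 : T -> R).
Hypotheses (mX1 : measurable_fun setT X1) (mX2 : measurable_fun setT X2)
  (mY1 : measurable_fun setT Y1) (mY2 : measurable_fun setT Y2).

Lemma measurable_crossing : measurable [set w | X1 w + Y1 w < a /\ b <= X2 w + Y2 w].
Proof.
by apply: measurableI; [apply: measurable_set_ltr|apply: measurable_set_ler] => //;
  exact: measurable_funD.
Qed.

Lemma measurable_gap : measurable [set w | X1 w + Y1 w < a /\ b < X2 w + Y2 w].
Proof. by apply: measurableI; apply: measurable_set_ltr => //; exact: measurable_funD. Qed.

End sum_events.

Section product_trig.
Context {R : realType} d1 (T1 : measurableType d1) (P1 : probability T1 R)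
  d2 (T2 : measurableType d2) (P2 : probability T2 R).

Lemma bivariate_trig_add (X Y : T1 -> R) (X' Y' : T2 -> R) (p c q p' c' q' : R) :
  bivariate_trig P1 X Y p c q -> bivariate_trig P2 X' Y' p' c' q' ->
  bivariate_trig (product_prob P1 P2) (fun z => X z.1 + X' z.2) (fun z => Y z.1 + Y' z.2)
    (p + p') (c + c') (q + q').
Proof.
move=> [mX mY c1 s1] [mX' mY' c2 s2].
have mlin d (T : measurableType d) (f g : T -> R) a b : measurable_fun setT f ->
    measurable_fun setT g -> measurable_fun setT (fun w => a * f w + b * g w).
  by move=> mf mg; apply: measurable_funD; exact: measurable_funM.
split.
- by apply: measurable_funD;
  [exact: measurableT_comp mX measurable_fst|exact: measurableT_comp mX' measurable_snd].
- by apply: measurable_funD;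
  [exact: measurableT_comp mY measurable_fst|exact: measurableT_comp mY' measurable_snd].
- move=> a b; have := product_cos P1 P2 (mlin _ _ _ _ a b mX mY) (mlin _ _ _ _ a b mX' mY').
  rewrite c1 s1 c2 s2 mul0r subr0 -expRD.
  rewrite (_ : (fun z => cos _) = (fun z : T1 * T2 => cos (a * (X z.1 + X' z.2) + b *
    (Y z.1 + Y' z.2)))); last first.
    by apply/funext => z; congr cos; ring.
  by move=> ->; congr expR; field.
- move=> a b; have := product_sin P1 P2 (mlin _ _ _ _ a b mX mY) (mlin _ _ _ _ a b mX' mY').
  rewrite c1 s1 c2 s2 mul0r mulr0 addr0.
  rewrite (_ : (fun z => sin _) = (fun z : T1 * T2 => sin (a * (X z.1 + X' z.2) + b *
    (Y z.1 + Y' z.2)))) //.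
  by apply/funext => z; congr sin; ring.
Qed.

Lemma bivariate_trig_diag (X : T1 -> R) (p : R) : measurable_fun setT X ->
  (forall a, \int[P1]_w cos (a * X w) = expR (- a ^+ 2 * p / 2)) ->
  (forall a, \int[P1]_w sin (a * X w) = 0) -> bivariate_trig P1 X X p p p.
Proof.
move=> mX c s; split => // a b.
- rewrite (_ : (fun t => _) = (fun t => cos ((a + b) * X t))); last by apply/funext => t;
  rewrite mulrDl.
  by rewrite c; congr expR; field.
- rewrite (_ : (fun t => _) = (fun t => sin ((a + b) * X t))); last by apply/funext => t;
  rewrite mulrDl.
  exact: s.
Qed.

End product_trig.

(** * The process J and its sum with Z on a single cell *)

Section par.
Context {R : realType} d (Omega : measurableType d) (P : probability Omega R).
Variables (rho lambda : R) (eps : nat -> {RV P >-> R}) (nu : R -> {RV P >-> nat}) (J : R -> Omega -> R).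
Hypotheses (rho_lt1 : `|rho| < 1) (lambda_gt0 : 0 < lambda)
  (eps_indep : mutually_independent P (fun n => eps n : Omega -> R))
  (eps_law : forall n, has_law P (eps n) (normal_prob 0 (Num.sqrt (1 / 2))))
  (nu_poisson : poisson_process lambda nu)
  (eps_nu : independent_systems P (sigma_of setT (fun n => eps n : Omega -> R))
     (sigma_of [set t | 0 <= t] (fun t => nu t : Omega -> nat)))
  (JE : forall t w, 0 <= t -> J t w = ar_chain rho (fun n => eps n : Omega -> R) (nu t w) w).

Local Notation A := (ar_chain rho (fun n => eps n : Omega -> R)).
Local Notation Q := (product_prob P P).

Definition noise_sets := \bigcup_(i in [set: nat]) preimage_set_system setT (eps i : Omega ->
  R) measurable.
Definition clock_sets := \bigcup_(t in [set t : R | 0 <= t]) preimage_set_system setT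
  (nu t : Omega -> nat) measurable.
Definition jump_sets := \bigcup_(t in [set t : R | 0 <= t]) preimage_set_system setT (J t) measurable.

Lemma noise_measurable : noise_sets `<=` measurable.
Proof. by apply: sigma_of_generators_measurable => i _; exact: measurable_funPT. Qed.

Lemma clock_measurable : clock_sets `<=` measurable.
Proof. by apply: sigma_of_generators_measurable => i _; exact: measurable_funPT. Qed.

Lemma measurable_chain k : measurable_fun setT (A k).
Proof. by apply: measurable_ar_chain => i _; exact: measurable_funPT. Qed.

Lemma measurable_jump t : 0 <= t -> measurable_fun setT (J t).
Proof.
move=> t0 _ B mB; rewrite setTI.
rewrite (_ : _ @^-1` _ = \bigcup_k (nu t @^-1` [set k] `&` A k @^-1` B)); last first.
  by apply/seteqP; split => [w|w [k _ []]] /=; rewrite JE//; [exists (nu t w)|move=> ->].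
apply: bigcup_measurable => k _; apply: measurableI; rewrite -[X in measurable X]setTI.
- exact: measurable_funPT.
- exact: measurable_chain.
Qed.

Lemma jump_measurable : jump_sets `<=` measurable.
Proof. by apply: sigma_of_generators_measurable => t; exact: measurable_jump. Qed.

Lemma nu_le s t w : 0 <= s -> s <= t -> (nu s w <= nu t w)%N.
Proof. by move=> s0 st; have [/(_ w)[_ + _ _] _ _] := nu_poisson; apply. Qed.

Lemma clock_rel s t (r : nat -> nat -> Prop) : 0 <= s -> 0 <= t ->
  <<s clock_sets >> [set w | r (nu s w) (nu t w)].
Proof.
move=> s0 t0; apply: (@measurable_nat_rel _ (g_sigma_algebraType clock_sets) (nu s) (nu t)).
- exact: measurable_sigma_of.
- exact: measurable_sigma_of.
Qed.

Lemma nu_incr s t k : 0 <= s -> s < t ->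
  P [set w | (nu t w - nu s w)%N = k] = (poisson_pmf (lambda * (t - s)) k)%:E.
Proof. by have [_ _] := nu_poisson; apply. Qed.

Lemma chain_noise k : measurable_fun (setT : set (g_sigma_algebraType noise_sets)) (A k).
Proof. by apply: measurable_ar_chain => i _; exact: measurable_sigma_of. Qed.

Lemma chain_diag_trig k : bivariate_trig P (A k) (A k) (1 / 2) (1 / 2) (1 / 2).
Proof.
apply: bivariate_trig_diag; first exact: measurable_chain.
- move=> a; have [-> _] := ar_chain_trig eps_indep eps_law rho_lt1 k a.
  by congr expR; field.
- by move=> a; have [] := ar_chain_trig eps_indep eps_law rho_lt1 k a.
Qed.

Lemma chain_small (k : nat) (x e : R) : 0 < e ->
  (P [set w | (x <= A k w)%R /\ (A k w < x + e)%R] <= (2 * e * normal_peak (Num.sqrt (1 / 2)))%:E)%E.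
Proof.
move=> e0; set s : R := Num.sqrt (1 / 2); have mA := measurable_chain.
(* Widened to an open interval of length 2e, the event has the form handled by
   [bivariate_gap_unique]. This moves it to [eps 0], whose density is at most its peak. *)
apply: (@le_trans _ _ (P [set w | (A k w < x + e)%R /\ (x - e < A k w)%R])).
  apply: le_measure; rewrite ?inE.
  - by apply: measurableI; [exact: measurable_set_ler|exact: measurable_set_ltr].
  - by apply: measurableI; exact: measurable_set_ltr.
  - by move=> w /= [h1 ->]; split => //; lra.
rewrite (bivariate_gap_unique (chain_diag_trig k) (chain_diag_trig 0)) /=.
rewrite (_ : [set t | _] = eps 0%N @^-1` `]x - e, x + e[%classic); last first.
  by apply/seteqP; split => w /=; rewrite in_itv/=; [move=> [-> ->]|move=> /andP[]].
rewrite eps_law// -/s /normal_prob.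
have s0 : s != 0 by rewrite gt_eqF// sqrtr_gt0 divr_gt0.
apply: (@le_trans _ _ (\int[lebesgue_measure]_(y in `](x - e)%R, (x + e)%R[%classic)
  (normal_peak s)%:E)%E).
  apply: ge0_le_integral => //.
  - by move=> y _; rewrite lee_fin normal_pdf_ge0.
  - by apply/measurable_EFinP; apply: measurable_funTS; exact: measurable_normal_pdf.
  - by move=> y _; rewrite lee_fin normal_pdf_ub.
rewrite integral_cst//= lebesgue_measure_itv/= lte_fin; case: ifPn => [_|].
  by rewrite -EFinB -EFinM lee_fin le_eqVlt; apply/orP; left; apply/eqP; ring.
by move=> _; rewrite mule0 lee_fin mulr_ge0 ?normal_peak_ge0// mulr_ge0// ltW.
Qed.

Variables (T : R) (Z : R -> {RV P >-> R}) (Gamma : R -> R).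
Hypotheses (Z_gaussian : gaussian_process P `[0, T] Z)
  (Z_centered : centered_process P `[0, T] Z)
  (Z_cov : covariance_function P `[0, T] Z Gamma)
  (Gamma0 : Gamma 0 = 1 / 2)
  (ZJ_indep : independent_systems P (sigma_of `[0, T] (fun t => Z t : Omega -> R))
     (sigma_of [set t : R | 0 <= t] J)).

Definition signal_sets := \bigcup_(t in [set` `[0, T]]) preimage_set_system setT (Z t : Omega ->
  R) measurable.

Lemma signal_measurable : signal_sets `<=` measurable.
Proof. by apply: sigma_of_generators_measurable => i _; exact: measurable_funPT. Qed.

Lemma signal_trig s t : s \in `[0, T] -> t \in `[0, T] ->
  bivariate_trig P (Z s) (Z t) (1 / 2) (Gamma (t - s)) (1 / 2).
Proof.
move=> Ds Dt; apply: gaussian_pair_trig; try exact: measurable_funPT.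
- move=> a b; have := gaussian_process3 Z_gaussian a b 0 Ds Dt Dt.
  by rewrite (_ : (fun w => _) = (fun w => a * Z s w + b * Z t w))//; apply/funext => w;
    rewrite mul0r addr0.
- exact: Z_centered.
- exact: Z_centered.
- by rewrite expr2 Z_cov// subrr Gamma0.
- by rewrite expr2 Z_cov// subrr Gamma0.
- by rewrite Z_cov.
Qed.

Lemma covariance_bound s t : s \in `[0, T] -> t \in `[0, T] -> `|Gamma (t - s)| <= 1 / 2.
Proof.
move=> Ds Dt.
have := inner_cauchy_schwarz (process_sq_integrable Z_cov Ds) (process_sq_integrable Z_cov Dt).
rewrite !(process_inner Z_cov)// !subrr Gamma0 => h.
have h2 : (0 : R) <= 1 / 2 by rewrite divr_ge0.
by rewrite -ler_sqr ?nnegrE// real_normK ?num_real// expr2.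
Qed.

Section cells.
Variables (s t : R).
Hypotheses (s0 : 0 <= s) (st : s < t) (tT : t <= T).

Let t0 : 0 <= t. Proof. exact: le_trans s0 (ltW st). Qed.
Let Ds : s \in `[0, T]. Proof. by rewrite in_itv/= s0 (le_trans (ltW st)). Qed.
Let Dt : t \in `[0, T]. Proof. by rewrite in_itv/= t0. Qed.

Let mZ r d0 (U : measurableType d0) : measurable_fun setT (fun z : Omega * U => Z r z.1).
Proof. by apply: measurableT_comp measurable_fst; exact: measurable_funPT. Qed.
Let mZs r d0 (U : measurableType d0) : r \in `[0, T] ->
  measurable_fun (setT : set (g_sigma_algebraType signal_sets * U)) (fun z => Z r z.1).
Proof. by move=> Dr; apply: measurableT_comp measurable_fst; exact: measurable_sigma_of. Qed.
Let mA k : measurable_fun (setT : set (Omega * g_sigma_algebraType noise_sets)) (fun z => A k z.2).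
Proof. by apply: measurableT_comp measurable_snd; exact: chain_noise. Qed.
Let mJ r : 0 <= r -> measurable_fun (setT : set
  (g_sigma_algebraType signal_sets * g_sigma_algebraType jump_sets)) (fun z => J r z.2).
Proof. by move=> r0; apply: measurableT_comp measurable_snd; exact: measurable_sigma_of. Qed.
Let mJo r : 0 <= r -> measurable_fun (setT : set (Omega * Omega)) (fun z => J r z.2).
Proof. by move=> r0; apply: measurableT_comp measurable_snd; exact: measurable_jump. Qed.
Let mnu (r : R) (k : nat) : 0 <= r -> <<s clock_sets >> (nu r @^-1` [set k]).
Proof. by move=> r0; exact: (@clock_rel r r (fun i _ => i = k)). Qed.

Variable u : R.
Let r := 1 / 2 + Gamma (t - s).

Let r1 : -1 <= r <= 1.
Proof. by have := covariance_bound Ds Dt; rewrite ler_norml /r => /andP[? ?]; apply/andP; split;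
  lra. Qed.

(** J is frozen at the left end of the cell. For nu(s) = k the event becomes [Fk k], whose second
    coordinate only involves the noise. *)
Let F : set (Omega * Omega) := [set z | Z s z.1 + J s z.2 < u /\ u <= Z t z.1 + J s z.2].
Let Fk k : set (Omega * g_sigma_algebraType noise_sets) :=
  [set z | Z s z.1 + A k z.2 < u /\ u <= Z t z.1 + A k z.2].

Let mF : measurable F.
Proof. exact: (measurable_crossing _ _ (@mZ s _ _) (@mZ t _ _) (@mJo _ s0) (@mJo _ s0)). Qed.

Let mFk k : measurable (Fk k).
Proof. exact: (measurable_crossing _ _ (@mZ s _ _) (@mZ t _ _) (@mA k) (@mA k)). Qed.

Let QFk k : Q (Fk k) = (crossing_prob u r)%:E.
Proof.
apply: crossing_probE => //.
have := bivariate_trig_add (signal_trig Ds Dt) (chain_diag_trig k).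
rewrite (_ : 1 / 2 + 1 / 2 = 1); last by field.
by rewrite addrC.
Qed.

Let c0 : 0 <= crossing_prob u r.
Proof. by rewrite /crossing_prob fine_ge0. Qed.

Let FS k v w : nu s w = k -> F (v, w) <-> Fk k (v, w).
Proof. by rewrite /F /Fk /= JE// => ->. Qed.

Let mix H : <<s clock_sets >> H -> Q (F `&` (setT `*` H)) = (P H * (crossing_prob u r)%:E)%E.
Proof.
move=> mH; apply: (mixture_eq noise_measurable clock_measurable eps_nu (N := nu s) (S := Fk)) => //.
- by move=> k; exact: (@mnu _ k s0).
- by move=> k v w /FS.
Qed.

Let cross (w : Omega) := Z s w + J s w < u /\ u <= Z t w + J s w.

(* The event G stands for the absence of jumps. Only the sigma-algebra of J, not
   that of nu, is independent of Z, so that G is merely known to lie between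
   the absence of ticks of nu and the sure event. *)
Lemma crossing_cell (G : set Omega) : <<s jump_sets >> G ->
  [set w | nu t w = nu s w] `<=` G ->
  (P ([set w | cross w] `&` G) <= (crossing_prob u r)%:E)%E /\
  ((expR (- (lambda * (t - s))) * crossing_prob u r)%:E <= P ([set w | cross w] `&` G))%E.
Proof.
move=> sG HG.
have E : P ([set w | cross w] `&` G) = Q (F `&` (setT `*` G)).
  have := @decoupling _ _ _ P signal_sets jump_sets (F `&`
    (setT `*` G)) signal_measurable jump_measurable ZJ_indep.
  move=> <-.
    by congr (P _); apply/seteqP; split => w [] // h1 h2; split => //; case: h2.
  apply: measurableI; last exact: measurableX.
  exact: (measurable_crossing _ _ (@mZs _ _ _ Ds) (@mZs _ _ _ Dt) (@mJ _ s0) (@mJ _ s0)).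
have mG := measurable_sub_set jump_measurable sG.
split.
- rewrite E; apply: (@le_trans _ _ (Q (F `&` (setT `*` setT)))).
    apply: le_measure; rewrite ?inE.
    + by apply: measurableI; [exact: mF|exact: measurableX].
    + by apply: measurableI; [exact: mF|exact: measurableX].
    + by apply: setIS => -[v w].
  rewrite mix; last exact: (@measurableT _ (g_sigma_algebraType clock_sets)).
  by rewrite (_ : P setT = 1%E) ?mul1e//; exact: probability_setT.
- have sH : <<s clock_sets >> [set w | nu t w = nu s w] by exact: (@clock_rel s t (fun i j => j = i)).
  rewrite E; apply: (@le_trans _ _ (Q (F `&` (setT `*` [set w | nu t w = nu s w])))); last first.
    apply: le_measure; rewrite ?inE.
    + apply: measurableI; first exact: mF.
      by apply: measurableX => //; exact: (measurable_sub_set clock_measurable sH).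
    + by apply: measurableI; [exact: mF|exact: measurableX].
    + by apply: setIS => -[v w] [_ /HG].
  rewrite mix// EFinM; apply: lee_wpmul2r => //.
  rewrite (_ : [set w | _] = [set w | (nu t w - nu s w)%N = 0%N]); last first.
    apply/seteqP; split => w /=; first by move=> ->; rewrite subnn.
    by move=> h; apply/eqP; rewrite eqn_leq -subn_eq0 h eqxx nu_le// ltW.
  rewrite nu_incr// lee_fin /poisson_pmf.
  by rewrite mulr_gt0 ?subr_gt0//= expr0 fact0 divr1 mul1r.
Qed.

(** With the path of Z and the index k fixed, a crossing with increment below e confines A_k to an
    interval [u - Z(t), u - Z(t) + e[, and the bounded density of A_k gives the estimate. Taking e
    proportional to the mesh keeps the sum over cells bounded. *)
Lemma crossing_slow (e : R) : 0 < e ->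
  (P [set w | cross w /\ (Z t w - Z s w < e)%R] <= (2 * e * normal_peak (Num.sqrt (1 / 2)))%:E)%E.
Proof.
move=> e0; set c := 2 * e * _.
have cp : 0 <= c by rewrite /c mulr_ge0 ?normal_peak_ge0// mulr_ge0// ltW.
pose slow d0 (U : measurableType d0) : set (Omega * U) := [set z | Z t z.1 - Z s z.1 < e].
have mslow d0 (U : measurableType d0) : measurable (slow d0 U).
  by apply: measurable_set_ltr => //; apply: measurable_funB; exact: mZ.
have E : P [set w | cross w /\ Z t w - Z s w < e] = Q (F `&` slow _ _).
  have := @decoupling _ _ _ P signal_sets jump_sets
    (F `&` slow _ _) signal_measurable jump_measurable ZJ_indep.
  move=> <- //; apply: measurableI.
    exact: (measurable_crossing _ _ (@mZs _ _ _ Ds) (@mZs _ _ _ Dt) (@mJ _ s0) (@mJ _ s0)).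
  by apply: measurable_set_ltr => //; apply: measurable_funB; exact: mZs.
rewrite E (_ : F `&` _ = (F `&` slow _ _) `&` (setT `*` setT)); last by rewrite setXTT setIT.
apply: (@le_trans _ _ (P setT * c%:E)%E); last first.
  by rewrite (_ : P setT = 1%E) ?mul1e//; exact: probability_setT.
apply: (mixture_le noise_measurable clock_measurable eps_nu (N := nu s)
  (S := fun k => Fk k `&` slow _ _)) => //.
- by apply: measurableI; [exact: mF|exact: mslow].
- by move=> k; exact: (@mnu _ k s0).
- exact: (@measurableT _ (g_sigma_algebraType clock_sets)).
- by move=> k; apply: measurableI; [exact: mFk|exact: mslow].
- by move=> k v w Nk _; have [h1 h2] := FS v Nk; split => -[h3 h4]; split => //; [exact: h1|exact: h2].
move=> k; rewrite /product_prob /product_measure1 /=.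
have mS := measurable_sub_prod noise_measurable (measurableI _ _ (mFk k) (@mslow _ _)).
apply: (@le_trans _ _ (\int[P]_w c%:E)%E).
  apply: ge0_le_integral => //.
  - exact: (measurable_fun_xsection P mS).
  - move=> w _ /=; apply: le_trans (@chain_small k (u - Z t w) e e0).
    apply: le_measure; rewrite ?inE.
    + exact: measurable_xsection.
    + by apply: measurableI; [apply: measurable_set_ler|apply: measurable_set_ltr] => //;
      exact: measurable_chain.
    + by move=> v; rewrite /xsection /= inE => -[[h1 h2] h3]; rewrite /slow /= in h1 h2 h3 *;
      split; lra.
rewrite integral_cst// -[leRHS]mule1; apply: lee_wpmul2l; first by rewrite lee_fin.
exact: (@probability_le1 _ _ _ P).
Qed.

Section gaps.
Context d' (Omega' : measurableType d') (P' : probability Omega' R) (V W : Omega' -> R).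
Hypothesis VW_trig : bivariate_trig P' V W 1 ((1 + rho) / 2) 1.
Variables (a b : R).
Hypothesis ab : a <= b.

(** Z is taken at the same time t on both sides. It then adds exactly 1/2 to the variances and to
    the covariance, so that across one jump the pair has exactly the law of (V, W). *)
Let FU : set (Omega * Omega) := [set z | Z t z.1 + J s z.2 < a /\ b < Z t z.1 + J t z.2].
Let FUk k : set (Omega * g_sigma_algebraType noise_sets) :=
  [set z | Z t z.1 + A k z.2 < a /\ b < Z t z.1 + A k.+1 z.2].
Let p := fine (P' [set w | V w < a /\ b < W w]).

Let mFU : measurable FU.
Proof. exact: (measurable_gap _ _ (@mZ t _ _) (@mZ t _ _) (@mJo _ s0) (@mJo _ t0)). Qed.

Let mFUk k : measurable (FUk k).
Proof. exact: (measurable_gap _ _ (@mZ t _ _) (@mZ t _ _) (@mA k) (@mA k.+1)). Qed.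

Let QFUk k : Q (FUk k) = p%:E.
Proof.
have h := bivariate_trig_add (signal_trig Dt Dt) (ar_chain_pair_trig eps_indep eps_law rho_lt1 k).
rewrite subrr Gamma0 (_ : 1 / 2 + 1 / 2 = 1) in h; last by field.
rewrite (_ : 1 / 2 + rho / 2 = (1 + rho) / 2) in h; last by field.
rewrite [LHS](bivariate_gap_unique h VW_trig a b) /p fineK// fin_num_measure//.
have [mV mW _ _] := VW_trig.
by apply: measurableI; exact: measurable_set_ltr.
Qed.

Let one_jump := [set w | (nu t w - nu s w)%N = 1%N].
Let two_jumps := [set w | (1 < nu t w - nu s w)%N].

Let s1 : <<s clock_sets >> one_jump.
Proof. exact: (@clock_rel s t (fun i j => (j - i)%N = 1%N)). Qed.
Let s2 : <<s clock_sets >> two_jumps.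
Proof. exact: (@clock_rel s t (fun i j => (1 < j - i)%N)). Qed.
Let m1 : measurable one_jump. Proof. exact: (measurable_sub_set clock_measurable s1). Qed.
Let m2 : measurable two_jumps. Proof. exact: (measurable_sub_set clock_measurable s2). Qed.

Let x := lambda * (t - s).
Let x0 : 0 < x. Proof. by rewrite mulr_gt0// subr_gt0. Qed.

Let P_one : P one_jump = (x * expR (- x))%:E.
Proof. by rewrite nu_incr// /poisson_pmf x0 expr1 (_ : 1`! = 1%N)// divr1. Qed.

(** exp(-x) >= 1 - x gives 1 - (1 + x) exp(-x) <= 1 - (1 + x)(1 - x). *)
Lemma two_jumps_le : (P two_jumps <= (x ^+ 2)%:E)%E.
Proof.
have E : two_jumps = ~` ([set w | (nu t w - nu s w)%N = 0%N] `|` one_jump).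
  apply/seteqP; split => w /=; rewrite /two_jumps /one_jump /=; case: (nu t w - nu s w)%N => [|[|n]]//.
  - by move=> _ [].
  - by move=> h; case: h; left.
  - by move=> h; case: h; right.
have m0 : measurable [set w | (nu t w - nu s w)%N = 0%N].
  by apply: (measurable_sub_set clock_measurable); exact: (@clock_rel s t (fun i j => (j - i)%N = 0%N)).
rewrite E probability_setC; last exact: measurableU.
have PU : P ([set w | (nu t w - nu s w)%N = 0%N] `|` one_jump) = (P [set w |
  (nu t w - nu s w)%N = 0%N] + P one_jump)%E.
  by apply: measureU => //; apply/seteqP; split => w //=; rewrite /one_jump /= => -[->].
rewrite PU P_one nu_incr// -/x /poisson_pmf x0 expr0 fact0 divr1 mul1r.
rewrite -[leLHS]/((1 - (expR (- x) + x * expR (- x)))%:E) lee_fin.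
have := expR_ge1Dx (- x); have := x0; nra.
Qed.

(** Exactly one jump contributes x exp(-x) p. Without a jump the two sides coincide, which a <= b
    excludes; two jumps or more cost at most x^2, negligible after summation over the cells. *)
Lemma gap_cell :
  ((x * expR (- x) * p)%:E <= P [set w | (Z t w + J s w < a)%R /\ (b < Z t w + J t w)%R])%E /\
  (P [set w | (Z t w + J s w < a)%R /\ (b < Z t w + J t w)%R] <= (x * p + x ^+ 2)%:E)%E.
Proof.
have -> : P [set w | Z t w + J s w < a /\ b < Z t w + J t w] = Q FU.
  have := @decoupling _ _ _ P signal_sets jump_sets FU signal_measurable jump_measurable ZJ_indep.
  move=> <- //.
  exact: (measurable_gap _ _ (@mZs _ _ _ Dt) (@mZs _ _ _ Dt) (@mJ _ s0) (@mJ _ t0)).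
have mix1 : Q (FU `&` (setT `*` one_jump)) = (P one_jump * p%:E)%E.
  apply: (mixture_eq noise_measurable clock_measurable eps_nu (N := nu s) (S := FUk)) => //.
  - by move=> k; exact: (@mnu _ k s0).
  - move=> k v w Nk; rewrite /one_jump /= /FU /FUk /= !JE// Nk => h.
    suff -> : nu t w = k.+1 by [].
    have := nu_le w s0 (ltW st); rewrite Nk => /subnK <-.
    by rewrite h add1n.
rewrite P_one -EFinM in mix1; rewrite -mix1; split.
  by apply: le_measure; rewrite ?inE//; apply: measurableI => //; exact: measurableX.
apply: (@le_trans _ _ (Q ((FU `&` (setT `*` one_jump)) `|` (setT `*` two_jumps)))).
  apply: le_measure; rewrite ?inE//.
    by apply: measurableU; [apply: measurableI => //|]; exact: measurableX.
  move=> [v w] Fvw; have := Fvw; rewrite /FU /= !JE//.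
  case E : (nu t w - nu s w)%N => [|[|n]].
  - have -> : nu t w = nu s w by apply/eqP; rewrite eqn_leq -subn_eq0 E eqxx nu_le// ltW.
    by move=> [h1 h2]; move: ab; rewrite leNgt; case/negP; exact: lt_trans h2 h1.
  - by move=> h; left; split.
  - by move=> h; right; split => //; rewrite /two_jumps /= E.
apply: (le_trans (measureU2 _ _ _)).
- by apply: measurableI => //; exact: measurableX.
- exact: measurableX.
rewrite EFinD; apply: leeD.
- apply: (@le_trans _ _ (x * expR (- x) * p)%:E); first by rewrite -mix1.
  rewrite lee_fin; apply: ler_wpM2r; first by rewrite /p fine_ge0.
  by rewrite ler_piMr ?(ltW x0)// -[leRHS]expR0 ler_expR oppr_le0 ltW.
- rewrite [leLHS]product_measure1E//; apply: le_trans _ two_jumps_le.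
  rewrite -[leRHS]mul1e; apply: lee_wpmul2r => //; exact: (@probability_le1 _ _ _ P).
Qed.

End gaps.

Lemma jump_prob_le : (P [set w | (nu s w < nu t w)%N] <= (lambda * (t - s))%:E)%E.
Proof.
have m0 : measurable [set w | (nu t w - nu s w)%N = 0%N].
  by apply: (measurable_sub_set clock_measurable); exact: (@clock_rel s t (fun i j => (j - i)%N = 0%N)).
rewrite (_ : [set w | _] = ~` [set w | (nu t w - nu s w)%N = 0%N]); last first.
  by apply/seteqP; split => w /=; rewrite -subn_gt0; case: (nu t w - nu s w)%N.
rewrite probability_setC// nu_incr// /poisson_pmf mulr_gt0 ?subr_gt0// expr0 fact0 divr1 mul1r.
by rewrite -EFinB lee_fin; have := expR_ge1Dx (- (lambda * (t - s))); lra.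
Qed.

End cells.
End par.

(** * Counting points with dyadic cells *)

Section limit_inferior.
Context {R : realType}.

Lemma limn_einf_ge (u : nat -> \bar R) (a : \bar R) :
  (\forall n \near \oo, (a <= u n)%E) -> (a <= limn_einf u)%E.
Proof.
move=> [N _ HN]; rewrite limn_einf_lim; apply: lime_ge; first exact: is_cvg_einfs.
exists N => // n Nn; apply: le_ereal_inf_tmp => _ /= [k nk <-]; apply: HN => /=.
exact: leq_trans Nn nk.
Qed.

Lemma limn_einf_le (u : nat -> \bar R) (a : \bar R) :
  (\forall n \near \oo, (u n <= a)%E) -> (limn_einf u <= a)%E.
Proof.
move=> [N _ HN]; rewrite limn_einf_lim; apply: lime_le; first exact: is_cvg_einfs.
exists N => // n Nn; apply: (@le_trans _ _ (u n)); last exact: HN.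
by apply: ereal_inf_lbound; exists n => /=.
Qed.

Lemma limn_einf_le_cvg (u : nat -> \bar R) (a : nat -> R) (c : R) :
  (forall n, (u n <= (a n)%:E)%E) -> a n @[n --> \oo] --> c -> (limn_einf u <= c%:E)%E.
Proof.
move=> ua ac; apply/lee_addgt0Pr => e e0; rewrite -EFinD; apply: limn_einf_le.
move/cvgrPdist_le : ac => /(_ _ e0); apply: filterS => n; rewrite ler_distlC => /andP[_ h].
by apply: le_trans (ua n) _; rewrite lee_fin.
Qed.

End limit_inferior.

Section hits.
Context {R : realType} d (Omega : measurableType d) (P : probability Omega R).

Definition hits (n : nat) (A : nat -> set Omega) (w : Omega) : nat :=
  count (fun i => w \in A i) (iota 0 (2 ^ n)).

Lemma hitsE n A w : (hits n A w)%:R = \sum_(0 <= i < 2 ^ n) \1_(A i) w :> R.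
Proof.
rewrite /hits -sum1_count big_mkcond /= natr_sum /index_iota subn0.
by apply: eq_bigr => i _; rewrite indicE; case: (w \in A i).
Qed.

Lemma measurable_hits n A : (forall i, measurable (A i)) ->
  measurable_fun setT (fun w => ((hits n A w)%:R : R)).
Proof.
move=> mA; rewrite (_ : (fun w => _) = (fun w => \sum_(0 <= i < 2 ^ n) \1_(A i) w)); last first.
  by apply/funext => w; rewrite hitsE.
by apply: measurable_sum => i; exact: measurable_indic.
Qed.

Lemma integral_hits n A : (forall i, measurable (A i)) ->
  (\int[P]_w ((hits n A w)%:R : R)%:E = \sum_(0 <= i < 2 ^ n) P (A i))%E.
Proof.
move=> mA; under eq_integral do rewrite hitsE -sumEFin.
rewrite ge0_integral_sum//.
- by apply: eq_bigr => i _; rewrite integral_indic// setIT.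
- by move=> i; apply/measurable_EFinP; exact: measurable_indic.
Qed.

Lemma hits_le n A B w : (forall i, A i `<=` B i) -> (hits n A w <= hits n B w)%N.
Proof. by move=> AB; apply: sub_count => i; rewrite !inE => /AB. Qed.

(** The halves 2i and 2i + 1 of distinct cells are distinct, so a hit of a cell is paid for by a hit
    of one of its own halves. *)
Lemma hits_refine n (B : nat -> nat -> set Omega) w :
  (forall i, B n i `<=` B n.+1 i.*2 `|` B n.+1 i.*2.+1) ->
  (hits n (B n) w <= hits n.+1 (B n.+1) w)%N.
Proof.
move=> BB; rewrite /hits expnS mul2n.
elim: (2 ^ n)%N => // k IH; rewrite doubleS -addn1 iotaD count_cat.
rewrite -[in leqRHS]addn2 iotaD count_cat add0n; apply: leq_add => //=.
rewrite !addn0; case: (boolP (w \in B n k)) => // /set_mem /BB[h|h].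
- by rewrite (mem_set h).
- by rewrite (mem_set h) addn1.
Qed.

End hits.

Section grid.
Context {R : realType} (T : R).
Hypothesis T_gt0 : 0 < T.

Definition grid (n i : nat) : R := i%:R * T / 2 ^+ n.

Lemma grid_le n i j : (i <= j)%N -> grid n i <= grid n j.
Proof.
move=> ij; rewrite /grid ler_pM2r ?invr_gt0 ?exprn_gt0//.
by rewrite ler_pM2r// ler_nat.
Qed.

Lemma grid0 n : grid n 0 = 0. Proof. by rewrite /grid mul0r mul0r. Qed.

Lemma grid_max n : grid n (2 ^ n) = T.
Proof. by rewrite /grid natrX mulrAC mulfV ?mul1r// expf_neq0. Qed.

Lemma grid_step n i : grid n i.+1 - grid n i = T / 2 ^+ n.
Proof. by rewrite /grid -mulrBl -mulrBl -natrB// subSnn mul1r. Qed.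

Lemma grid_refine n i : grid n.+1 i.*2 = grid n i.
Proof. by rewrite /grid -muln2 natrM exprS; field; rewrite expf_neq0. Qed.

Lemma cvg_mesh : T / 2 ^+ n @[n --> \oo] --> (0 : R).
Proof.
rewrite (_ : (fun n => _) = (fun n => T * (2^-1) ^+ n)); last first.
  by apply/funext => n; rewrite exprVn.
rewrite -[X in _ --> X](mulr0 T); apply: cvgMr; apply: cvg_expr.
by rewrite gtr0_norm ?invr_gt0// invf_lt1// ltr1n.
Qed.

(** Cells are open on the left and closed on the right: paths of J are right-continuous, so a jump
    at the right end is already visible there. *)
Lemma grid_cell n s : 0 < s < T -> exists2 i, (i < 2 ^ n)%N & grid n i < s <= grid n i.+1.
Proof.
move=> /andP[s0 sT].
have ex : exists i, s <= grid n i by exists (2 ^ n)%N; rewrite grid_max ltW.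
case: (ex_minnP ex) => -[|i] hi min_i; first by move: s0; rewrite ltNge -(grid0 n) hi.
exists i; last by rewrite hi andbT ltNge; apply/negP => /min_i; rewrite ltnn.
by apply: min_i; rewrite grid_max ltW.
Qed.

Lemma grid_cell_unique n i j s : grid n i < s <= grid n i.+1 -> grid n j < s <= grid n j.+1 -> i = j.
Proof.
move=> /andP[h1 h2] /andP[h3 h4]; apply/eqP; rewrite eqn_leq; apply/andP; split; rewrite leqNgt;
  apply/negP.
- by move=> /grid_le h; move: h1; rewrite ltNge (le_trans h4 (h n)).
- by move=> /grid_le h; move: h3; rewrite ltNge (le_trans h2 (h n)).
Qed.

End grid.

Lemma near_all_seq (I : eqType) (l : seq I) (Q : I -> nat -> Prop) :
  (forall s, s \in l -> \forall n \near \oo, Q s n) ->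
  \forall n \near \oo, forall s, s \in l -> Q s n.
Proof.
elim: l => [|s l IH] HQ; first exact: nearW.
have := IH (fun s' h => HQ s' (mem_behead (s := s :: l) h)).
have := HQ s (mem_head _ _); apply: filterS2 => n h1 h2 s'.
by rewrite inE => /predU1P[->|]; [exact: h1|exact: h2].
Qed.

Section counting_points.
Context {R : realType} d (Omega : measurableType d) (T : R).
Hypothesis T_gt0 : 0 < T.
Variables (S : set R) (w : Omega).
Hypothesis S_T : forall s, S s -> 0 < s < T.

Lemma hits_le_counting n (A : nat -> set Omega) :
  (forall i, (i < 2 ^ n)%N -> A i w -> exists2 s, S s & grid T n i < s <= grid T n i.+1) ->
  ((hits n A w)%:R%:E <= (counting S : \bar R))%E.
Proof.
move=> HA; rewrite /counting; case: asboolP => [fS|_]; last by rewrite leey.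
rewrite lee_fin ler_nat /hits -size_filter.
have /choice[f Hf] : forall i, exists s, (i < 2 ^ n)%N -> A i w ->
  S s /\ grid T n i < s <= grid T n i.+1.
  move=> i; have [[h1 h2]|h] := pselect ((i < 2 ^ n)%N /\ A i w).
    by have [s Ss hs] := HA i h1 h2; exists s.
  by exists 0 => h1 h2; case: h.
set l := [seq i <- _ | _].
have lP i : i \in l -> S (f i) /\ grid T n i < f i <= grid T n i.+1.
  by rewrite mem_filter mem_iota add0n => /andP[/set_mem h1 /= h2]; exact: Hf.
rewrite -(size_map f); apply: uniq_leq_size.
  rewrite map_inj_in_uniq ?filter_uniq ?iota_uniq// => i j /lP[_ hi] /lP[_ hj] e.
  by rewrite e in hi; exact: grid_cell_unique hi hj.
by move=> _ /mapP[i /lP[Sf _] ->]; rewrite in_fset_set// inE.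
Qed.

(** Once the mesh is below all mutual distances, distinct points lie in distinct cells. *)
Lemma size_le_hits (l : seq R) (A : nat -> nat -> set Omega) : uniq l -> (forall s, s \in l -> S s) ->
  (forall s, s \in l -> \forall n \near \oo, forall i, grid T n i < s <= grid T n i.+1 -> A n i w) ->
  \forall n \near \oo, (size l <= hits n (A n) w)%N.
Proof.
move=> ul lS HA.
have H1 := near_all_seq HA.
have H2 : \forall n \near \oo, forall s, s \in l -> forall s', s' \in l -> s != s' ->
  T / 2 ^+ n < `|s - s'|.
  apply: near_all_seq => s _; apply: near_all_seq => s' _.
  have [->|ss'] := eqVneq s s'; first by apply: nearW.
  have h0 : 0 < `|s - s'| by rewrite normr_gt0 subr_eq0.
  move/cvgr0Pnorm_lt : (cvg_mesh T) => /(_ _ h0); apply: filterS => n h _.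
  by apply: le_lt_trans h; exact: ler_norm.
move: H1 H2; apply: filterS2 => n H1 H2.
have /choice[f Hf] : forall s, exists i, s \in l -> (i < 2 ^ n)%N /\ grid T n i < s <= grid T n i.+1.
  move=> s; case: (boolP (s \in l)) => [/lS /S_T|_]; last by exists 0%N.
  by move=> /(grid_cell n)[i h1 h2]; exists i.
rewrite /hits -size_filter -(size_map f); apply: uniq_leq_size.
  rewrite map_inj_in_uniq// => s s' sl sl' e.
  have [_ /andP[h1 h2]] := Hf s sl; have [_] := Hf s' sl'; rewrite -e => /andP[h3 h4].
  apply/eqP; apply: contraT => ne; have := H2 s sl s' sl' ne.
  by rewrite -(grid_step T n (f s)) => h; exfalso; move: h; rewrite ltNge; apply/negP/negPn;
    rewrite ler_norml; apply/andP; split; lra.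
move=> _ /mapP[s sl ->]; have [h1 h2] := Hf s sl.
by rewrite mem_filter mem_iota add0n /= h1 andbT; apply/mem_set; exact: (H1 s sl).
Qed.

(** Every finite set of points is eventually detected. If [S] is infinite, finite subsets of
    arbitrary size make the iterated lower limit infinite. *)
Lemma counting_le_liminf (A : nat -> nat -> nat -> set Omega) :
  (forall s, S s -> \forall m \near \oo, \forall n \near \oo,
    forall i, grid T n i < s <= grid T n i.+1 -> A m n i w) ->
  ((counting S : \bar R) <= limn_einf (fun m => limn_einf (fun n => (hits n (A m n) w)%:R%:E)))%E.
Proof.
move=> HA.
have H (l : seq R) : uniq l -> (forall s, s \in l -> S s) ->
    ((size l)%:R%:E <= (limn_einf (fun m => limn_einf (fun n => (hits n (A m n) w)%:R%:E)) : \bar R))%E.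
  move=> ul lS; apply: limn_einf_ge.
  have := @near_all_seq _ l (fun s m => \forall n \near \oo, forall i,
    grid T n i < s <= grid T n i.+1 -> A m n i w)
    (fun s sl => HA s (lS s sl)).
  apply: filterS => m Hm; apply: limn_einf_ge.
  by have := size_le_hits ul lS Hm; apply: filterS => n h; rewrite lee_fin ler_nat.
rewrite /counting; case: asboolP => [fS|infS].
  by apply: H => [|s]; [exact: finmap.fset_uniq|rewrite in_fset_set// inE].
rewrite leye_eq; apply/eqP/eqyP => r r0.
have [B BS Br] := infinite_set_fset (Num.truncn r).+1 infS.
apply: (@le_trans _ _ (size (finmap.enum_fset B))%:R%:E); last by apply: H;
  [exact: finmap.fset_uniq|exact: BS].
by rewrite lee_fin (le_trans (ltW (truncnS_gt _)))// ler_nat.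
Qed.

End counting_points.

(** * Expectation of a point count from the probabilities of cell events *)

Section counting_expectation.
Context {R : realType} d (Omega : measurableType d) (P : probability Omega R).
Variables (T : R) (S : Omega -> set R).
Variables (E : nat -> nat -> nat -> set Omega) (B : nat -> nat -> set Omega).
Variables (a : nat -> R) (b : nat -> nat -> R) (delta : nat -> R) (c C : R).
Hypotheses (T_gt0 : 0 < T) (S_T : forall w s, S w s -> 0 < s < T)
  (mE : forall m n i, measurable (E m n i)) (mB : forall n i, measurable (B n i))
  (E_point : forall m w, \forall n \near \oo, forall i, (i < 2 ^ n)%N -> E m n i w ->
    exists2 s, S w s & grid T n i < s <= grid T n i.+1)
  (point_E : forall w s, S w s -> \forall m \near \oo, \forall n \near \oo,
    forall i, grid T n i < s <= grid T n i.+1 -> E m n i w)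
  (E_B : forall m n i, E m n i `<=` B n i)
  (B_B : forall n i, B n i `<=` B n.+1 i.*2 `|` B n.+1 i.*2.+1)
  (P_B : forall n, (\sum_(0 <= i < 2 ^ n) P (B n i) <= C%:E)%E)
  (P_E_le : forall m n, (\sum_(0 <= i < 2 ^ n) P (E m n i) <= (a n)%:E)%E)
  (P_E_ge : forall m n, ((b m n)%:E <= \sum_(0 <= i < 2 ^ n) P (E m n i))%E)
  (cvg_a : a n @[n --> \oo] --> c)
  (cvg_b : forall m, b m n @[n --> \oo] --> c - delta m)
  (cvg_delta : delta m @[m --> \oo] --> (0 : R)).

Local Notation K := (fun w => counting (S w) : \bar R).
Local Notation N m n := (fun w => (hits n (E m n) w)%:R%:E : \bar R).

(** For fixed margin m, detections eventually come from distinct points, so they do not exceed the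
    count; conversely each point is detected once m, then n, is large. Measurability of the count is
    read off this formula. *)
Let KE : K = (fun w => limn_einf (fun m => limn_einf (fun n => N m n w))).
Proof.
apply/funext => w; apply/eqP; rewrite eq_le; apply/andP; split.
  apply: (@counting_le_liminf _ _ _ T) => [|s Ss]; [exact: S_T|exact: (point_E Ss)].
apply: limn_einf_le; apply: nearW => m; apply: limn_einf_le.
have := E_point m w; apply: filterS => n Hn.
exact: (hits_le_counting T_gt0).
Qed.

Let mN m n : measurable_fun setT (N m n).
Proof. by apply/measurable_EFinP; exact: measurable_hits. Qed.

Let m_liminf (f : nat -> Omega -> \bar R) : (forall n, measurable_fun setT (f n)) ->
  measurable_fun setT (fun w => limn_einf (f ^~ w)).
Proof.
move=> mf; rewrite (_ : (fun w => _) = (fun w => - limn_esup ((fun n w => - f n w)%E ^~ w))%E)//.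
apply: measurableT_comp => //; apply: measurable_fun_limn_esup => n.
by apply: measurableT_comp => //; exact: mf.
Qed.

Lemma measurable_counting : measurable_fun setT K.
Proof. by rewrite KE; apply: m_liminf => m; exact: m_liminf. Qed.

Let K_ge0 w : (0 <= K w)%E.
Proof. by rewrite /counting; case: asboolP => // _; rewrite leey. Qed.

(** Fatou for each of the two lower limits; the bounds [a n] are uniform in m. *)
Let integral_le : (\int[P]_w K w <= c%:E)%E.
Proof.
rewrite KE; apply: (le_trans (@fatou _ _ _ P setT measurableT (fun m w => limn_einf
  (fun n => N m n w)) _ _)).
- by move=> m; exact: m_liminf.
- by move=> m w _; apply: limn_einf_ge; apply: nearW => n; rewrite lee_fin.
apply: limn_einf_le; apply: nearW => m.
apply: (le_trans (@fatou _ _ _ P setT measurableT (fun n w => N m n w) _ _)).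
- by move=> n; exact: mN.
- by move=> n w _; rewrite lee_fin.
apply: (limn_einf_le_cvg _ cvg_a) => n.
by rewrite integral_hits.
Qed.

Local Notation D n := (fun w => (hits n (B n) w)%:R%:E : \bar R).
Let Dsup w : \bar R := limn (fun n => D n w).

Let D_mono w : {homo (fun n => D n w) : n m / (n <= m)%N >-> (n <= m)%E}.
Proof.
by apply/nondecreasing_seqP => n; rewrite lee_fin ler_nat; exact: hits_refine.
Qed.

Let D_le n w : (D n w <= Dsup w)%E.
Proof.
rewrite /Dsup (cvg_lim _ (ereal_nondecreasing_cvgn (@D_mono w)))//.
by apply: ereal_sup_ubound; exists n.
Qed.

Let mD n : measurable_fun setT (D n).
Proof. by apply/measurable_EFinP; exact: measurable_hits. Qed.

Let mDsup : measurable_fun setT Dsup.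
Proof. by apply: (emeasurable_fun_cvg (fun n w => D n w)) => // w _;
  exact: ereal_nondecreasing_is_cvgn. Qed.

Let Dsup_ge0 w : (0 <= Dsup w)%E.
Proof. by apply: le_trans (D_le 0 w); rewrite lee_fin. Qed.

Let iDsup : P.-integrable setT Dsup.
Proof.
apply/integrableP; split => //.
under eq_integral do rewrite gee0_abs//.
rewrite (@monotone_convergence _ _ _ P setT measurableT (fun n w => D n w)) //.
apply: (@le_lt_trans _ _ C%:E); last exact: ltry.
apply: lime_le.
  apply: ereal_nondecreasing_is_cvgn => n m nm; apply: ge0_le_integral => //.
  by move=> w _; exact: D_mono.
by apply: nearW => n; rewrite integral_hits.
Qed.

(* The excess of the hits of E over the number of points vanishes eventually,
   and it is dominated by the limit of the hits of B, which increase with n. *)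
Let integral_ge m : ((c - delta m)%:E <= \int[P]_w K w)%E.
Proof.
pose A n := [set w | (K w < N m n w)%E].
have mA n : measurable (A n).
  by rewrite /A -[X in measurable X]setTI; apply: emeasurable_fun_lt => //; exact: measurable_counting.
pose F n w : \bar R := (Dsup w * (\1_(A n) w)%:E)%E.
have F0 n w : (0 <= F n w)%E by rewrite mule_ge0// lee_fin.
have mF n : measurable_fun setT (F n).
  by apply: emeasurable_funM => //; apply/measurable_EFinP; exact: measurable_indic.
have NF n w : (N m n w <= K w + F n w)%E.
  rewrite /F indicE; have [wA|] := boolP (w \in A n).
    rewrite mule1; apply: le_trans (leeDr _ (K_ge0 w)).
    by apply: le_trans (D_le n w); rewrite lee_fin ler_nat; exact: hits_le.
  by move=> wA; rewrite mule0 adde0 leNgt; apply: contra wA => h; exact/mem_set.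
have F_cvg w : F n w @[n --> \oo] --> (0 : \bar R)%E.
  apply: cvg_near_cst; have := E_point m w; apply: filterS => n Hn.
  rewrite /F indicE memNset ?mule0// /A /=; apply/negP; rewrite -leNgt.
  exact: (hits_le_counting T_gt0).
have [||_ _] := @dominated_convergence _ _ _ P setT measurableT F (cst 0%E) Dsup mF
  (measurable_cst _) _ iDsup _.
- by apply: aeW => w _; exact: F_cvg.
- apply: aeW => w n _; rewrite gee0_abs// /F -[leRHS]mule1; apply: lee_wpmul2l => //.
  by rewrite lee_fin indicE; case: (_ \in _).
rewrite integral0 => cF.
have H n : ((b m n)%:E <= \int[P]_w K w + \int[P]_w F n w)%E.
  apply: (le_trans (P_E_ge m n)); rewrite -integral_hits//.
  rewrite -ge0_integralD//; last exact: measurable_counting.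
  apply: ge0_le_integral => //.
  by apply: emeasurable_funD => //; exact: measurable_counting.
have KF : (\int[P]_w K w)%E \is a fin_num.
  by rewrite ge0_fin_numE ?integral_ge0// (le_lt_trans integral_le)// ltry.
have cb : (b m n)%:E @[n --> \oo] --> (c - delta m)%:E.
  by apply: cvg_EFin; [exact: nearW|exact: cvg_b].
have cKF : (\int[P]_w K w + \int[P]_w F n w)%E @[n --> \oo] --> (\int[P]_w K w + 0)%E.
  by apply: cvgeD => //; [rewrite fin_num_adde_defl|exact: cvg_cst].
rewrite adde0 in cKF.
rewrite -(cvg_lim _ cb)// -(cvg_lim _ cKF)//; apply: lee_lim.
- by apply/cvg_ex; exists (c - delta m)%:E.
- by apply/cvg_ex; eexists; exact: cKF.
- exact: nearW.
Qed.

(** The lower bound c - delta(m) holds for every m, and the loss delta(m) due to the margin tends to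
    0. *)
Lemma expected_counting : (\int[P]_w K w = c%:E)%E.
Proof.
apply/eqP; rewrite eq_le integral_le /=.
have cd : (c - delta m)%:E @[m --> \oo] --> c%:E.
  apply: cvg_EFin; first exact: nearW.
  by rewrite -[X in _ --> X]subr0; apply: cvgB => //; exact: cvg_cst.
rewrite -(cvg_lim _ cd)//; apply: lime_le; first by apply/cvg_ex; exists c%:E.
by apply: nearW => m; exact: integral_ge.
Qed.

End counting_expectation.

(** * Up-crossings of a path *)

Section regularity.
Context {R : realType} (T : R).
Hypothesis T_gt0 : 0 < T.

Lemma near_mesh (r : R) : 0 < r -> \forall n \near \oo, T / 2 ^+ n < r.
Proof.
move=> r0; move/cvgr0Pnorm_lt : (cvg_mesh T) => /(_ _ r0); apply: filterS => n.
by apply: le_lt_trans; exact: ler_norm.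
Qed.

(** Compactness of [0, T]: a relation valid for all pairs near each point holds for all pairs at
    distance at most the mesh. It gives both uniform continuity and the separation of jumps. *)
Lemma uniform_pairs (Q : R -> R -> Prop) :
  (forall x, 0 <= x <= T -> exists2 r, 0 < r &
     forall y z, 0 <= y <= T -> 0 <= z <= T -> `|y - x| < r -> `|z - x| < r -> Q y z) ->
  \forall n \near \oo, forall y z, 0 <= y <= T -> 0 <= z <= T -> `|y - z| <= T / 2 ^+ n -> Q y z.
Proof.
move=> HQ; have /compact_near_coveringP H := @segment_compact R 0 T.
have h : forall x, [set` `[0, T]] x -> \forall x' \near x & n \near \oo, forall z, 0 <= x' <= T ->
  0 <= z <= T -> `|x' - z| <= T / 2 ^+ n -> Q x' z.
  move=> x; rewrite /= in_itv/= => xT; have [r r0 Hr] := HQ x xT.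
  have r2 : 0 < r / 2 by rewrite divr_gt0.
  near=> x' n => z x'T zT xz; apply: Hr => //.
    have : `|x - x'| < r / 2 by near: x'; exact: (nbhsx_ballx x (r / 2) r2).
    by rewrite distrC => h; lra.
  have h1 : `|x - x'| < r / 2 by near: x'; exact: (nbhsx_ballx x (r / 2) r2).
  have h2 : T / 2 ^+ n < r / 2 by near: n; exact: near_mesh.
  have := ler_distD x' z x; rewrite (distrC z x') (distrC x' x); move: h1 h2 xz; lra.
have Foo : Filter (\oo : set_system nat) by exact: eventually_filter.
have := H nat \oo (fun n x => forall z, 0 <= x <= T -> 0 <= z <= T -> `|x - z| <= T / 2 ^+ n ->
  Q x z) Foo h.
by apply: filterS => n Hn y z yT zT; apply: (Hn y) => //; rewrite /= in_itv/=.
Unshelve. all: by end_near. Qed.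

Lemma uniform_continuity (f : R -> R) (e : R) : {within `[0, T], continuous f} -> 0 < e ->
  \forall n \near \oo, forall y z, 0 <= y <= T -> 0 <= z <= T -> `|y - z| <= T / 2 ^+ n ->
    `|f y - f z| < e.
Proof.
move=> /subspace_continuousP cf e0; apply: uniform_pairs => x xT.
have e2 : 0 < e / 2 by rewrite divr_gt0.
have := cf x; rewrite /= in_itv/= => /(_ xT)/cvgr_dist_lt/(_ _ e2).
move=> [r /= r0 Hr]; exists r => // y z yT zT yx zx.
have h1 : `|f x - f y| < e / 2 by apply: Hr => /=; rewrite ?in_itv//= distrC.
have h2 : `|f x - f z| < e / 2 by apply: Hr => /=; rewrite ?in_itv//= distrC.
have := ler_distD (f x) (f y) (f z); rewrite (distrC (f y) (f x)); move: h1 h2; lra.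
Qed.

Section counting_path.
Variable f : R -> nat.
Hypothesis fP : simple_counting_path f.

Lemma counting_path_right s : 0 <= s -> exists2 r, 0 < r & forall t, s <= t < s + r -> f t = f s.
Proof.
move=> s0; have [_ _ + _] := fP => /(_ s s0)[r /= r0 Hr].
exists r => // t /andP[st tr]; have [->//|ne] := eqVneq t s.
apply: Hr => /=; last by rewrite lt_def ne.
by rewrite ler0_norm ?subr_le0// opprB ltrBlDl.
Qed.

(** Left limits are not part of the definition. Either f takes the value f(s) shortly before s, and
    by monotonicity keeps it until s, or nearby earlier values are below f(s) and within one of it,
    hence all equal to f(s) - 1. *)
Lemma counting_path_left s : 0 < s -> exists2 r, 0 < r <= s &
  exists2 k, (k <= f s <= k.+1)%N & forall t, s - r < t < s -> f t = k.
Proof.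
move=> s0; have [_ mono _ +] := fP => /(_ s s0)[r /= r0 Hr].
have le_f t : s - Num.min r s < t < s -> 0 <= t /\ (f s <= (f t).+1)%N.
  move=> /andP[h1 h2]; have h3 : Num.min r s <= r by rewrite ge_min lexx.
  have h4 : Num.min r s <= s by rewrite ge_min lexx orbT.
  split; first by lra.
  by apply: Hr => //=; rewrite ger0_norm; lra.
have m0 : 0 < Num.min r s by rewrite lt_min r0.
have ms : Num.min r s <= s by rewrite ge_min lexx orbT.
have [[t0 /andP[h1 h2] h3]|no] := pselect (exists2 t0, s - Num.min r s < t0 < s & f t0 = f s).
  have t00 : 0 <= t0 by have [] := le_f t0 (introT andP (conj h1 h2)).
  exists (s - t0); first by apply/andP; split; lra.
  exists (f s); first by rewrite leqnn leqnSn.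
  move=> t /andP[h4 h5]; apply/eqP; rewrite eqn_leq -{2}h3 !mono//; lra.
exists (Num.min r s); first by rewrite m0.
have lt_f t : s - Num.min r s < t < s -> (f t).+1 = f s.
  move=> ht; have [t_0 h] := le_f t ht; apply/eqP; rewrite eqn_leq h andbT.
  rewrite ltn_neqAle; apply/andP; split; first by apply/eqP => e; apply: no; exists t.
  by apply: mono => //; case/andP: ht => _ /ltW.
exists (f s).-1; last by move=> t /lt_f <-.
have := lt_f (s - Num.min r s / 2);
  have h : s - Num.min r s < s - Num.min r s / 2 < s by apply/andP; split; lra.
by move=> /(_ h) <- /=; rewrite leqnSn leqnn.
Qed.

(** Around each point the path takes at most two consecutive values, k and k + 1; by compactness a
    fine cell contains at most one tick. *)
Lemma counting_path_uniform :
  \forall n \near \oo, forall y z, 0 <= y <= T -> 0 <= z <= T -> `|y - z| <= T / 2 ^+ n -> (f z <=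
    (f y).+1)%N.
Proof.
apply: uniform_pairs => x /andP[x0 xT].
have [r1 r10 H1] := counting_path_right x0; have [_ mono _ _] := fP.
have [xe|xn] := eqVneq x 0.
  exists r1 => // y z /andP[y0 _] /andP[z0 _] yx zx.
  rewrite xe !subr0 !ger0_norm// in yx zx.
  by rewrite !H1 ?xe ?add0r ?y0 ?z0.
have xp : 0 < x by rewrite lt_def xn.
have [r2 /andP[r20 _] [k /andP[k1 k2] H2]] := counting_path_left xp.
exists (Num.min r1 r2); first by rewrite lt_min r10.
have val y : `|y - x| < Num.min r1 r2 -> (k <= f y <= k.+1)%N.
  rewrite lt_min !ltr_norml => /andP[/andP[h1 h2] /andP[h3 h4]].
  have [yx|xy] := ltP y x.
    by rewrite (H2 y) ?leqnn ?leqnSn//; apply/andP; split; lra.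
  by rewrite (H1 y) ?k1 ?k2//; apply/andP; split; lra.
move=> y z _ _ /val/andP[h1 _] /val/andP[_ h2].
by apply: leq_trans h2 _; rewrite ltnS.
Qed.

End counting_path.

Lemma derivable_continuous (h : R -> R) (s : R) : derivable h s 1 -> {for s, continuous h}.
Proof. by move=> /derivable1_diffP/differentiable_continuous. Qed.

Lemma near_inv_nat (e : R) : 0 < e -> \forall m \near \oo, m.+1%:R^-1 < e.
Proof.
move=> e0; have := @cvg_harmonic R => /cvgr0Pnorm_lt/(_ _ e0); apply: filterS => m.
by apply: le_lt_trans; exact: ler_norm.
Qed.

(** * Detected cells versus up-crossings of a fixed path *)

Section path_crossings.
Variables (u : R) (z j : R -> R) (f : R -> nat) (alpha : nat -> R).
Hypotheses (z_C1 : C1_on 0 T z) (fP : simple_counting_path f)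
  (jE : forall t, 0 <= t -> j t = alpha (f t)).

Let x t := z t + j t.

Lemma grid_ge0 n i : 0 <= grid T n i.
Proof. by rewrite -(grid0 T n) grid_le. Qed.

Lemma grid_leT n i : (i <= 2 ^ n)%N -> grid T n i <= T.
Proof. by move=> h; rewrite -[leRHS](grid_max T n) grid_le. Qed.

Lemma grid_ltS n i : grid T n i < grid T n i.+1.
Proof. by rewrite -subr_gt0 grid_step divr_gt0 ?exprn_gt0. Qed.

Lemma grid_ltT n i : (i < 2 ^ n)%N -> grid T n i < T.
Proof. by move=> h; apply: lt_le_trans (grid_ltS n i) (grid_leT h). Qed.

Lemma grid_interior n i s : grid T n i < s <= grid T n i.+1 -> s + T / 2 ^+ n < T -> (i.+1 < 2 ^ n)%N.
Proof.
move=> /andP[h1 h2] h3; rewrite ltnNge; apply/negP => /(grid_le T_gt0 n).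
rewrite grid_max => h4; have := grid_step T n i; lra.
Qed.

Let z_derivable s : 0 < s < T -> derivable z s 1.
Proof. by have [_ [dz [_ dzP]]] := z_C1 => /dzP h; exact: ex_derive. Qed.

Let x_derive s d : (\forall t \near s, j t = j s) -> is_derive s 1 z d -> is_derive s 1 x d.
Proof.
move=> js dz; apply: (@near_eq_is_derive _ _ _ (fun t => z t + j s)).
  by near=> t; rewrite /x (_ : j t = j s)//; near: t.
by rewrite -[d]addr0; apply: is_deriveD.
Unshelve. all: by end_near. Qed.

Let near_const s r1 r2 k : 0 < r1 -> 0 < r2 -> (forall t, s - r2 < t < s -> j t = k) -> k = j s ->
  (forall t, s <= t < s + r1 -> j t = j s) -> forall t, s - r2 < t < s + r1 -> j t = j s.
Proof.
move=> r10 r20 H2 <- H1 t /andP[h1 h2]; have [ts|st] := ltP t s; first by rewrite H2// h1 ts.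
by rewrite H1// st h2.
Qed.

Let near_itv s r1 r2 (Q : R -> Prop) : 0 < r1 -> 0 < r2 ->
  (forall t, s - r2 < t < s + r1 -> Q t) -> \forall t \near s, Q t.
Proof.
move=> r10 r20 HQ; exists (Num.min r1 r2); first by rewrite /= lt_min r10.
move=> t /=; rewrite lt_min !ltr_norml => /andP[/andP[h1 h2] /andP[h3 h4]].
by apply: HQ; apply/andP; split; lra.
Qed.

(** The intermediate value theorem gives s with x(s) = u. The mean value theorem gives a point of
    the cell with derivative at least 1/(m+1), and uniform continuity of z' makes the derivative at
    s positive as well. *)
Lemma continuous_upcrossing_of_cell (m : nat) : \forall n \near \oo, forall i, (i.+1 < 2 ^ n)%N ->
  (forall t, grid T n i <= t <= grid T n i.+1 -> j t = j (grid T n i)) ->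
  z (grid T n i) + j (grid T n i) < u -> u <= z (grid T n i.+1) + j (grid T n i) ->
  (grid T n i.+1 - grid T n i) * m.+1%:R^-1 <= z (grid T n i.+1) - z (grid T n i) ->
  exists2 s, continuous_upcrossings T u x s & grid T n i < s <= grid T n i.+1.
Proof.
have [cz [dz [cdz dzP]]] := z_C1.
have e0 : (0 : R) < m.+1%:R^-1 by rewrite invr_gt0.
move: m.+1%:R^-1 e0 => e e0.
have := uniform_continuity cdz e0; apply: filterS => n Hn i ilt.
have := grid_ltS n i; have := grid_ge0 n i; have := grid_ltT ilt; have := grid_step T n i.
move: (grid T n i) (grid T n i.+1) => a b ab bT a0 altb jc za zb slope.
have sub : `[a, b] `<=` `[0, T].
  by move=> t /=; rewrite !in_itv/= => /andP[? ?]; apply/andP; split; lra.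
have czab := continuous_subspaceW sub cz.
have [|s] := @IVT R z a b (u - j a) (ltW altb) czab.
  by rewrite ge_min le_max; apply/andP; split; apply/orP; [left|right]; lra.
rewrite in_itv/= => /andP[sa sb] zs.
have as_ : a < s by rewrite lt_def sa andbT; apply/eqP => h; rewrite h in zs; lra.
have [|c] := @MVT R z dz a b altb _ czab.
  by move=> t; rewrite in_itv/= => /andP[? ?]; apply: dzP; apply/andP; split; lra.
rewrite in_itv/= => /andP[ac cb] zab.
have dzc : e <= dz c.
  have ba : 0 < b - a by rewrite subr_gt0.
  by rewrite -(ler_pM2l ba) (mulrC _ (dz c)) -zab.
have dzs : 0 < dz s.
  have : `|dz c - dz s| < e.
    apply: Hn; rewrite -?ab; try by apply/andP; split; lra.
    by rewrite ler_norml; apply/andP; split; lra.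
  by rewrite ltr_norml => /andP[? ?]; lra.
have s0 : 0 <= s by lra.
have [r1 r10 H1] := counting_path_right fP s0.
have ja t : a <= t <= b -> j t = j s by move=> /jc ->; rewrite [RHS]jc// sa sb.
(* [s] may be the right end [b], beyond which constancy comes from the right-continuity of [f] and
   no longer from the cell. *)
have js : \forall t \near s, j t = j s.
  apply: (@near_itv s r1 (s - a)) => //; first by rewrite subr_gt0.
  move=> t /andP[t1 t2]; have [ts|st] := ltP t s.
    by apply: ja; apply/andP; split; lra.
  by rewrite !jE//; [rewrite H1// st t2|lra].
have dx : is_derive s 1 x (dz s) by apply: x_derive => //; apply: dzP; apply/andP; split; lra.
exists s; last by rewrite as_.
split.
- by apply/andP; split; lra.
- by apply: derivable_continuous; exact: ex_derive.
- by rewrite /x zs (ja a) ?lexx ?(ltW altb)// subrK.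
- exact: ex_derive.
- by rewrite derive1E derive_val.
Qed.

(** With d = x'(s) > 0, every secant of z through s over a short distance has slope above d/2. Any m
    with 1/(m+1) < d/2 then suits all fine cells containing s. *)
Lemma cell_of_continuous_upcrossing s : continuous_upcrossings T u x s ->
  \forall m \near \oo, \forall n \near \oo, forall i, grid T n i < s <= grid T n i.+1 ->
  [/\ (i.+1 < 2 ^ n)%N,
     (forall t, grid T n i <= t <= grid T n i.+1 -> j t = j (grid T n i)),
     z (grid T n i) + j (grid T n i) < u, u <= z (grid T n i.+1) + j (grid T n i) &
     (grid T n i.+1 - grid T n i) * m.+1%:R^-1 <= z (grid T n i.+1) - z (grid T n i)].
Proof.
move=> [s0T cx xs dx d0]; have [s0 sT] := andP s0T.
have [r1 r10 H1] := counting_path_right fP (ltW s0).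
have [r2 /andP[r20 r2s] [k _ H2]] := counting_path_left fP s0.
have H1' t : s <= t < s + r1 -> j t = j s by move=> h; rewrite !jE ?H1 ?(ltW s0)//; case/andP: h; lra.
have H2' t : s - r2 < t < s -> j t = alpha k by move=> h; rewrite jE ?H2//; case/andP: h; lra.
have cz := derivable_continuous (z_derivable s0T).
(* [f] may tick at [s], but [x] and [z] are continuous there, hence so is [j]: its value just before
   [s] is its value at [s]. *)
have kjs : alpha k = j s.
  apply/eqP; apply: contraT => ne.
  have e0 : 0 < `|j s - alpha k| by rewrite normr_gt0 subr_eq0 eq_sym.
  have cj : j t @[t --> s] --> j s.
    rewrite (_ : j = (fun t => x t - z t)); last by apply/funext => t; rewrite /x addrAC subrr add0r.
    by apply: cvgB; [exact: cx|exact: cz].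
  move/cvgrPdist_lt : cj => /(_ _ e0)[r3 /= r30 H3].
  pose t := s - Num.min r2 r3 / 2.
  have m0 : 0 < Num.min r2 r3 by rewrite lt_min r20.
  have m2 : Num.min r2 r3 <= r2 by rewrite ge_min lexx.
  have m3 : Num.min r2 r3 <= r3 by rewrite ge_min lexx orbT.
  have := H3 t; rewrite /= /t opprB addrCA subrr addr0 gtr0_norm ?divr_gt0//.
  have h : Num.min r2 r3 / 2 < r3 by lra.
  have ht : s - r2 < s - Num.min r2 r3 / 2 < s by apply/andP; split; lra.
  by move=> /(_ h); rewrite (H2' _ ht) ltxx.
have js := near_const r10 r20 H2' kjs H1'.
pose d := derive1 x s.
have dz : is_derive s 1 z d.
  have dx' : is_derive s 1 x d by rewrite /d derive1E; exact: derivableP.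
  apply: (@near_eq_is_derive _ _ _ (fun t => x t - j s)).
    by apply: (near_itv r10 r20) => t /js e; rewrite /x e addrK.
  by rewrite -[d]subr0; apply: is_deriveB.
have [r3 r30 H3] : exists2 r, 0 < r & forall h, 0 < `|h| < r -> d / 2 < h^-1 * (z (s + h) - z s).
  have ex : derivable z s 1 by exact: ex_derive.
  have cq : h^-1 *: ((z \o shift s) (h *: 1) - z s) @[h --> 0^'] --> d.
    by rewrite -(@derive_val _ _ _ _ _ _ _ dz); exact: ex.
  have d2 : d / 2 < d by rewrite /d; lra.
  have [r /= r0 Hr] := cvgr_gt _ cq _ d2.
  exists r => // h /andP[h0 hr]; have := Hr h; rewrite /= sub0r normrN hr -normr_gt0 h0 => /(_ isT isT).
  by rewrite /= /GRing.scale /= mulr1 (addrC s).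
have zl y : s - r3 < y -> y < s -> d / 2 * (s - y) < z s - z y.
  move=> y1 y2; have sy : 0 < s - y by rewrite subr_gt0.
  have hr : 0 < `|y - s| < r3 by rewrite distrC gtr0_norm// sy; lra.
  have := H3 (y - s) hr; rewrite (_ : s + (y - s) = y); last by ring.
  rewrite (_ : (y - s)^-1 * _ = (z s - z y) / (s - y)); last first.
    by rewrite -(opprB y s) -(opprB (z y)) invrN mulrNN mulrC.
  by rewrite ltr_pdivlMr.
have zr y : s < y -> y < s + r3 -> d / 2 * (y - s) < z y - z s.
  move=> y1 y2; have sy : 0 < y - s by rewrite subr_gt0.
  have hr : 0 < `|y - s| < r3 by rewrite gtr0_norm// sy; lra.
  have := H3 (y - s) hr; rewrite (_ : s + (y - s) = y); last by ring.
  by rewrite (mulrC (y - s)^-1) ltr_pdivlMr.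
have d20 : 0 < d / 2 by rewrite divr_gt0.
have := near_inv_nat d20; apply: filterS => m; move: m.+1%:R^-1 => e md.
have r0 : 0 < Num.min (Num.min r1 r2) (Num.min r3 (T - s)) by rewrite !lt_min r10 r20 r30 subr_gt0.
have := near_mesh r0; apply: filterS => n.
rewrite !lt_min => /andP[/andP[n1 n2] /andP[n3 n4]] i hi.
have ilt : (i.+1 < 2 ^ n)%N by apply: (grid_interior hi); lra.
move: hi (grid_step T n i); move: (grid T n i) (grid T n i.+1) => a b /andP[as_ sb] ab.
have ja : j a = j s by apply: js; apply/andP; split; lra.
have za : d / 2 * (s - a) < z s - z a by apply: zl => //; lra.
have zb : d / 2 * (b - s) <= z b - z s.
  move: sb; rewrite le_eqVlt => /predU1P[<-|sb]; first by rewrite !subrr mulr0.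
  by apply/ltW/zr => //; lra.
have xs' : z s + j s = u by [].
have p1 : 0 < d / 2 * (s - a) by rewrite mulr_gt0// subr_gt0.
have p2 : 0 <= d / 2 * (b - s) by apply: mulr_ge0; [exact: ltW|rewrite subr_ge0].
split => //.
- move=> t /andP[t1 t2]; rewrite ja; apply: js; apply/andP; split; lra.
- rewrite ja; lra.
- rewrite ja; lra.
- apply: (@le_trans _ _ ((b - a) * (d / 2))); first by rewrite ler_wpM2l ?subr_ge0 ?(ltW md)//; lra.
  have -> : (b - a) * (d / 2) = d / 2 * (s - a) + d / 2 * (b - s) by ring.
  lra.
Qed.

(** The hypotheses force j to change, so f ticks, and exactly once if the cell is fine. At the tick
    time s, z(s) is within e of z(b), so that the two margins leave x on either side of u. *)
Lemma discontinuous_upcrossing_of_cell (e : R) : 0 < e -> \forall n \near \oo,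
  forall i, (i.+1 < 2 ^ n)%N ->
  z (grid T n i.+1) + j (grid T n i) < u - e -> u + e < z (grid T n i.+1) + j (grid T n i.+1) ->
  exists2 s, discontinuous_upcrossings T u x s & grid T n i < s <= grid T n i.+1.
Proof.
move=> e0; have [cz _] := z_C1.
have := uniform_continuity cz e0; have := counting_path_uniform fP; apply: filterS2 => n Fn Hn i ilt.
have := grid_ltS n i; have := grid_ge0 n i; have := grid_ltT ilt; have := grid_step T n i.
move: (grid T n i) (grid T n i.+1) => a b ab bT a0 altb za zb.
have [_ mono _ _] := fP.
have fab : f a != f b by apply/eqP => h; move: za zb; rewrite !jE//; [rewrite h; lra|lra].
have fb : f b = (f a).+1.
  apply/eqP; rewrite eqn_leq ltn_neqAle fab mono ?(ltW altb)// !andbT.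
  apply: Fn; [by apply/andP; split; lra..|].
  by rewrite distrC gtr0_norm ?subr_gt0// ab.
(* The tick time is the supremum of the times before the tick. *)
pose A := [set t | a <= t <= b /\ f t = f a].
have Aa : A a by split => //; rewrite lexx ltW.
have hA : has_sup A by split; [exists a|exists b => t [/andP[]]].
pose s := sup A.
have As t : A t -> t <= s by move=> At; exact: (ub_le_sup (proj2 hA)).
have sb : s <= b by apply: (ge_sup (proj1 hA)) => t [/andP[]].
have f1 t : a <= t < s -> f t = f a.
  move=> /andP[t1 t2].
  have st : 0 < s - t by rewrite subr_gt0.
  have [t' [/andP[t'1 t'2] ft'] tt'] := sup_adherent st hA.
  rewrite -/s opprB addrC subrK in tt'.
  by apply/eqP; rewrite eqn_leq -{1}ft' !mono//; lra.
have f2 t : s < t <= b -> f t = f b.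
  move=> /andP[t1 t2].
  have ta : a <= t by have := As a Aa; lra.
  apply/eqP; rewrite eqn_leq mono//; last lra.
  rewrite fb ltn_neqAle mono// andbT; apply/eqP => h.
  by have := As t (conj (introT andP (conj ta t2)) (esym h)); rewrite leNgt t1.
have as_ : a < s.
  have [r r0 Hr] := counting_path_right fP a0.
  pose t := a + Num.min r (b - a) / 2.
  have m0 : 0 < Num.min r (b - a) by rewrite lt_min r0 subr_gt0.
  have m1 : Num.min r (b - a) <= r by rewrite ge_min lexx.
  have m2 : Num.min r (b - a) <= b - a by rewrite ge_min lexx orbT.
  apply: (@lt_le_trans _ _ t); first by rewrite /t; lra.
  by apply: As; split; [apply/andP; split; rewrite /t; lra|apply: Hr; apply/andP; split;
    rewrite /t; lra].
have s0 : 0 < s by lra.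
(* Right-continuity: f equals f(b) immediately after s. *)
have fs : f s = f b.
  have [->//|sne] := eqVneq s b.
  have slt : s < b by rewrite lt_neqAle sne.
  have [r r0 Hr] := counting_path_right fP (ltW s0).
  pose t := s + Num.min r (b - s) / 2.
  have m0 : 0 < Num.min r (b - s) by rewrite lt_min r0 subr_gt0.
  have m1 : Num.min r (b - s) <= r by rewrite ge_min lexx.
  have m2 : Num.min r (b - s) <= b - s by rewrite ge_min lexx orbT.
  have h1 : s <= t < s + r by apply/andP; split; rewrite /t; lra.
  have h2 : s < t <= b by apply/andP; split; rewrite /t; lra.
  by rewrite -(Hr t h1) f2.
have zsb : `|z s - z b| < e.
  by apply: Hn; [apply/andP; split; lra..|rewrite ler0_norm ?subr_le0//; lra].
rewrite ltr_norml in zsb; case/andP: zsb => zs1 zs2.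
have s0T : 0 < s < T by apply/andP; split; lra.
exists s; last by rewrite as_.
split => //; exists (z s + j a); split.
  apply: (@cvg_trans _ ((fun t => z t + j a) @ s^'-)).
    apply: near_eq_cvg; near=> t; rewrite /x; congr (_ + _).
    have ta : a < t by near: t; exact: nbhs_left_gt.
    have ts : t < s by near: t; exact: nbhs_left_lt.
    by rewrite !jE//; [rewrite f1// ts ltW|lra].
  apply: cvgD; last exact: cvg_cst.
  by apply: cvg_at_left_filter; exact: derivable_continuous (z_derivable s0T).
have jsb : j s = j b by rewrite !jE ?fs//; lra.
by rewrite /x jsb; apply/andP; split; lra.
Unshelve. all: by end_near. Qed.

Lemma cell_of_discontinuous_upcrossing s : discontinuous_upcrossings T u x s ->
  \forall m \near \oo, \forall n \near \oo, forall i, grid T n i < s <= grid T n i.+1 ->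
  [/\ (i.+1 < 2 ^ n)%N, z (grid T n i.+1) + j (grid T n i) < u - m.+1%:R^-1 &
     u + m.+1%:R^-1 < z (grid T n i.+1) + j (grid T n i.+1)].
Proof.
move=> [s0T [l [xl /andP[lu ux]]]]; have [s0 sT] := andP s0T.
have [r1 r10 H1] := counting_path_right fP (ltW s0).
have [r2 /andP[r20 r2s] [k _ H2]] := counting_path_left fP s0.
have H1' t : s <= t < s + r1 -> j t = j s by move=> h; rewrite !jE ?H1 ?(ltW s0)//; case/andP: h; lra.
have H2' t : s - r2 < t < s -> j t = alpha k by move=> h; rewrite jE ?H2//; case/andP: h; lra.
have cz := derivable_continuous (z_derivable s0T).
have lE : l = z s + alpha k.
  apply: (@cvg_unique _ (@Rhausdorff R) (x t @[t --> s^'-])) => //.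
  apply: (@cvg_trans _ ((fun t => z t + alpha k) @ s^'-)).
    apply: near_eq_cvg; near=> t; rewrite /x H2'//.
    apply/andP; split; near: t; [apply: nbhs_left_gt; lra|exact: nbhs_left_lt].
  by apply: cvgD; [exact: cvg_at_left_filter|exact: cvg_cst].
(* Half of [eta] absorbs the variation of z between s and the end of the cell, the other half is
   left for the margin 1/(m+1). *)
pose eta := Num.min (u - l) (x s - u).
have eta0 : 0 < eta by rewrite lt_min !subr_gt0 lu ux.
have eta1 : eta <= u - l by rewrite ge_min lexx.
have eta2 : eta <= x s - u by rewrite ge_min lexx orbT.
have eta20 : 0 < eta / 2 by rewrite divr_gt0.
move/cvgrPdist_lt : cz => /(_ _ eta20)[r3 /= r30 H3].
have := near_inv_nat eta20; apply: filterS => m; move: m.+1%:R^-1 => e me.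
have r0 : 0 < Num.min (Num.min r1 r2) (Num.min r3 (T - s)) by rewrite !lt_min r10 r20 r30 subr_gt0.
have := near_mesh r0; apply: filterS => n.
rewrite !lt_min => /andP[/andP[n1 n2] /andP[n3 n4]] i hi.
have ilt : (i.+1 < 2 ^ n)%N by apply: (grid_interior hi); lra.
move: hi (grid_step T n i); move: (grid T n i) (grid T n i.+1) => a b /andP[as_ sb] ab.
have ja : j a = alpha k by apply: H2'; apply/andP; split; lra.
have jb : j b = j s by apply: H1'; apply/andP; split; lra.
have : `|z s - z b| < eta / 2 by apply: H3; rewrite /= ler0_norm ?subr_le0//; lra.
rewrite ltr_norml => /andP[zb1 zb2].
have xE : x s = z s + j s by [].
by split => //; rewrite ?ja ?jb; lra.
Unshelve. all: by end_near. Qed.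

End path_crossings.
End regularity.

(** * Expected numbers of up-crossings *)

Section cell_sums.
Context {R : realType}.

Lemma cell_sum_le n (p : nat -> \bar R) (y : R) : (forall i, (i < 2 ^ n)%N -> (p i <= y%:E)%E) ->
  (\sum_(0 <= i < 2 ^ n) p i <= (2 ^+ n * y)%:E)%E.
Proof.
move=> Hp; apply: (@le_trans _ _ (\sum_(0 <= i < 2 ^ n) y%:E)%E).
  by rewrite !big_nat; apply: lee_sum => i /andP[_]; exact: Hp.
by rewrite sumEFin big_const_nat subn0 iter_addr_0 -[y *+ _]mulr_natl natrX.
Qed.

(** The cell ending at T is excluded from detection, since it could produce the point T, outside the
    open interval; one term is lost, hence 2^n - 1. *)
Lemma cell_sum_ge n (p : nat -> \bar R) (y : R) : (forall i, 0 <= p i)%E ->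
  (forall i, (i.+1 < 2 ^ n)%N -> (y%:E <= p i)%E) ->
  (((2 ^+ n - 1) * y)%:E <= \sum_(0 <= i < 2 ^ n) p i)%E.
Proof.
move=> p0 Hp; have e : (2 ^ n)%N = (2 ^ n).-1.+1 by rewrite prednK// expn_gt0.
apply: (@le_trans _ _ (\sum_(0 <= i < (2 ^ n).-1) p i)%E).
  apply: (@le_trans _ _ (\sum_(0 <= i < (2 ^ n).-1) y%:E)%E); last first.
    by rewrite !big_nat; apply: lee_sum => i /andP[_ h]; apply: Hp; rewrite e ltnS.
  rewrite sumEFin big_const_nat subn0 iter_addr_0 -[y *+ _]mulr_natl.
  by rewrite -subn1 natrB ?expn_gt0// natrX.
by rewrite [in leRHS]e big_nat_recr//= leeDl.
Qed.

End cell_sums.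

Section expectations.
Context {R : realType} d (Omega : measurableType d) (P : probability Omega R).
Variables (rho lambda : R) (eps : nat -> {RV P >-> R}) (nu : R -> {RV P >-> nat}) (J : R -> Omega -> R).
Hypotheses (rho_lt1 : `|rho| < 1) (lambda_gt0 : 0 < lambda)
  (eps_indep : mutually_independent P (fun n => eps n : Omega -> R))
  (eps_law : forall n, has_law P (eps n) (normal_prob 0 (Num.sqrt (1 / 2))))
  (nu_poisson : poisson_process lambda nu)
  (eps_nu : independent_systems P (sigma_of setT (fun n => eps n : Omega -> R))
     (sigma_of [set t | 0 <= t] (fun t => nu t : Omega -> nat)))
  (JE : forall t w, 0 <= t -> J t w = ar_chain rho (fun n => eps n : Omega -> R) (nu t w) w).
Variables (T u : R) (Z : R -> {RV P >-> R}) (Gamma : R -> R).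
Hypotheses (T_gt0 : 0 < T)
  (Z_gaussian : gaussian_process P `[0, T] Z)
  (Z_centered : centered_process P `[0, T] Z)
  (Z_C1 : forall w, C1_on 0 T (fun t => Z t w))
  (Z_cov : covariance_function P `[0, T] Z Gamma)
  (Gamma0 : Gamma 0 = 1 / 2)
  (ZJ_indep : independent_systems P (sigma_of `[0, T] (fun t => Z t : Omega -> R))
     (sigma_of [set t : R | 0 <= t] J)).

Let nu_path w : simple_counting_path (fun t => nu t w).
Proof. by have [+ _ _] := nu_poisson; apply. Qed.

Definition jump_free (a b : R) := [set w | forall t, a <= t <= b -> J t w = J a w].

(** By right-continuity, constancy may be tested at rational times and at the end b. The event is
    phrased with J and not with nu because only events of J are independent of Z. *)
Lemma jump_free_sigma a b : 0 <= a -> a < b -> <<s jump_sets J >> (jump_free a b).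
Proof.
move=> a0 ab.
have mJ t : 0 <= t -> measurable_fun (setT : set (g_sigma_algebraType (jump_sets J))) (J t).
  by move=> t0; exact: measurable_sigma_of.
have mE t : 0 <= t -> <<s jump_sets J >> [set w | J t w = J a w].
  move=> t0; rewrite (_ : [set w | _] = [set w | J t w <= J a w] `&` [set w | J a w <= J t w]).
    by apply: (@measurableI _ (g_sigma_algebraType (jump_sets J))); apply: measurable_set_ler;
      exact: mJ.
  by apply/seteqP; split => w /=; [move=> ->|move=> [h1 h2]; apply: le_anti; rewrite h1].
have -> : jump_free a b = [set w | J b w = J a w] `&`
    \bigcap_(q : rat) [set w | a <= ratr q <= b -> J (ratr q) w = J a w].
  apply/seteqP; split => w.
    by move=> H; split => [|q _ /= /H//]; apply: H; rewrite lexx ltW.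
  move=> [hb hq] t /andP[]; rewrite le_eqVlt => /predU1P[<-//|at_].
  rewrite le_eqVlt => /predU1P[->//|tb].
  have t0 : 0 <= t by lra.
  have [r r0 Hr] := counting_path_right (nu_path w) t0.
  have : t < Num.min b (t + r) by rewrite lt_min tb ltrDl.
  move=> /rat_in_itvoo[q]; rewrite in_itv/= lt_min => /andP[q1 /andP[q2 q3]].
  rewrite -(hq q I); last by apply/andP; split; lra.
  by rewrite !JE//; [rewrite Hr// ltW|lra].
apply: (@measurableI _ (g_sigma_algebraType (jump_sets J))); first by apply: mE; lra.
rewrite -[\bigcap_q _]setCK setC_bigcap; apply: (@measurableC _ (g_sigma_algebraType (jump_sets J))).
apply: (@bigcupT_measurable_rat _ (g_sigma_algebraType (jump_sets J))) => q.
apply: (@measurableC _ (g_sigma_algebraType (jump_sets J))).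
have [h|h] := boolP (a <= ratr q <= b).
- rewrite (_ : [set w | _] = [set w | J (ratr q) w = J a w]); first by apply: mE; case/andP: h; lra.
  by apply/seteqP; split => w /=; [exact|].
- rewrite (_ : [set w | _] = setT); first exact: (@measurableT _ (g_sigma_algebraType (jump_sets J))).
  by apply/seteqP; split => w //= _ h'; rewrite h' in h.
Qed.

Lemma measurable_jump_free a b : 0 <= a -> a < b -> measurable (jump_free a b).
Proof.
move=> a0 ab; apply: (measurable_sub_set (jump_measurable JE)).
exact: jump_free_sigma.
Qed.

Local Notation g := (grid T).
Local Notation h := (fun n : nat => T / 2 ^+ n).
Local Notation K := (@normal_peak R (Num.sqrt (1 / 2))).

Let h_gt0 n : 0 < h n. Proof. by rewrite divr_gt0 ?exprn_gt0. Qed.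

Let h_leT n : h n <= T.
Proof. by rewrite ler_pdivrMr ?exprn_gt0// ler_peMr ?(ltW T_gt0)// exprn_ege1// ler1n. Qed.

Let mh n : 2 ^+ n * h n = T.
Proof. by rewrite mulrCA mulfV ?mulr1// expf_neq0. Qed.

Let rescale1 (y x b : R) : 0 < x -> y * x * (b / x) = y * b.
Proof. by move=> x0; field; rewrite gt_eqF. Qed.

Let rescale2 (y x a b k e : R) : 0 < x ->
  (y * x - x) * (a * (b / x) - 2 * k * e) = (y - 1) * (a * b - 2 * (x * e) * k).
Proof. by move=> x0; field; rewrite gt_eqF. Qed.

Let cvg_h : h n @[n --> \oo] --> (0 : R).
Proof. exact: cvg_mesh. Qed.

Let mJ t : 0 <= t -> measurable_fun setT (J t).
Proof. by move=> t0; exact: (measurable_jump JE t0). Qed.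

Let mZ t : measurable_fun setT (Z t).
Proof. exact: measurable_funPT. Qed.

Let cvg_expR_h : expR (- (lambda * h n)) @[n --> \oo] --> (1 : R).
Proof.
rewrite -[X in _ --> X]expR0 -[X in expR X]oppr0 -[X in - X](mulr0 lambda).
apply: continuous_cvg; first exact: continuous_expR.
by apply: cvgN; apply: cvgMr; exact: cvg_h.
Qed.

Section continuous_part.

Let r n := 1 / 2 + Gamma (h n).
Let c n := crossing_prob u (r n).
Let s2 := - derive1n 2 Gamma 0.
Let L := Num.sqrt s2 * normal_pdf 0 1 u * normal_peak 1.

Let cvg_c : c n / h n @[n --> \oo] --> L.
Proof.
have [_ cG] := covariance_second_derivative T_gt0 Z_gaussian Z_centered Z_C1 Z_cov.
apply: cvg_crossing_prob => //.
  move=> n; have D0 : 0 \in `[0, T] by rewrite in_itv/= lexx ltW.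
  have Dh : h n \in `[0, T] by rewrite in_itv/= h_leT ltW.
  by have := covariance_bound Z_cov Gamma0 D0 Dh; rewrite subr0 ler_norml /r => /andP[_ ?]; lra.
have /cvgr_dnbhsP H := cG.
have := H h (conj (fun n => lt0r_neq0 (h_gt0 n)) cvg_h).
rewrite (_ : (fun n => _) = (fun n => 2 * (1 - r n) / h n ^+ 2))//.
by apply/funext => n; congr (_ * _ / _); rewrite /r Gamma0; lra.
Qed.

Let cross n i := [set w | Z (g n i) w + J (g n i) w < u /\ u <= Z (g n i.+1) w + J (g n i) w].
Let steep m n i := [set w | (g n i.+1 - g n i) * m.+1%:R^-1 <= Z (g n i.+1) w - Z (g n i) w].
Let B n i := cross n i `&` jump_free (g n i) (g n i.+1).
(** The slope condition is kept out of [B]: steepness of a cell need not pass to the half that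
    crosses, whereas a jump-free crossing does. *)
Let E m n i := if (i.+1 < 2 ^ n)%N then B n i `&` steep m n i else set0.

Let mcross n i : measurable (cross n i).
Proof. by apply: measurable_crossing => //; apply: mJ; exact: grid_ge0. Qed.

Let mB n i : measurable (B n i).
Proof.
apply: measurableI => //; apply: measurable_jump_free; [exact: grid_ge0|exact: grid_ltS].
Qed.

Let mE m n i : measurable (E m n i).
Proof.
rewrite /E; case: ifP => // _; apply: measurableI => //.
by apply: measurable_set_ler => //; exact: measurable_funB.
Qed.

Let g_step n i : (i < 2 ^ n)%N -> [/\ 0 <= g n i, g n i < g n i.+1 & g n i.+1 <= T].
Proof. by move=> hi; split; [exact: grid_ge0|exact: grid_ltS|exact: grid_leT]. Qed.

Let cell_bound n i : (i < 2 ^ n)%N -> (P (B n i) <= (c n)%:E)%E /\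
  ((expR (- (lambda * h n)) * c n)%:E <= P (B n i))%E.
Proof.
move=> /g_step[g0 gg gT].
have := crossing_cell rho_lt1 lambda_gt0 eps_indep eps_law nu_poisson eps_nu JE
  Z_gaussian Z_centered Z_cov Gamma0 ZJ_indep g0 gg gT u (jump_free_sigma g0 gg).
rewrite (grid_step T n i); apply => w /= e t /andP[t1 t2].
have t0 : 0 <= t by lra.
have [_ mono _ _] := nu_path w.
rewrite !JE// (_ : nu t w = nu (g n i) w)//; apply/eqP; rewrite eqn_leq -{1}e !mono//.
Qed.

Let P_B n : (\sum_(0 <= i < 2 ^ n) P (B n i) <= (T * (c n / h n))%:E)%E.
Proof.
rewrite (_ : T * _ = 2 ^+ n * c n); last first.
  by transitivity (2 ^+ n * h n * (c n / h n)); [rewrite mh|exact: rescale1].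
by apply: cell_sum_le => i /cell_bound[].
Qed.

Let P_E_le m n : (\sum_(0 <= i < 2 ^ n) P (E m n i) <= (T * (c n / h n))%:E)%E.
Proof.
apply: le_trans (P_B n); rewrite !big_nat; apply: lee_sum => i _.
apply: le_measure; rewrite ?inE// /E; case: ifP => // _; exact: subIsetl.
Qed.

(** A jump-free crossing is steep or slow, and [crossing_slow] with e = h/(m+1) bounds the slow
    ones. The total loss is at most 2 K T/(m+1), uniformly in n. *)
Let P_E_ge m n : (((T - h n) * (expR (- (lambda * h n)) * (c n / h n) - 2 * K * m.+1%:R^-1))%:E <=
  \sum_(0 <= i < 2 ^ n) P (E m n i))%E.
Proof.
have e0 : (0 : R) < m.+1%:R^-1 by rewrite invr_gt0.
rewrite (_ : _ * _ = (2 ^+ n - 1) * (expR (- (lambda * h n)) * c n - 2 * (h n * m.+1%:R^-1) * K));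
  last first.
  transitivity ((2 ^+ n * h n - h n) * (expR (- (lambda * h n)) * (c n / h n) - 2 * K * m.+1%:R^-1)).
    by rewrite mh.
  exact: rescale2.
apply: cell_sum_ge => // i hi; have hi' := ltnW hi; have [g0 gg gT] := g_step hi'.
have [_ lo] := cell_bound hi'.
have slow := crossing_slow rho_lt1 eps_indep eps_law eps_nu JE ZJ_indep g0 gg gT u (mulr_gt0
  (h_gt0 n) e0).
rewrite EFinB leeBlDr//; apply: (le_trans lo).
apply: (@le_trans _ _ (P (E m n i) + P [set w | cross n i w /\ (Z (g n i.+1) w - Z
  (g n i) w < h n * m.+1%:R^-1)%R])%E); last exact: leeD2l.
have mslow : measurable [set w | cross n i w /\ Z (g n i.+1) w - Z (g n i) w < h n * m.+1%:R^-1].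
  by apply: measurableI => //; apply: measurable_set_ltr => //; exact: measurable_funB.
apply: le_trans (measureU2 _ _ _) => //.
apply: le_measure; rewrite ?inE//; first exact: measurableU.
move=> w [w1 w2]; have [le|lt] := leP (h n * m.+1%:R^-1) (Z (g n i.+1) w - Z (g n i) w).
  by left; rewrite /E hi; split => //; rewrite /steep /= grid_step.
by right.
Qed.

Let X w t := Z t w + J t w.
Let S w := continuous_upcrossings T u (X w).

Lemma expected_continuous_upcrossings : measurable_fun setT (fun w => counting (S w) : \bar R) /\
  (\int[P]_w (counting (S w) : \bar R) = (T * L)%:E)%E.
Proof.
pose alpha w k := ar_chain rho (fun n => eps n : Omega -> R) k w.
have alphaE w (t : R) : 0 <= t -> J t w = alpha w (nu t w) by exact: JE.
have S_T w s : S w s -> 0 < s < T by case.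
have E_point m w : \forall n \near \oo, forall i, (i < 2 ^ n)%N -> E m n i w ->
    exists2 s, S w s & grid T n i < s <= grid T n i.+1.
  have := @continuous_upcrossing_of_cell _ T T_gt0 u (fun t => Z t w) (fun t => J t w)
    (fun t => nu t w) (alpha w) (Z_C1 w) (nu_path w) (alphaE w) m.
  apply: filterS => n H i _; rewrite /E; case: ifP => // hi [[[h1 h2] h3] h4].
  exact: H.
have point_E w s : S w s -> \forall m \near \oo, \forall n \near \oo,
    forall i, grid T n i < s <= grid T n i.+1 -> E m n i w.
  move=> Sws; have := @cell_of_continuous_upcrossing _ T T_gt0 u (fun t => Z t w) (fun t => J t w)
    (fun t => nu t w) (alpha w) (Z_C1 w) (nu_path w) (alphaE w) s Sws.
  apply: filterS => m; apply: filterS => n H i hi; have [h1 h2 h3 h4 h5] := H i hi.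
  by rewrite /E h1; do !split.
have E_B m n i : E m n i `<=` B n i by rewrite /E; case: ifP => // _; exact: subIsetl.
(* J being constant on the cell, the left half crosses if the midpoint value is at least u, the
   right half otherwise. *)
have B_B n i : B n i `<=` B n.+1 i.*2 `|` B n.+1 i.*2.+1.
  move=> w [[w1 w2] w3].
  have gl : g n.+1 i.*2 = g n i := grid_refine T n i.
  have gr : g n.+1 i.*2.+2 = g n i.+1 by rewrite -doubleS grid_refine.
  have := grid_ltS T_gt0 n.+1 i.*2; have := grid_ltS T_gt0 n.+1 i.*2.+1.
  rewrite /B /cross /= gl gr; move: (g n.+1 i.*2.+1) => c' c1 c2.
  have jc : J c' w = J (g n i) w by apply: w3; rewrite !ltW.
  have [hc|hc] := leP u (Z c' w + J (g n i) w).
    by left; split => // t /andP[t1 t2]; apply: w3; rewrite t1 (le_trans t2)// ltW.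
  right; split; first by rewrite jc.
  by move=> t /andP[t1 t2]; rewrite jc; apply: w3; rewrite t2 (le_trans _ t1)// ltW.
have cvg_a : T * (c n / h n) @[n --> \oo] --> T * L by apply: cvgMr; exact: cvg_c.
have [C HC] : exists C, forall n, T * (c n / h n) <= C.
  have /cvg_seq_bounded[C [_ HC]] : cvgn (fun n => T * (c n / h n)) by apply/cvg_ex; exists (T * L).
  exists (C + 1) => n; apply: (le_trans (ler_norm _)); apply: HC => //; lra.
have P_B' n : (\sum_(0 <= i < 2 ^ n) P (B n i) <= C%:E)%E.
  by apply: le_trans (P_B n) _; rewrite lee_fin.
have cvg_b m : (T - h n) * (expR (- (lambda * h n)) * (c n / h n) - 2 * K * m.+1%:R^-1) @[n --> \oo] -->
    T * L - T * (2 * K * m.+1%:R^-1).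
  rewrite -mulrBr; apply: cvgM.
    by rewrite -[X in _ --> X]subr0; apply: cvgB; [exact: cvg_cst|exact: cvg_h].
  apply: cvgB; last exact: cvg_cst.
  by rewrite -[X in _ --> X]mul1r; apply: cvgM; [exact: cvg_expR_h|exact: cvg_c].
have cvg_d : T * (2 * K * m.+1%:R^-1) @[m --> \oo] --> (0 : R).
  rewrite -[X in _ --> X](mulr0 T); apply: cvgMr.
  by rewrite -[X in _ --> X](mulr0 (2 * K)); apply: cvgMr; exact: cvg_harmonic.
split.
- exact: (measurable_counting T_gt0 S_T mE E_point point_E).
- exact: (expected_counting T_gt0 S_T mE mB E_point point_E E_B B_B P_B' P_E_le P_E_ge cvg_a cvg_b cvg_d).
Qed.

End continuous_part.

Section discontinuous_part.
Context d' (Omega' : measurableType d') (P' : probability Omega' R) (V W : Omega' -> R).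
Hypothesis VW_trig : bivariate_trig P' V W 1 ((1 + rho) / 2) 1.

Let low m := u - m.+1%:R^-1.
Let high m := u + m.+1%:R^-1.
Let gap m := [set w | V w < low m /\ high m < W w].
Let p_ m := fine (P' (gap m)).
Let p := fine (P' [set w | V w < u < W w]).

Let mV : measurable_fun setT V. Proof. by have [] := VW_trig. Qed.
Let mW : measurable_fun setT W. Proof. by have [] := VW_trig. Qed.

Let mgap m : measurable (gap m).
Proof. by apply: measurableI; exact: measurable_set_ltr. Qed.

Let inv_gt0 m : (0 : R) < m.+1%:R^-1. Proof. by rewrite invr_gt0. Qed.

Let low_lt m : low m < u. Proof. by rewrite ltrBlDr ltrDl. Qed.
Let high_gt m : u < high m. Proof. by rewrite ltrDl. Qed.

Let gapE : \bigcup_m gap m = [set w | V w < u < W w].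
Proof.
apply/seteqP; split => [w [m _ [h1 h2]]|w /= /andP[h1 h2]].
  by rewrite /= (lt_trans h1 (low_lt m)) (lt_trans (high_gt m) h2).
have r0 : 0 < Num.min (u - V w) (W w - u) by rewrite lt_min !subr_gt0 h1.
have [m _ /(_ m (leqnn m))] := near_inv_nat r0; rewrite lt_min => /andP[h3 h4].
by exists m => //; rewrite /gap /low /high /=; split; move: h3 h4; move: m.+1%:R^-1 => e; lra.
Qed.

Let mcross : measurable [set w | V w < u < W w].
Proof. by rewrite -gapE; apply: bigcup_measurable. Qed.

Let pE : P' [set w | V w < u < W w] = p%:E.
Proof. by rewrite /p fineK// fin_num_measure. Qed.

Let p_E m : P' (gap m) = (p_ m)%:E.
Proof. by rewrite /p_ fineK// fin_num_measure. Qed.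

Let p_ge0 : 0 <= p. Proof. by rewrite /p fine_ge0. Qed.

Let p_le m : p_ m <= p.
Proof.
rewrite -lee_fin -pE -p_E; apply: le_measure; rewrite ?inE// -gapE.
exact: bigcup_sup.
Qed.

Let cvg_p : p_ m @[m --> \oo] --> p.
Proof.
have c : P' (gap m) @[m --> \oo] --> P' (\bigcup_m gap m).
  apply: nondecreasing_cvg_mu => //; first by rewrite gapE.
  move=> m k mk; apply/subsetPset => w [h1 h2].
  have : (k.+1%:R^-1 : R) <= m.+1%:R^-1 by rewrite lef_pV2 ?posrE// ler_nat ltnS.
  by rewrite /gap /low /high /= in h1 h2 *; move: m.+1%:R^-1 k.+1%:R^-1 h1 h2 => x y *; split; lra.
rewrite gapE pE in c; exact: (fine_cvg c).
Qed.

(** Any tick of the clock, whatever values J takes: such cells contain every detected one, pass to a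
    half under refinement, and number at most lambda T on average. *)
Let B n i := [set w | (nu (g n i) w < nu (g n i.+1) w)%N].
Let E m n i := if (i.+1 < 2 ^ n)%N then
  [set w | Z (g n i.+1) w + J (g n i) w < low m /\ high m < Z (g n i.+1) w + J (g n i.+1) w] else set0.

Let mB n i : measurable (B n i).
Proof. by apply: (@measurable_nat_rel _ _ _ _ (fun x y => (x < y)%N)); exact: measurable_funPT. Qed.

Let mE m n i : measurable (E m n i).
Proof.
rewrite /E; case: ifP => // _.
by apply: measurable_gap => //; apply: mJ; exact: grid_ge0.
Qed.

Let g_step n i : (i < 2 ^ n)%N -> [/\ 0 <= g n i, g n i < g n i.+1 & g n i.+1 <= T].
Proof. by move=> hi; split; [exact: grid_ge0|exact: grid_ltS|exact: grid_leT]. Qed.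

Let P_B n : (\sum_(0 <= i < 2 ^ n) P (B n i) <= (lambda * T)%:E)%E.
Proof.
rewrite -[X in (_ * X)%:E](mh n) mulrCA; apply: cell_sum_le => i /g_step[g0 gg _].
by have := jump_prob_le lambda_gt0 nu_poisson g0 gg; rewrite grid_step.
Qed.

Let low_high m : low m <= high m.
Proof. by apply/ltW/lt_trans; [exact: low_lt|exact: high_gt]. Qed.

Let cell_bound m n i : (i.+1 < 2 ^ n)%N ->
  ((lambda * h n * expR (- (lambda * h n)) * p_ m)%:E <= P (E m n i))%E /\
  (P (E m n i) <= (lambda * h n * p_ m + (lambda * h n) ^+ 2)%:E)%E.
Proof.
move=> hi; have [g0 gg gT] := g_step (ltnW hi).
have := gap_cell rho_lt1 lambda_gt0 eps_indep eps_law nu_poisson eps_nu JE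
  Z_gaussian Z_centered Z_cov Gamma0 ZJ_indep g0 gg gT VW_trig (low_high m).
by rewrite grid_step /E hi.
Qed.

Let P_E_le m n : (\sum_(0 <= i < 2 ^ n) P (E m n i) <= (lambda * T * p + lambda ^+ 2 * T * h n)%:E)%E.
Proof.
rewrite (_ : lambda * T * p + _ = 2 ^+ n * (lambda * h n * p + (lambda * h n) ^+ 2)); last first.
  transitivity (lambda * (2 ^+ n * h n) * p + lambda ^+ 2 * (2 ^+ n * h n) * h n); first by rewrite mh.
  by ring.
have x0 : 0 <= lambda * h n by rewrite mulr_ge0 ?ltW.
apply: cell_sum_le => i hi; have [hi'|hi'] := boolP (i.+1 < 2 ^ n)%N.
  have [_ /le_trans] := cell_bound m hi'; apply; rewrite lee_fin lerD2r.
  by rewrite ler_wpM2l.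
rewrite /E (negbTE hi') measure0 lee_fin; apply: addr_ge0; first exact: mulr_ge0.
exact: sqr_ge0.
Qed.

Let P_E_ge m n : (((T - h n) * (lambda * expR (- (lambda * h n)) * p_ m))%:E <=
  \sum_(0 <= i < 2 ^ n) P (E m n i))%E.
Proof.
rewrite (_ : _ * _ = (2 ^+ n - 1) * (lambda * h n * expR (- (lambda * h n)) * p_ m)); last first.
  transitivity ((2 ^+ n * h n - h n) * (lambda * expR (- (lambda * h n)) * p_ m)); first by rewrite mh.
  by ring.
by apply: cell_sum_ge => // i hi; have [] := cell_bound m hi.
Qed.

Let X w t := Z t w + J t w.
Let S w := discontinuous_upcrossings T u (X w).

Lemma expected_discontinuous_upcrossings : measurable_fun setT (fun w => counting (S w) : \bar R) /\
  (\int[P]_w (counting (S w) : \bar R) = (lambda * T)%:E * P' [set w | (V w < u < W w)%R])%E.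
Proof.
pose alpha w k := ar_chain rho (fun n => eps n : Omega -> R) k w.
have alphaE w (t : R) : 0 <= t -> J t w = alpha w (nu t w) by exact: JE.
have S_T w s : S w s -> 0 < s < T by case.
have E_point m w : \forall n \near \oo, forall i, (i < 2 ^ n)%N -> E m n i w ->
    exists2 s, S w s & grid T n i < s <= grid T n i.+1.
  have := @discontinuous_upcrossing_of_cell _ T T_gt0 u (fun t => Z t w) (fun t => J t w)
    (fun t => nu t w) (alpha w) (Z_C1 w) (nu_path w) (alphaE w) _ (inv_gt0 m).
  apply: filterS => n H i _; rewrite /E; case: ifP => // hi [h1 h2].
  exact: H.
have point_E w s : S w s -> \forall m \near \oo, \forall n \near \oo,
    forall i, grid T n i < s <= grid T n i.+1 -> E m n i w.
  move=> Sws; have := @cell_of_discontinuous_upcrossing _ T T_gt0 u (fun t => Z t w) (fun t => J t w)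
    (fun t => nu t w) (alpha w) (Z_C1 w) (nu_path w) (alphaE w) s Sws.
  apply: filterS => m; apply: filterS => n H i hi; have [h1 h2 h3] := H i hi.
  by rewrite /E h1.
have E_B m n i : E m n i `<=` B n i.
  rewrite /E; case: ifP => [hi w [h1 h2]|_ w //]; have [g0 gg gT] := g_step (ltnW hi).
  have [_ mono _ _] := nu_path w; rewrite /B /= ltn_neqAle mono ?(ltW gg)// andbT.
  apply/eqP => e; move: h1 h2; rewrite !JE ?e//; last exact: grid_ge0.
  by have := low_high m; lra.
have B_B n i : B n i `<=` B n.+1 i.*2 `|` B n.+1 i.*2.+1.
  move=> w; have gl : g n.+1 i.*2 = g n i := grid_refine T n i.
  have gr : g n.+1 i.*2.+2 = g n i.+1 by rewrite -doubleS grid_refine.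
  rewrite /B /setU /= gl gr => hw.
  by have [h1|h1] := ltnP (nu (g n i) w) (nu (g n.+1 i.*2.+1) w); [left|right;
    exact: leq_ltn_trans h1 hw].
have cvg_a : lambda * T * p + lambda ^+ 2 * T * h n @[n --> \oo] --> lambda * T * p.
  rewrite -[X in _ --> X]addr0 -[X in _ + X](mulr0 (lambda ^+ 2 * T)).
  by apply: cvgD; [exact: cvg_cst|apply: cvgMr; exact: cvg_h].
(* The loss due to the margin is lambda T (p - p_m), and p_m increases to p by continuity of the
   measure. *)
have cvg_b m : (T - h n) * (lambda * expR (- (lambda * h n)) * p_ m) @[n --> \oo] -->
    lambda * T * p - lambda * T * (p - p_ m).
  rewrite (_ : _ - _ = (T - 0) * (lambda * 1 * p_ m)); last by ring.
  apply: cvgM; first by apply: cvgB; [exact: cvg_cst|exact: cvg_h].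
  by apply: cvgMl; apply: cvgMr; exact: cvg_expR_h.
have cvg_d : lambda * T * (p - p_ m) @[m --> \oo] --> (0 : R).
  rewrite [X in _ --> X](_ : 0 = lambda * T * (p - p)); last by rewrite subrr mulr0.
  apply: cvgMr.
  by apply: cvgB; [exact: cvg_cst|exact: cvg_p].
split.
- exact: (measurable_counting T_gt0 S_T mE E_point point_E).
- rewrite pE -EFinM.
  exact: (expected_counting T_gt0 S_T mE mB E_point point_E E_B B_B P_B P_E_le P_E_ge cvg_a cvg_b cvg_d).
Qed.

End discontinuous_part.

End expectations.

Theorem theorem6 (R : realType)
    (d : measure_display) (Omega : measurableType d) (P : probability Omega R)
    (T u rho lambda : R)
    (Z : R -> {RV P >-> R}) (Gamma : R -> R) (J : R -> Omega -> R)
    (d' : measure_display) (Omega' : measurableType d')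
    (P' : probability Omega' R) (V W : {RV P' >-> R})
    (T_gt0 : 0 < T) (rho_lt1 : `|rho| < 1) (lambda_gt0 : 0 < lambda)
    (Z_gaussian : gaussian_process P `[0, T] Z)
    (Z_centered : centered_process P `[0, T] Z)
    (Z_stationary : stationary_process P `[0, T] Z)
    (Z_C1 : forall w, C1_on 0 T (fun t => Z t w))
    (Z_cov : covariance_function P `[0, T] Z Gamma)
    (Gamma0 : Gamma 0 = 1 / 2)
    (J_PAR : PAR_process P rho lambda J)
    (ZJ_indep : independent_systems P
       (sigma_of `[0, T] (fun t => Z t : Omega -> R))
       (sigma_of [set t : R | 0 <= t] J))
    (VW_gaussian : centered_gaussian_pair P' V W)
    (V_var : ('E_P'[(V : Omega' -> R) ^+ 2] = 1)%E)
    (W_var : ('E_P'[(W : Omega' -> R) ^+ 2] = 1)%E)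
    (VW_cov : ('E_P'[(V : Omega' -> R) * W] = ((1 + rho) / 2)%R%:E)%E) :
  let X := fun (w : Omega) (t : R) => Z t w + J t w in
  let Uc := fun w => nb_cont_up T u (X w) in
  let Ud := fun w => nb_disc_up T u (X w) in
  (measurable_fun setT Uc /\
   (\int[P]_w Uc w =
     (T * Num.sqrt (- derive1n 2 Gamma 0 / (2 * pi)) * normal_pdf 0 1 u)%R%:E)%E) /\
  (measurable_fun setT Ud /\
   (\int[P]_w Ud w =
     (lambda * T)%R%:E * P' [set w | V w < u < W w]%R)%E).
Proof.
have [eps [nu [[eps_indep eps_law] nu_poisson eps_nu JE]]] := J_PAR.
move=> X Uc Ud; split.
- have [mU ->] := expected_continuous_upcrossings rho_lt1 lambda_gt0 eps_indep eps_law nu_poisson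
    eps_nu JE u T_gt0 Z_gaussian Z_centered Z_C1 Z_cov Gamma0 ZJ_indep.
  split => //; congr EFin.
  have [s2 _] := covariance_second_derivative T_gt0 Z_gaussian Z_centered Z_C1 Z_cov.
  (* [normal_peak 1] is 1/sqrt(2 pi); splitting the square root of the quotient uses - Gamma''(0) >=
     0. *)
  rewrite sqrtrM// sqrtrV ?mulr_ge0 ?pi_ge0// /normal_peak expr1n mul1r -mulr_natl.
  by ring.
- have [Vsums V0 W0] := VW_gaussian.
  have VW_trig := gaussian_pair_trig (measurable_funPT V) (measurable_funPT W) Vsums V0 W0 V_var W_var VW_cov.
  exact: (expected_discontinuous_upcrossings rho_lt1 lambda_gt0 eps_indep eps_law nu_poisson
    eps_nu JE u T_gt0 Z_gaussian Z_centered Z_C1 Z_cov Gamma0 ZJ_indep VW_trig).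
Qed.
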